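(* Let $\delta\in(0,2)$ be arbitrary, let $\Pi_\alpha$ be the spike and slab prior with slab density $\gamma(x)=c_\gamma(1+|x|)^{-1-\delta}$, and let $q\in(0,2]$ with $q>\delta$. Suppose $s\to\infty$, $s=o(n)$ and $\kappa_1\log^2n\le s$ for some constant $\kappa_1>0$. For $M>0$ and $\alpha=\alpha(n)\in(0,1)$ (deterministic, possibly depending on $n$) let $$\mathcal C_{q,\alpha}=\{\theta\in\mathbb R^n:\ d_q(\theta,\hat\theta_\alpha)\le M\,v_{q,\alpha}(X)\},\qquad v_{q,\alpha}(X)=\int d_q(\theta,\hat\theta_\alpha)\,d\Pi_\alpha(\theta\mid X).$$ (i) If $s\log^{\delta/2}(n/s)/n\lesssim\alpha\le\alpha_1$ for a sufficiently small constant $\alpha_1>0$, then for some sufficiently large choice of $M$, as $n\to\infty$, $$\inf_{\theta_0\in\ell_0[s]}P_{\theta_0}(\theta_0\in\mathcal C_{q,\alpha})\to1.$$ (ii) If $\alpha=o\big(s\log^{\delta/2}(n/s)/n\big)$, then for arbitrary $M>0$, as $n\to\infty$, $$\sup_{\theta_0\in\tilde\Theta_{s,\alpha}}P_{\theta_0}(\theta_0\in\mathcal C_{q,\alpha})\to0,$$ where $\tilde\Theta_{s,\alpha}=\big\{\theta\in\ell_0[s]:\ |\{i:\ t(\alpha)/8\le|\theta_i|\le t(\alpha)/4\}|=s\big\}$.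
   Context: Model: one observes $X=(X_1,\dots,X_n)$ with $X_i=\theta_i+\varepsilon_i$, $\varepsilon_i$ i.i.d. $N(0,1)$; $P_\theta$ is the law of $X$. $s=s_n$ is a sequence of integers, $\ell_0[s]=\{\theta\in\mathbb R^n: |\{i:\theta_i\ne0\}|\le s\}$, $d_q(\theta,\theta')=\sum_{i=1}^n|\theta_i-\theta_i'|^q$. $a_n\lesssim b_n$ means $a_n\le Cb_n$ for some constant $C>0$. Prior and posterior: $\phi$ is the standard normal density; $c_\gamma$ is the normalising constant of $\gamma$; $g=\phi*\gamma$. $\Pi_\alpha=\otimes_{i=1}^n((1-\alpha)\delta_0+\alpha G)$, where $G$ has density $\gamma$. The posterior is $\Pi_\alpha[\cdot\mid X]=\otimes_{i=1}^n\big((1-a_\alpha(X_i))\delta_0+a_\alpha(X_i)\gamma_{X_i}(\cdot)\big)$, where $\gamma_x(u)=\phi(x-u)\gamma(u)/g(x)$ and $a_\alpha(x)=\alpha g(x)/\{(1-\alpha)\phi(x)+\alpha g(x)\}$. $\hat\theta_\alpha$ is the vector of coordinatewise medians of the posterior; $t(\alpha)>0$ is its threshold: $(\hat\theta_\alpha)_i=0$ if and only if $|X_i|\le t(\alpha)$. *)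

(* Defs.v *)
From HB Require Import structures.
From mathcomp Require Import all_boot all_order all_algebra.
From mathcomp Require Import all_classical all_reals all_analysis.

Set Implicit Arguments.
Unset Strict Implicit.
Unset Printing Implicit Defensive.

Import Order.TTheory GRing.Theory Num.Theory.
Import numFieldNormedType.Exports.

Local Open Scope classical_set_scope.
Local Open Scope ring_scope.

(* m_0 (x) ... (x) m_(n-1) on [n.-tuple T]. The factors are plain set
   functions, so that densities can be used without bundling proofs;
   [product_measure_probability] and [product_measure_box] say what it is when
   the factors are probability measures. *)
Fixpoint product_measure d (T : measurableType d) (R : realType) (n : nat) :
    ('I_n -> set T -> \bar R) -> set (n.-tuple T) -> \bar R :=
  match n with
  | 0 => fun _ => dirac [tuple]
  | k.+1 => fun m =>
      pushforward
        (product_measure1 (m ord0)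
          (product_measure (fun i : 'I_k => m (lift ord0 i))))
        (fun p : T * k.-tuple T => [the k.+1.-tuple T of p.1 :: p.2])
  end.

Section product_measure_probabilities.
Context d (T : measurableType d) (R : realType).

Lemma product_measure_probability n (m : 'I_n -> probability T R) :
  exists P : probability (n.-tuple T) R,
    P = product_measure (fun i => m i) :> (set (n.-tuple T) -> \bar R).
Proof.
elim: n m => [|k IHk] m; first by exists (dirac [tuple]).
have [P /= <-] := IHk (fun i => m (lift ord0 i)).
pose X := fun p : T * k.-tuple T => [the k.+1.-tuple T of p.1 :: p.2].
have mX : measurable_fun setT X by apply: measurable_cons.
pose X' : {mfun (T * k.-tuple T)%type >-> k.+1.-tuple T} :=
  HB.pack X (isMeasurableFun.Build _ _ _ _ X mX).
pose Q : probability (T * k.-tuple T)%type R :=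
  [the probability _ _ of product_measure1 (m ord0) P].
by exists (distribution Q X').
Qed.

Lemma product_measure_box n (m : 'I_n -> probability T R)
    (A : 'I_n -> set T) : (forall i, measurable (A i)) ->
  product_measure (fun i => m i) [set x | forall i, A i (tnth x i)] =
  (\prod_(i < n) m i (A i))%E.
Proof.
elim: n m A => [|n IHn] m A mA /=.
  by rewrite big_ord0 diracE mem_set // => -[].
rewrite big_ord_recl /pushforward.
pose B := [set x : n.-tuple T | forall i, A (lift ord0 i) (tnth x i)].
have mB : measurable B.
  rewrite (_ : B = \bigcap_(i in [set: 'I_n])
      ((@tnth n T)^~ i @^-1` A (lift ord0 i))).
    apply: fin_bigcap_measurable => // i _.
    rewrite -[X in measurable X]setTI; exact: measurable_tnth.
  by apply/seteqP; split=> x /= h i => [_|]; apply: h.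
rewrite [X in product_measure1 _ _ X](_ : _ = A ord0 `*` B).
  rewrite -IHn //.
  have [P <-] := product_measure_probability (fun i => m (lift ord0 i)).
  by rewrite product_measure1E.
apply/seteqP; split=> -[a x] /=.
  by move=> h; split=> [|i]; [have := h ord0 |
    have := h (lift ord0 i); rewrite tnthS].
by case=> Aa Bx i; case: (unliftP ord0 i) => [j ->|->] //; rewrite tnthS.
Qed.

End product_measure_probabilities.

Section spike_and_slab.
Context {R : realType}.
Local Notation mu := (@lebesgue_measure R).
(* [R^n] with the sigma-algebra on [R] that carries [lebesgue_measure] and
   [normal_prob]. *)
Local Notation mvec n := (n.-tuple (measurableTypeR R)).
Implicit Types (delta alpha q x u M : R) (n s : nat).

Definition l0_ball n s : set (n.-tuple R) :=
  [set theta : n.-tuple R | (#|[pred i | tnth theta i != 0%R]| <= s)%N].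
Arguments l0_ball : clear implicits.

(* For [0 < q], [0 `^ q = 0], so null differences do not contribute. *)
Definition dist_q q n (theta theta' : n.-tuple R) : R :=
  \sum_(i < n) `|tnth theta i - tnth theta' i| `^ q.

Definition law n (theta : n.-tuple R) : set (mvec n) -> \bar R :=
  product_measure (T := measurableTypeR R)
    (fun i => normal_prob (tnth theta i) 1).

Definition phi : R -> R := normal_pdf 0 1.

Definition slab_constant delta : R :=
  (\int[mu]_x ((1 + `|x|) `^ (- 1 - delta)))^-1.

Definition slab delta x : R :=
  slab_constant delta * (1 + `|x|) `^ (- 1 - delta).

Definition slab_convolution delta x : R :=
  \int[mu]_u (phi (x - u) * slab delta u).

(* (1 - w) delta_0 + w F, where F has Lebesgue density f *)
Definition spike_slab (w : R) (f : R -> R) (A : set R) : \bar R :=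
  ((1 - w)%:E * \d_(0%R : measurableTypeR R) A +
   w%:E * \int[mu]_(u in A) (f u)%:E)%E.

Definition prior delta alpha n : set (mvec n) -> \bar R :=
  product_measure (T := measurableTypeR R)
    (fun=> spike_slab alpha (slab delta)).
Arguments prior : clear implicits.

(* Bayes' rule for one observation [x ~ N(u, 1)] with [u] drawn from
   [spike_slab alpha (slab delta)]: the slab is tilted by the likelihood and the
   weights of spike and slab are multiplied by the marginal densities [phi x]
   and [slab_convolution delta x]. *)
Definition posterior_slab delta x u : R :=
  phi (x - u) * slab delta u / slab_convolution delta x.

Definition posterior_weight delta alpha x : R :=
  alpha * slab_convolution delta x /
  ((1 - alpha) * phi x + alpha * slab_convolution delta x).

Definition coord_posterior delta alpha x : set R -> \bar R :=
  spike_slab (posterior_weight delta alpha x) (posterior_slab delta x).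

Definition posterior delta alpha n (X : n.-tuple R) :
    set (mvec n) -> \bar R :=
  product_measure (T := measurableTypeR R)
    (fun i => coord_posterior delta alpha (tnth X i)).

Definition is_median (P : set R -> \bar R) (m : R) : Prop :=
  ((2^-1)%:E <= P `]-oo, m]%classic)%E /\ ((2^-1)%:E <= P `[m, +oo[%classic)%E.

(* For [0 < alpha < 1] the slab part of a coordinate posterior has positive
   weight and positive density everywhere, so the median is unique. *)
Definition median (P : set R -> \bar R) : R := xget 0 [set m | is_median P m].

Definition posterior_median delta alpha n (X : n.-tuple R) : n.-tuple R :=
  [tuple median (coord_posterior delta alpha (tnth X i)) | i < n].

Definition is_threshold delta alpha t : Prop :=
  0 < t /\
  forall x, median (coord_posterior delta alpha x) = 0 <-> `|x| <= t.

(* For [0 < alpha < 1] the median is odd and nondecreasing in the observation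
   and vanishes exactly on some interval [-t, t] with [0 < t], so the threshold
   exists and is unique. *)
Definition threshold delta alpha : R :=
  xget 0 [set t | is_threshold delta alpha t].

Definition posterior_spread delta alpha q n (X : n.-tuple R) : \bar R :=
  (\int[posterior delta alpha X]_theta
     (dist_q q theta (posterior_median delta alpha X))%:E)%E.

Definition credible_set delta alpha q M n (X : n.-tuple R) :
    set (n.-tuple R) :=
  [set theta : n.-tuple R |
    ((dist_q q theta (posterior_median delta alpha X))%:E <=
     M%:E * posterior_spread delta alpha q X)%E].

Definition coverage delta alpha q M n (theta0 : n.-tuple R) : \bar R :=
  law theta0 [set X | credible_set delta alpha q M X theta0].

Definition intermediate_signals delta alpha n s : set (n.-tuple R) :=
  l0_ball n s `&`
  [set theta : n.-tuple R |
    #|[pred i | threshold delta alpha / 8 <= `|tnth theta i|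
                <= threshold delta alpha / 4]| = s].
Arguments intermediate_signals : clear implicits.

(* Only meaningful when [0 < s n < n], which holds eventually when [s] tends to
   infinity and is o(n). *)
Definition rate delta (s : nat -> nat) n : R :=
  (s n)%:R * (ln (n%:R / (s n)%:R) `^ (delta / 2)) / n%:R.

End spike_and_slab.

Arguments l0_ball {R}.
Arguments prior {R}.
Arguments intermediate_signals {R}.

(* Main.v *)
(* The posterior factorizes over coordinates. At an observation x its slab
   weight is at most of order alpha * slab(x) / phi(x), the median is 0 when that
   weight is below 1/2, and the slab part is concentrated at distance O(1) from
   x. Put tau = sqrt(ln(1 / alpha)), which is of the order of the threshold.

   A null coordinate contributes about alpha * tau^(q - delta) to the expected
   spread; this is where delta < q enters, since the integral of
   |x|^(q - 1 - delta) up to tau is then carried by |x| of order tau. Its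
   contribution to the loss is at most of the same order. A signal contributes
   at most O(tau^q) to the loss. If s * tau^delta = O(n * alpha), the null
   coordinates alone make the spread dominate the loss, and Chebyshev's
   inequality gives coverage 1 - O(1 / s) uniformly over the l0 ball. If
   n * alpha = o(s * tau^delta), then signals between t / 8 and t / 4 are
   estimated by 0 up to a negligible fraction, so the loss is at least of order
   s * t^q, while each of them contributes only O(1) to the expected spread;
   Markov's inequality then bounds the coverage by
   O(n * alpha / (s * tau^delta) + tau^(-q)). The assumption on alpha decides
   between the two cases because tau^2 is comparable to ln(n / s) at the critical
   rate. *)
Require Import Defs.
From HB Require Import structures.
From mathcomp Require Import all_boot all_order all_algebra.
From mathcomp Require Import all_classical all_reals all_analysis.
From mathcomp Require Import measurable_realfun.
From mathcomp Require Import ring lra.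
Import Order.TTheory GRing.Theory Num.Theory.
Import numFieldNormedType.Exports.

Set Implicit Arguments.
Unset Strict Implicit.
Unset Printing Implicit Defensive.

Local Open Scope classical_set_scope.
Local Open Scope ring_scope.

(** * Product measures *)

(** The law is therefore evaluated on arbitrary sets, where only its monotonicity is available. The
    event is compared, by inclusion, with events about sums over coordinates of explicit measurable
    functions: [risk_bound] as a majorant, [null_spread_lower] as a minorant, and for the signals a
    square of the noise or an indicator. The median enters through deterministic inequalities at
    each observation only.

    The scale tau is defined exactly by [alpha = expR (- tau ^+ 2)] and stands in for the threshold.
    At [|x| <= tau] the noise density is at least of order sqrt(alpha), so alpha / phi(x) is still
    small: tau lies below the threshold with room to spare, and crude comparisons between the two
    suffice.

    Gaussian moments are bounded, not computed: a polynomial factor of degree at most 6 is absorbed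
    by passing from standard deviation 1 to 2. Most powers of 2 in the constants come from this and
    from the cubic variation of the slab. *)

Section integral_monotone.
Local Open Scope ereal_scope.
Context d (T : measurableType d) (R : realType).

(* Unlike [ge0_le_integral], no measurability is required: the integral of a
   nonnegative function is a supremum over the simple functions below it. *)
Lemma ge0_le_integral_nonmeasurable (m : {measure set T -> \bar R})
    (f g : T -> \bar R) :
  (forall x, 0 <= f x) -> (forall x, f x <= g x) ->
  \int[m]_x f x <= \int[m]_x g x.
Proof.
move=> f0 fg; have g0 x : 0 <= g x := le_trans (f0 x) (fg x).
rewrite !ge0_integralTE//; apply: le_ereal_sup => _ [h hf <-].
by exists h => // x; exact: le_trans (hf x) (fg x).
Qed.

(** The product measure of any set is an iterated integral of the measures of its sections, so
    induction works for sets that need not be measurable. Coverage events are handled through this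
    inequality. *)
Lemma product_measure_monotone n (m : 'I_n -> probability T R)
    (A B : set (n.-tuple T)) : A `<=` B ->
  product_measure (fun i => m i) A <= product_measure (fun i => m i) B.
Proof.
elim: n m A B => [|n IHn] m A B AB /=.
  by rewrite !diracE lee_fin ler_nat; case: (boolP ([tuple] \in A)) => //;
    rewrite inE => /AB ?; rewrite mem_set.
have [P PE] := product_measure_probability (fun i => m (lift ord0 i)).
rewrite /pushforward /product_measure1/=.
apply: ge0_le_integral_nonmeasurable => x /=; last first.
  by apply: IHn => y; rewrite /xsection/= !inE; exact: AB.
(* Nonnegativity on an arbitrary section comes from comparison with the empty set. *)
by rewrite -[X in _ <= X]/(product_measure _ _)
  (le_trans _ (IHn _ set0 _ _))// -PE measure0.
Qed.

End integral_monotone.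

Lemma ge0_markov d (T : measurableType d) (R : realType)
    (P : probability T R) (f : T -> R) (b c : R) :
  measurable_fun setT f -> (forall x, 0 <= f x) -> 0 < c ->
  (\int[P]_x (f x)%:E <= b%:E)%E ->
  (P [set x | (c <= f x)%R] <= (b / c)%:E)%E.
Proof.
move=> mf f0 c0 bP.
rewrite EFinM lee_pdivlMr//; apply: le_trans bP; rewrite muleC.
have mA : measurable [set x | (c <= f x)%R].
  by rewrite -[X in measurable X]setTI; exact: measurable_fun_le.
rewrite -[X in (_ * P X)%E]setIT -integral_indic//.
rewrite -ge0_integralZl_EFin ?(ltW c0)//; last exact/measurable_EFinP.
apply: ge0_le_integral => //.
- by move=> x _; rewrite -EFinM lee_fin mulr_ge0// ltW.
- by apply: measurable_funeM; exact/measurable_EFinP.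
- exact/measurable_EFinP.
move=> x _; rewrite -EFinM lee_fin indicE.
case: (boolP (x \in _)) => /= [|_]; first by rewrite inE mulr1.
by rewrite mulr0.
Qed.

(** * Moments of coordinate sums under a product measure *)

Section product_moments.
Local Open Scope ereal_scope.
Context d (T : measurableType d) (R : realType) (n : nat).
Variables (m : 'I_n -> probability T R) (P : probability (n.-tuple T) R).
Hypothesis PE : P = product_measure (fun i => m i) :> (set (n.-tuple T) -> \bar R).

Lemma product_measure_marginal (i : 'I_n) (A : set T) : measurable A ->
  P ((fun x : n.-tuple T => tnth x i) @^-1` A) = m i A.
Proof.
move=> mA; pose B j := if j == i then A else setT.
have -> : (fun x : n.-tuple T => tnth x i) @^-1` A =
    [set x | forall j, B j (tnth x j)].
  apply/seteqP; split => x /= => [Ax j|/(_ i)]; last by rewrite /B eqxx.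
  by rewrite /B; case: eqP => // ->.
rewrite PE product_measure_box; last by move=> j; rewrite /B; case: ifP.
rewrite (bigD1 i)//= /B eqxx big1 ?mule1// => j /negPf ->.
exact: probability_setT.
Qed.

Lemma product_measure_marginal2 (i j : 'I_n) (A B : set T) : i != j ->
  measurable A -> measurable B ->
  P ((fun x : n.-tuple T => (tnth x i, tnth x j)) @^-1` (A `*` B)) =
  m i A * m j B.
Proof.
move=> ij mA mB.
pose C k := if k == i then A else if k == j then B else setT.
have -> : (fun x : n.-tuple T => (tnth x i, tnth x j)) @^-1` (A `*` B) =
    [set x | forall k, C k (tnth x k)].
  apply/seteqP; split => x /= => [[Ax Bx] k|Cx].
    by rewrite /C; case: eqP => [->//|_]; case: eqP => // ->.
  by split; [have := Cx i|have := Cx j];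
    rewrite /C ?eqxx// eq_sym (negPf ij).
rewrite PE product_measure_box; last first.
  by move=> k; rewrite /C; case: ifP => // _; case: ifP.
rewrite (bigD1 i)//= (bigD1 j)/= 1?eq_sym// {1 2}/C !eqxx.
rewrite [X in if X then A else B]eq_sym (negPf ij) big1 ?mule1//.
by move=> k /andP[/negPf ki /negPf kj]; rewrite /C ki kj; exact: probability_setT.
Qed.

Lemma ge0_integral_coordinate (i : 'I_n) (f : T -> \bar R) :
  measurable_fun setT f -> (forall x, 0 <= f x) ->
  \int[P]_x f (tnth x i) = \int[m i]_y f y.
Proof.
move=> mf f0.
have mX : measurable_fun setT (fun x : n.-tuple T => tnth x i).
  exact: measurable_tnth.
pose X : {mfun n.-tuple T >-> T} := HB.pack (fun x : n.-tuple T => tnth x i)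
  (isMeasurableFun.Build _ _ _ _ _ mX).
have := @ge0_integral_pushforward _ _ _ _ R _ mX P setT f measurableT mf.
rewrite preimage_setT => <-//; apply: (eq_measure_integral (m i)).
by move=> A mA _; exact: product_measure_marginal.
Qed.

(** The joint law of two coordinates agrees with [m i \x m j] on rectangles, hence everywhere, and
    Tonelli factors the integral. This pairwise independence is what the second moment of a sum
    requires. *)
Lemma ge0_integral_coordinate2 (i j : 'I_n) (f g : T -> R) : i != j ->
  measurable_fun setT f -> (forall x, 0 <= f x)%R ->
  measurable_fun setT g -> (forall x, 0 <= g x)%R ->
  \int[P]_x (f (tnth x i) * g (tnth x j))%:E =
  (\int[m i]_y (f y)%:E) * (\int[m j]_y (g y)%:E).
Proof.
move=> ij mf f0 mg g0.
have mX : measurable_fun setT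
    (fun x : n.-tuple T => (tnth x i, tnth x j)).
  exact: (measurable_fun_pair (measurable_tnth i) (measurable_tnth j)).
pose X : {mfun n.-tuple T >-> (T * T)%type} :=
  HB.pack (fun x : n.-tuple T => (tnth x i, tnth x j))
    (isMeasurableFun.Build _ _ _ _ _ mX).
pose h (z : T * T) := (f z.1 * g z.2)%:E.
have mh : measurable_fun setT h.
  apply/measurable_EFinP/measurable_funM.
  - exact: (measurableT_comp mf measurable_fst).
  - exact: (measurableT_comp mg measurable_snd).
have h0 z : 0 <= h z by rewrite lee_fin mulr_ge0.
have := @ge0_integral_pushforward _ _ _ _ R _ mX P setT h measurableT mh.
rewrite preimage_setT => /(_ (fun z _ => h0 z)) <-.
rewrite (eq_measure_integral (m i \x m j)); last first.
  move=> A mA _.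
  have := @product_measure_unique _ _ _ _ _ (m i) (m j) (distribution P X).
  move=> H; apply/esym/H => // B C mB mC.
  exact: product_measure_marginal2.
rewrite fubini_tonelli1//= /fubini_F/= /h/=.
under eq_integral.
  move=> x _; under eq_integral do rewrite EFinM.
  rewrite ge0_integralZl_EFin//; last 2 first.
  - by move=> y _; rewrite lee_fin.
  - exact/measurable_EFinP.
  over.
rewrite ge0_integralZr//.
- exact/measurable_EFinP.
- by move=> y _; rewrite lee_fin.
- by apply: integral_ge0 => y _; rewrite lee_fin.
Qed.

Section sums.
Variable f : 'I_n -> T -> R.
Hypothesis mf : forall i, measurable_fun setT (f i).
Hypothesis f0 : forall i x, (0 <= f i x)%R.
Let S (x : n.-tuple T) := (\sum_(i < n) f i (tnth x i))%R.

Lemma measurable_coordinate_sum : measurable_fun setT S.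
Proof.
apply: measurable_sum => i; apply: measurableT_comp => //.
exact: measurable_tnth.
Qed.

Lemma coordinate_sum_ge0 x : (0 <= S x)%R.
Proof. exact: sumr_ge0. Qed.

Lemma measurable_deviation (M c : R) :
  measurable [set x | (c <= `|S x - M|)%R].
Proof.
rewrite -[X in measurable X]setTI; apply: measurable_fun_le => //.
apply: measurableT_comp => //; apply: measurable_funB => //.
exact: measurable_coordinate_sum.
Qed.

Lemma integral_coordinate_sum :
  \int[P]_x (S x)%:E = \sum_(i < n) \int[m i]_y (f i y)%:E.
Proof.
under eq_integral do rewrite -sumEFin.
rewrite ge0_integral_sum//.
- apply: eq_bigr => i _.
  rewrite (@ge0_integral_coordinate i (EFin \o f i))//; last first.
    by move=> x; rewrite lee_fin.
  exact/measurable_EFinP.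
- move=> i; apply/measurable_EFinP/measurableT_comp => //.
  exact: measurable_tnth.
- by move=> i x _; rewrite lee_fin.
Qed.

Lemma markov_coordinate_sum (b c : R) : (0 < c)%R ->
  \sum_(i < n) \int[m i]_y (f i y)%:E <= b%:E ->
  P [set x | c <= S x]%R <= (b / c)%:E.
Proof.
move=> c0 bP; apply: ge0_markov => //.
- exact: measurable_coordinate_sum.
- exact: coordinate_sum_ge0.
- by rewrite integral_coordinate_sum.
Qed.

(** Here [v] bounds raw second moments, not variances. Little is lost for rare contributions, whose
    squared mean is small against the second moment. *)
Lemma integral_coordinate_sum_sqr (mu v : 'I_n -> R) :
  (forall i, \int[m i]_y (f i y)%:E = (mu i)%:E) ->
  (forall i, \int[m i]_y (f i y ^+ 2)%:E <= (v i)%:E) ->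
  \int[P]_x (S x ^+ 2)%:E <= (\sum_i v i + (\sum_i mu i) ^+ 2)%:E.
Proof.
move=> muE vE.
have mt i : measurable_fun setT (fun x : n.-tuple T => f i (tnth x i)).
  by apply: measurableT_comp => //; exact: measurable_tnth.
under eq_integral.
  move=> x _; rewrite expr2 mulr_suml -sumEFin.
  under eq_bigr do rewrite mulr_sumr -sumEFin.
  over.
rewrite ge0_integral_sum//; last 2 first.
- move=> i; apply: emeasurable_sum => j.
  exact/measurable_EFinP/measurable_funM.
- by move=> i x _; apply: sume_ge0 => j _; rewrite lee_fin mulr_ge0.
have mu0 i : (0 <= mu i)%R.
  by rewrite -lee_fin -muE; apply: integral_ge0 => x _; rewrite lee_fin.
have -> : (\sum_i v i + (\sum_i mu i) ^+ 2 =
    \sum_i (v i + \sum_j mu i * mu j))%R.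
  rewrite big_split/= expr2 mulr_suml; congr (_ + _)%R.
  by apply: eq_bigr => i _; rewrite mulr_sumr.
rewrite -sumEFin; apply: lee_sum => i _.
rewrite ge0_integral_sum//; last 2 first.
- by move=> j; exact/measurable_EFinP/measurable_funM.
- by move=> j x _; rewrite lee_fin mulr_ge0.
rewrite (bigD1 i)//= EFinD; apply: leeD.
  apply: le_trans (vE i).
  rewrite -(@ge0_integral_coordinate i (fun y => (f i y ^+ 2)%:E)).
  - by under [leRHS]eq_integral do rewrite expr2.
  - exact/measurable_EFinP/measurable_funX.
  - by move=> x; rewrite lee_fin sqr_ge0.
(* The diagonal term [mu i * mu i] on the right is a nonnegative surplus. *)
rewrite [in leRHS](bigD1 i)//= EFinD -sumEFin -[leLHS]add0e; apply: leeD.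
  by rewrite lee_fin mulr_ge0.
apply: lee_sum => j ji.
by rewrite ge0_integral_coordinate2 1?eq_sym// !muE.
Qed.

(* [E (S - mu)^2 + 2 mu E S = E S^2 + mu^2] involves nonnegative integrands
   only, so that the centred second moment needs no integrability. *)
Lemma chebyshev_coordinate_sum (mu v : 'I_n -> R) (c : R) : (0 < c)%R ->
  (forall i, \int[m i]_y (f i y)%:E = (mu i)%:E) ->
  (forall i, \int[m i]_y (f i y ^+ 2)%:E <= (v i)%:E) ->
  P [set x | c <= `|S x - \sum_i mu i|]%R <= ((\sum_i v i) / c ^+ 2)%:E.
Proof.
move=> c0 muE vE; set M := (\sum_i mu i)%R.
have M0 : (0 <= M)%R.
  apply: sumr_ge0 => i _.
  by rewrite -lee_fin -muE; apply: integral_ge0 => x _; rewrite lee_fin.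
have mS := measurable_coordinate_sum.
have mD : measurable_fun setT (fun x => (S x - M) ^+ 2)%R.
  by apply: measurable_funX; exact: measurable_funB.
have -> : [set x | c <= `|S x - M|]%R = [set x | c ^+ 2 <= (S x - M) ^+ 2]%R.
  apply/seteqP; split => x /=.
    by move=> h; rewrite -[leRHS]real_normK ?num_real// lerXn2r// nnegrE ltW.
  rewrite -[leRHS]real_normK ?num_real// ler_pXn2r// nnegrE; exact: ltW.
apply: (@ge0_markov _ _ _ P (fun x => (S x - M) ^+ 2)%R) => //.
- by move=> x; exact: sqr_ge0.
- by rewrite exprn_gt0.
have ES : \int[P]_x (S x)%:E = M%:E.
  by rewrite integral_coordinate_sum -sumEFin; apply: eq_bigr.
rewrite -(@leeD2rE _ (2 * M * M)%:E)//.
have -> : \int[P]_x ((S x - M) ^+ 2)%:E + (2 * M * M)%:E =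
    \int[P]_x (S x ^+ 2)%:E + (M ^+ 2)%:E.
  transitivity (\int[P]_x (((S x - M) ^+ 2)%:E + (2 * M * S x)%:E)).
    rewrite ge0_integralD//.
    - congr (_ + _).
      under eq_integral do rewrite EFinM.
      rewrite ge0_integralZl_EFin//.
      + by rewrite ES.
      + by move=> x _; rewrite lee_fin coordinate_sum_ge0.
      + exact/measurable_EFinP.
      + by rewrite mulr_ge0.
    - by move=> x _; rewrite lee_fin sqr_ge0.
    - exact/measurable_EFinP.
    - by move=> x _; rewrite lee_fin mulr_ge0// ?coordinate_sum_ge0// mulr_ge0.
    - by apply/measurable_EFinP; exact: measurable_funM.
  transitivity (\int[P]_x ((S x ^+ 2)%:E + (M ^+ 2)%:E)).
    by apply: eq_integral => x _; rewrite -!EFinD; congr EFin; ring.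
  rewrite ge0_integralD//.
  - congr (_ + _); transitivity ((M ^+ 2)%:E * P setT); first exact: integral_cst.
    by rewrite probability_setT mule1.
  - by move=> x _; rewrite lee_fin sqr_ge0.
  - by apply/measurable_EFinP; exact: measurable_funX.
  - by move=> x _; rewrite lee_fin sqr_ge0.
apply: (@le_trans _ _ ((\sum_i v i + M ^+ 2)%:E + (M ^+ 2)%:E)).
  by rewrite leeD2r// integral_coordinate_sum_sqr.
by rewrite -!EFinD lee_fin; lra.
Qed.

End sums.
End product_moments.

(** * Integration against measures given by a density *)

Section density.
Local Open Scope ereal_scope.
Context d (T : measurableType d) (R : realType).
Variables (mu nu : {measure set T -> \bar R}) (g : T -> R).
Hypotheses (mg : measurable_fun setT g) (g0 : forall x, (0 <= g x)%R).
Hypothesis nuE : forall A, measurable A -> nu A = \int[mu]_(x in A) (g x)%:E.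

Import HBNNSimple.

(** It serves both the slab part of a posterior and the normal law. The identity passes from
    indicators to simple functions and then to monotone limits. *)
Lemma ge0_integral_density (f : T -> \bar R) : measurable_fun setT f ->
  (forall x, 0 <= f x) -> \int[nu]_x f x = \int[mu]_x (f x * (g x)%:E).
Proof.
move=> mf f0; pose h := nnsfun_approx measurableT mf.
have mg' : measurable_fun setT (EFin \o g) by exact/measurable_EFinP.
have hf x : (h n x)%:E @[n --> \oo] --> f x by exact: cvg_nnsfun_approx.
have -> : \int[nu]_x f x = limn (fun n => \int[nu]_x (h n x)%:E).
  rewrite -monotone_convergence//.
  - by apply: eq_integral => x _; apply/esym/cvg_lim => //; exact: hf.
  - by move=> n; exact/measurable_EFinP.
  - by move=> n x _; rewrite lee_fin.
  - by move=> x _ a b ab; rewrite lee_fin; exact/lefP/nd_nnsfun_approx.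
have -> : \int[mu]_x (f x * (g x)%:E) =
    limn (fun n => \int[mu]_x ((h n x)%:E * (g x)%:E)).
  rewrite -monotone_convergence//.
  - by apply: eq_integral => x _; apply/esym/cvg_lim => //; exact: cvgeZr.
  - by move=> n; apply: emeasurable_funM => //; exact/measurable_EFinP.
  - by move=> n x _; rewrite -EFinM lee_fin mulr_ge0.
  - move=> x _ a b ab; rewrite -!EFinM lee_fin ler_wpM2r//.
    exact/lefP/nd_nnsfun_approx.
congr (limn _); apply/funext => n.
have mi r : measurable (h n @^-1` [set r]) by [].
under eq_integral do rewrite fimfunE -fsumEFin//.
rewrite ge0_integral_fsum//; last 2 first.
- by move=> r; exact/measurable_EFinP/measurableT_comp.
- by move=> r x _; exact: nnfun_muleindic_ge0.
under [RHS]eq_integral.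
  move=> x _; rewrite fimfunE -fsumEFin// ge0_mule_fsuml; last first.
    by move=> r; exact: nnfun_muleindic_ge0.
  over.
rewrite [RHS]ge0_integral_fsum//; last 2 first.
- move=> r; apply: emeasurable_funM => //.
  exact/measurable_EFinP/measurableT_comp.
- by move=> r x _; rewrite mule_ge0//; [exact: nnfun_muleindic_ge0|rewrite lee_fin].
apply: eq_fsbigr => r /[!inE] -[x _ <-{r}].
under [RHS]eq_integral do rewrite EFinM -muleA.
under eq_integral do rewrite EFinM.
have hx0 : (0 <= h n x)%R by [].
rewrite ge0_integralZl_EFin//; last exact/measurable_EFinP.
rewrite [RHS]ge0_integralZl_EFin//; last 2 first.
- by move=> y _; rewrite mule_ge0 ?lee_fin.
- by apply: emeasurable_funM => //; exact/measurable_EFinP.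
congr (_ * _); rewrite integral_indic// setIT nuE// integral_mkcond.
apply: eq_integral => y _; rewrite patchE indicE.
by case: ifP => _; rewrite ?mul1e ?mul0e.
Qed.

End density.

Section spike_and_slab_measure.
Local Open Scope ereal_scope.
Context (R : realType).
Local Notation mu := (@lebesgue_measure R).
Variables (w : R) (f : R -> R).
Hypotheses (w01 : (0 <= w <= 1)%R) (mf : measurable_fun setT f).
Hypotheses (f0 : forall x, (0 <= f x)%R) (f1 : \int[mu]_x (f x)%:E = 1).

Let nu (A : set (measurableTypeR R)) : \bar R := \int[mu]_(x in A) (f x)%:E.

Let nu0 : nu set0 = 0. Proof. exact: integral_set0. Qed.

Let nu_ge0 A : 0 <= nu A.
Proof. by apply: integral_ge0 => x _; rewrite lee_fin. Qed.

Let nu_sigma_additive : semi_sigma_additive nu.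
Proof.
by apply: (@semi_sigma_additive_nng_induced _ _ _ mu) => //;
  exact/measurable_EFinP.
Qed.

Let numeasure : {measure set (measurableTypeR R) -> \bar R} :=
  HB.pack nu (isMeasure.Build _ _ _ nu nu0 nu_ge0 nu_sigma_additive).

Let w0 : (0 <= w)%R. Proof. by case/andP: w01. Qed.
Let w1 : (0 <= 1 - w)%R. Proof. by rewrite subr_ge0; case/andP: w01. Qed.

Let ssm : {measure set (measurableTypeR R) -> \bar R} :=
  measure_add (mscale (NngNum w1) (\d_(0%R : measurableTypeR R)))
    (mscale (NngNum w0) numeasure).

Let ssmE : ssm = spike_slab w f :> (set R -> \bar R).
Proof. by apply/funext => A; exact: measure_addE. Qed.

Let ssm1 : ssm setT = 1.
Proof.
rewrite ssmE /spike_slab diracE mem_set// mule1 f1 mule1 -EFinD.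
by rewrite subrK.
Qed.

(** [spike_slab] is a bare set function; identifying it with a probability gives access to
    integration theory. *)
Lemma spike_slab_probability :
  exists P : probability (measurableTypeR R) R,
    P = spike_slab w f :> (set R -> \bar R).
Proof.
pose P : probability (measurableTypeR R) R :=
  HB.pack (Measure.sort ssm) (Measure_isProbability.Build _ _ _ ssm ssm1).
by exists P; rewrite -ssmE.
Qed.

Lemma ge0_integral_spike_slab (P : probability (measurableTypeR R) R)
    (h : R -> \bar R) :
  P = spike_slab w f :> (set R -> \bar R) ->
  measurable_fun setT h -> (forall x, 0 <= h x) ->
  \int[P]_x h x = (1 - w)%:E * h 0%R + w%:E * \int[mu]_x (h x * (f x)%:E).
Proof.
move=> PE mh h0.
rewrite (eq_measure_integral ssm); last first.
  by move=> A mA _; exact: (congr1 (fun m => m A) (etrans PE (esym ssmE))).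
rewrite /ssm ge0_integral_measure_add//.
rewrite !ge0_integral_mscale//= integral_dirac// diracE mem_set// mul1e.
by congr (_ + _ * _); exact: (@ge0_integral_density _ _ _ mu numeasure f).
Qed.

End spike_and_slab_measure.

Lemma ge0_integral_normal_prob (R : realType) (m s : R) (h : R -> \bar R) :
  measurable_fun setT h -> (forall x, (0 <= h x)%E) ->
  (\int[normal_prob m s]_x h x =
   \int[@lebesgue_measure R]_x (h x * (normal_pdf m s x)%:E))%E.
Proof.
move=> mh h0; apply: ge0_integral_density => //.
- exact: measurable_normal_pdf.
- by move=> x; exact: normal_pdf_ge0.
Qed.

(** * Existence of medians *)

Section median_existence.
Context (R : realType) (P : probability (measurableTypeR R) R).
Local Open Scope ereal_scope.

Let half : R := 2^-1%R.

(** Continuity from above, as a lower bound carried to the limit. Every limit below is cast as a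
    decreasing intersection, passing to complements with [half_setC] when necessary. *)
Let le_measure_bigcap (F : (set (measurableTypeR R))^nat) (x : \bar R) :
  (forall k, measurable (F k)) -> measurable (\bigcap_k F k) ->
  nonincreasing_seq F -> (forall k, x <= P (F k)) -> x <= P (\bigcap_k F k).
Proof.
move=> mF mI nF xF.
have Fcvg : P \o F @ \oo --> P (\bigcap_k F k).
  apply: nonincreasing_cvg_mu => //.
  by rewrite (le_lt_trans (probability_le1 P _))// ltry.
rewrite -(cvg_lim _ Fcvg)//; apply: lime_ge; first by apply/cvg_ex; eexists; exact: Fcvg.
exact: nearW.
Qed.

Let half_setC (A : set (measurableTypeR R)) : measurable A ->
  ~ half%:E <= P A -> half%:E <= P (~` A).
Proof.
move=> mA /negP; rewrite -ltNge probability_setC//.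
rewrite -(fineK (fin_num_measure P A mA)) -EFinB lte_fin lee_fin /half.
by lra.
Qed.

Let not_half_set0 : ~ half%:E <= P set0.
Proof. by rewrite measure0 lee_fin /half; lra. Qed.

Let cdf_right : exists r : R, half%:E <= P `]-oo, r]%classic.
Proof.
apply: contrapT => /forallNP h; apply: not_half_set0.
have <- : \bigcap_k `]k%:R, +oo[%classic = set0 :> set R.
  apply/seteqP; split => // x /(_ (Num.truncn x).+1 I) /=.
  by rewrite in_itv/= andbT ltNge (ltW (truncnS_gt x)).
apply: le_measure_bigcap.
- by move=> k; exact: measurable_itv.
- by apply: bigcap_measurable => // k _; exact: measurable_itv.
- move=> a b ab; apply/subsetPset => x/=; rewrite !in_itv/= !andbT.
  by apply: le_lt_trans; rewrite ler_nat.
- by move=> k; rewrite -setCitvl; apply: half_setC => //; exact: measurable_itv.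
Qed.

Let cdf_left : exists r : R, ~ half%:E <= P `]-oo, r]%classic.
Proof.
apply: contrapT => h; apply: not_half_set0.
have <- : \bigcap_k `]-oo, (- k%:R)%R]%classic = set0 :> set R.
  apply/seteqP; split => // x /(_ (Num.truncn (- x)).+1 I) /=.
  by rewrite in_itv/= lerNr leNgt truncnS_gt.
apply: le_measure_bigcap.
- by move=> k; exact: measurable_itv.
- by apply: bigcap_measurable => // k _; exact: measurable_itv.
- move=> a b ab; apply/subsetPset => x/=; rewrite !in_itv/=.
  by move=> /le_trans; apply; rewrite lerN2 ler_nat.
- by move=> k; apply: contrapT => hk; apply: h; exists (- k%:R : R)%R.
Qed.

Let le_cdf (a b : R) : (a <= b)%R -> P `]-oo, a]%classic <= P `]-oo, b]%classic.
Proof.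
move=> ab; apply: le_measure; rewrite ?inE; [exact: measurable_itv..|].
by move=> x /=; rewrite !in_itv/= => /le_trans; exact.
Qed.

(** The infimum of the points where the distribution function reaches 1/2 is a median: right
    continuity gives the left half-line, and below the infimum the function is less than 1/2, so the
    open right half-lines starting there have mass at least 1/2 and shrink to the closed one. *)
Lemma median_exists : exists m, is_median P m.
Proof.
pose A := [set r : R | half%:E <= P `]-oo, r]%classic].
have [r0 Ar0] := cdf_right; have [r1 Ar1] := cdf_left.
have Alb : has_lbound A.
  exists r1 => r Ar; rewrite leNgt; apply/negP => /ltW rr1.
  by apply: Ar1; exact: le_trans Ar (le_cdf rr1).
exists (inf A); split.
  rewrite (itvNycEbigcap false); apply: le_measure_bigcap.
  - by move=> k; exact: measurable_itv.
  - by apply: bigcap_measurable => // k _; exact: measurable_itv.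
  - move=> a b ab; apply/subsetPset => x/=; rewrite !in_itv/=.
    by move=> /le_trans; apply; rewrite lerD2l lef_pV2 ?posrE// ler_nat.
  - move=> k; have [//||e Ae /ltW ek] := @inf_adherent R A k.+1%:R^-1.
      by split => //; exists r0.
    exact: le_trans Ae (le_cdf ek).
rewrite itvcyEbigcap; apply: le_measure_bigcap.
- by move=> k; exact: measurable_itv.
- by apply: bigcap_measurable => // k _; exact: measurable_itv.
- move=> a b ab; apply/subsetPset => x/=; rewrite !in_itv/= !andbT.
  by apply: le_lt_trans; rewrite lerD2l lerN2 lef_pV2 ?posrE// ler_nat.
- move=> k; rewrite -setCitvl; apply: half_setC; first exact: measurable_itv.
  move=> /(ge_inf Alb); rewrite leNgt => /negP; apply.
  by rewrite ltrBlDr ltrDl.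
Qed.

End median_existence.

(** * Gaussian and polynomial integrals *)

Section polynomial_integrals.
Context (R : realType).
Local Notation mu := (@lebesgue_measure R).
Implicit Types p T x : R.

Lemma measurable_powR1norm p :
  measurable_fun [set: R] (fun x : R => (1 + `|x|) `^ p).
Proof.
apply: (measurableT_comp (measurable_powR p)) => //.
by apply: measurable_funD => //; exact: measurableT_comp.
Qed.

Lemma is_derive_powR1D p x : -1 < x ->
  is_derive x 1 (fun y : R => (1 + y) `^ p) (p * (1 + x) `^ (p - 1)).
Proof.
move=> x1.
have H1 : is_derive x 1 (fun y : R => 1 + y) 1.
  by rewrite -[X in is_derive _ _ _ X]add0r; apply: is_deriveD.
have x1' : 0 < 1 + x by lra.
have H2 : is_derive (1 + x) 1 (@powR R ^~ p) (p * (1 + x) `^ (p - 1)).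
  exact: is_derive1_powR.
have := @is_derive1_comp R (@powR R ^~ p) (fun y : R => 1 + y) x _ _ H2 H1.
by rewrite mulr1.
Qed.

Lemma integral_powR1D p T : p != 0 -> 0 < T ->
  (\int[mu]_(x in `[0%R, T]) ((1 + x) `^ (p - 1))%:E =
   (((1 + T) `^ p - 1) / p)%:E)%E.
Proof.
move=> p0 T0.
have dF r x : -1 < x -> derivable (fun y : R => (1 + y) `^ r) x 1.
  by move=> x1; have := is_derive_powR1D r x1; exact: @ex_derive.
have cF r x : -1 < x -> {for x, continuous (fun y : R => (1 + y) `^ r)}.
  by move=> x1; apply: differentiable_continuous; exact/derivable1_diffP/dF.
pose F x := (1 + x) `^ p * p^-1.
have cF' x : -1 < x -> {for x, continuous F}.
  by move=> x1; apply: continuousM; [exact: cF|exact: cst_continuous].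
rewrite (@continuous_FTC2 _ _ F)//.
- by rewrite /F addr0 powR1 -EFinB mulrBl.
- apply: continuous_in_subspaceT => x; rewrite inE/= in_itv/= => /andP[x0 _].
  by apply: cF; lra.
- split.
  + move=> x; rewrite in_itv/= => /andP[x0 _].
    by apply: derivableM => //; apply: dF; lra.
  + by apply: cvg_at_right_filter; apply: cF'; lra.
  + by apply: cvg_at_left_filter; apply: cF'; lra.
- move=> x; rewrite in_itv/= => /andP[x0 _].
  have x1 : -1 < x by lra.
  have H := is_derive_powR1D p x1.
  have HF : is_derive x 1 F ((1 + x) `^ p *: 0 + p^-1 *: (p * (1 + x) `^ (p - 1))).
    exact: is_deriveM.
  rewrite derive1E derive_val.
  by rewrite scaler0 add0r /GRing.scale/= mulrA mulVf// mul1r.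
Qed.

Lemma le_integral_even (f : R -> R) (b : R) : measurable_fun setT f ->
  (forall x, 0 <= f x) -> (forall x, f (- x) = f x) ->
  (\int[mu]_(x in `[0%R, +oo[) (f x)%:E <= b%:E)%E ->
  (\int[mu]_x (f x)%:E <= (2 * b)%:E)%E.
Proof.
move=> mf f0 fN fb.
have mf' : measurable_fun [set: R] (EFin \o f) by exact/measurable_EFinP.
have f0' x : (0 <= (EFin \o f) x)%E by rewrite lee_fin.
have := ge0_integration_by_substitution0 mf' f0'.
under [in RHS]eq_integral do rewrite /= fN.
move=> fE.
have -> : [set: R] = `]-oo, 0%R[ `|` `[0%R, +oo[.
  by rewrite -setCitvr setUC setUv.
rewrite ge0_integral_setU//=; last 3 first.
- exact: measurable_funTS.
- by move=> x _; rewrite lee_fin.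
- by rewrite -setCitvr /disj_set setICl.
rewrite (_ : 2 * b = b + b); last by ring.
rewrite EFinD; apply: leeD => //.
apply: le_trans fb; rewrite fE; apply: ge0_subset_integral => //=.
- exact: measurable_funTS.
- by move=> x _; rewrite lee_fin.
- by apply: subset_itvl; rewrite bnd_simp.
Qed.

(** Used with [p = - delta], where the bound stays finite as [T] grows and makes the slab
    integrable, and with [p = r - delta > 0], where the endpoint [T] carries the integral. *)
Lemma le_integral_powR1norm p T : p != 0 -> 0 < T ->
  (\int[mu]_(x in `[(- T)%R, T]) ((1 + `|x|) `^ (p - 1))%:E <=
   (2 * (((1 + T) `^ p - 1) / p))%:E)%E.
Proof.
move=> p0 T0; rewrite integral_mkcond.
pose f x : R := (1 + `|x|) `^ (p - 1) * \1_(`[- T, T] : set R) x.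
have fE x : ((fun x : R => ((1 + `|x|) `^ (p - 1))%:E) \_ `[- T, T]) x = (f x)%:E.
  by rewrite patchE /f indicE; case: ifP => _; rewrite ?mulr1 ?mulr0.
under eq_integral do rewrite fE.
apply: le_integral_even.
- apply: measurable_funM; first exact: measurable_powR1norm.
  exact: measurable_indic.
- by move=> x; rewrite mulr_ge0// powR_ge0.
- move=> x; rewrite /f normrN !indicE !mem_setE !in_itv/=.
  by congr (_ * (_ : bool)%:R); rewrite lerNl opprK andbC lerNl.
rewrite -integral_powR1D// integral_mkcond [leRHS]integral_mkcond.
rewrite le_eqVlt; apply/orP; left; apply/eqP.
apply: eq_integral => x _; rewrite !patchE !mem_setE !in_itv/= /f indicE mem_setE in_itv/=.
case: (lerP 0 x) => x0 //=; rewrite (ger0_norm x0).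
have -> : - T <= x by lra.
by case: (x <= T); rewrite ?mulr1 ?mulr0.
Qed.

End polynomial_integrals.

(** * Gaussian integrals of polynomially bounded functions *)

Section gaussian_moments.
Context (R : realType).
Local Notation mu := (@lebesgue_measure R).
Local Notation peak := (@normal_peak R 1).
Implicit Types m x z : R.

Lemma normal_peak1_gt0 : 0 < peak.
Proof. by rewrite normal_peak_gt0. Qed.

Lemma normal_peak1_le1 : peak <= 1.
Proof.
rewrite /normal_peak invf_le1 ?sqrtr_gt0; last first.
  by rewrite expr1n mul1r mulrn_wgt0// pi_gt0.
rewrite -[leLHS]sqrtr1 ler_wsqrtr// expr1n mul1r.
by have := pi_ge2 R; lra.
Qed.

Lemma normal_pdf1E m x : normal_pdf m 1 x = peak * expR (- (x - m) ^+ 2 / 2).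
Proof. by rewrite normal_pdfE// /normal_fun expr1n. Qed.

Lemma normal_pdf2E m x :
  normal_pdf m 2 x = peak / 2 * expR (- (x - m) ^+ 2 / 8).
Proof.
rewrite normal_pdfE ?pnatr_eq0// /normal_fun /normal_peak; congr (_ * _).
  rewrite -mulrnAr sqrtrM ?sqr_ge0// sqrtr_sqr ger0_norm// invfM mulrC.
  by rewrite expr1n mul1r.
by congr (expR (_ / _)); ring.
Qed.

Lemma normal_pdf1_gt0 m x : 0 < normal_pdf m 1 x.
Proof. by rewrite normal_pdf1E mulr_gt0 ?normal_peak1_gt0 ?expR_gt0. Qed.

Lemma normal_pdf_sym m x : normal_pdf m 1 x = normal_pdf x 1 m.
Proof. by rewrite !normal_pdf1E -(opprB x m) sqrrN. Qed.

Lemma phiE x m : phi (x - m) = normal_pdf m 1 x.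
Proof. by rewrite /phi !normal_pdf1E subr0. Qed.

Lemma phi_gt0 x : 0 < phi x.
Proof. exact: normal_pdf1_gt0. Qed.

Lemma le_phi x z : `|x| <= `|z| -> phi z <= phi x.
Proof.
move=> xz; rewrite /phi !normal_pdf1E !subr0 ler_pM2l ?normal_peak1_gt0//.
rewrite ler_expR ler_pM2r// lerN2 -(real_normK (num_real x)).
by rewrite -(real_normK (num_real z)) lerXn2r ?nnegrE.
Qed.

(** The rate 1/8 is a third of the gap 3/8 between the exponents 1/2 and 1/8 of the normal densities
    with standard deviations 1 and 2, so that three such factors, a sixth power, fit into the
    gap. *)
Lemma exp1normX2_le z : (1 + `|z|) ^+ 2 <= 16 * expR (z ^+ 2 / 8).
Proof.
have h := expR_ge1Dx (z ^+ 2 / 8).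
rewrite -(real_normK (num_real z)) in h *.
by set y := `|z| in h *; have := sqr_ge0 (y - 1); nra.
Qed.

Lemma exp1norm_le k j z : (k <= 2 * j)%N ->
  (1 + `|z|) ^+ k <= 16 ^+ j * expR (j%:R * z ^+ 2 / 8).
Proof.
move=> kj; apply: (@le_trans _ _ ((1 + `|z|) ^+ (2 * j))).
  by rewrite ler_weXn2l// lerDl.
rewrite exprM -[j%:R * _ * _]mulrA expRM_natl -exprMn.
by apply: lerXn2r; rewrite ?nnegrE ?exp1normX2_le ?mulr_ge0 ?sqr_ge0 ?expR_ge0.
Qed.

(** The constant is [16 ^+ 3], from three quadratic factors, times the ratio 2 of the two peaks. *)
Lemma gaussian_tail_exp m x k : (k <= 6)%N ->
  (1 + `|x - m|) ^+ k * normal_pdf m 1 x <= 2 ^+ 13 * normal_pdf m 2 x.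
Proof.
move=> k6; have := @exp1norm_le k 3 (x - m) k6.
rewrite normal_pdf1E normal_pdf2E; move: (x - m) => z kz.
have -> : - z ^+ 2 / 8 = - z ^+ 2 / 2 + 3 * z ^+ 2 / 8 by field.
rewrite expRD; set a := expR (- z ^+ 2 / 2); set b := expR (3 * z ^+ 2 / 8).
rewrite -/b in kz.
have a0 : 0 < a by exact: expR_gt0.
have p0 := normal_peak1_gt0.
apply: (@le_trans _ _ ((16 ^+ 3 * b) * (peak * a))).
  by rewrite ler_pM2r// mulr_gt0.
by rewrite le_eqVlt; apply/orP; left; apply/eqP; field.
Qed.

(** The majorant is a multiple of a normal density with standard deviation 2, which integrates to 1.
    Degree 6 leaves room for a cubic integrand times the cubic variation of the slab. *)
Lemma le_integral_gaussian (f : R -> R) m c : measurable_fun setT f ->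
  (forall x, 0 <= f x) -> (forall x, f x <= c * (1 + `|x - m|) ^+ 6) ->
  (\int[mu]_x (f x * normal_pdf m 1 x)%:E <= (2 ^+ 13 * c)%:E)%E.
Proof.
move=> mf f0 fc.
have c0 : 0 <= c.
  by have := le_trans (f0 m) (fc m); rewrite subrr normr0 addr0 expr1n mulr1.
have mn s : measurable_fun setT (normal_pdf m s) by exact: measurable_normal_pdf.
apply: (@le_trans _ _ (\int[mu]_x ((2 ^+ 13 * c)%:E * (normal_pdf m 2 x)%:E))%E).
  apply: ge0_le_integral => //.
  - by move=> x _; rewrite lee_fin mulr_ge0// normal_pdf_ge0.
  - by apply/measurable_EFinP; apply: measurable_funM; [exact: mf|exact: mn].
  - by apply: measurable_funeM; apply/measurable_EFinP; exact: mn.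
  - move=> x _; rewrite -EFinM lee_fin.
    apply: (@le_trans _ _ (c * ((1 + `|x - m|) ^+ 6 * normal_pdf m 1 x))).
      by rewrite mulrA ler_wpM2r// normal_pdf_ge0.
    rewrite [leRHS](_ : _ = c * (2 ^+ 13 * normal_pdf m 2 x)); last by ring.
    by rewrite ler_wpM2l// gaussian_tail_exp.
rewrite ge0_integralZl_EFin//.
- by rewrite integral_normal_pdf mule1.
- by move=> x _; rewrite lee_fin normal_pdf_ge0.
- by apply/measurable_EFinP; exact: mn.
- by rewrite mulr_ge0// exprn_ge0.
Qed.

End gaussian_moments.

(** * The slab density *)

Section slab_bounds.
Context (R : realType) (delta : R).
Hypothesis hdelta : 0 < delta < 2.
Local Notation mu := (@lebesgue_measure R).
Implicit Types x u : R.

Let d0 : 0 < delta. Proof. by case/andP: hdelta. Qed.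
Let d2 : delta < 2. Proof. by case/andP: hdelta. Qed.

Definition slab_tail x : R := (1 + `|x|) `^ (- 1 - delta).

Lemma ge1_1norm x : 1 <= 1 + `|x|.
Proof. by rewrite lerDl. Qed.

Lemma gt0_1norm x : 0 < 1 + `|x|.
Proof. exact: lt_le_trans (ge1_1norm x). Qed.

Lemma slab_tail_gt0 x : 0 < slab_tail x.
Proof. by rewrite powR_gt0// gt0_1norm. Qed.

Lemma slab_tail_le1 x : slab_tail x <= 1.
Proof.
by rewrite /slab_tail -[leRHS](powRr0 (1 + `|x|)) ler_powR ?ge1_1norm//; have := d0; have := d2; lra.
Qed.

Lemma slab_tail_ge x : ((1 + `|x|) ^+ 3)^-1 <= slab_tail x.
Proof.
rewrite -powR_mulrn ?(ltW (gt0_1norm x))// -powRN /slab_tail ler_powR ?ge1_1norm//; have := d0; have := d2; lra.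
Qed.

Lemma le_slab_tail x u : `|x| <= `|u| -> slab_tail u <= slab_tail x.
Proof.
move=> xu; rewrite /slab_tail -opprD !powRN lef_pV2 ?posrE ?powR_gt0 ?gt0_1norm//.
by apply: ge0_ler_powR; rewrite ?nnegrE ?lerD2l//; have := d0; lra.
Qed.

(** A form of Peetre's inequality, the source of the slow variation of the slab. *)
Lemma norm1_submul x u : 1 + `|x| <= (1 + `|u|) * (1 + `|x - u|).
Proof.
have : `|x| <= `|u| + `|x - u| by rewrite -[X in `|X| <= _](subrKC u) ler_normD.
by have := normr_ge0 u; have := normr_ge0 (x - u); nra.
Qed.

(* The slab is slowly varying: it changes by a bounded factor on the unit
   scale of the noise, which makes its convolution with [phi] comparable to
   it. *)
Lemma slab_tail_ratio x u : slab_tail u <= slab_tail x * (1 + `|x - u|) ^+ 3.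
Proof.
have h := gt0_1norm; have h1 := ge1_1norm.
rewrite /slab_tail -opprD !powRN ler_pdivlMl ?powR_gt0//.
rewrite ler_pdivrMr ?powR_gt0//.
apply: (@le_trans _ _ (((1 + `|u|) * (1 + `|x - u|)) `^ (1 + delta))).
  apply: ge0_ler_powR; rewrite ?nnegrE; [have := d0; lra|exact: ltW|..].
    by rewrite mulr_ge0// ltW// h.
  exact: norm1_submul.
rewrite powRM ?(ltW (h _))// [leLHS]mulrC ler_wpM2r ?powR_ge0//.
by rewrite -powR_mulrn ?(ltW (h _))// ler_powR//; have := d2; lra.
Qed.

Lemma measurable_slab_tail : measurable_fun setT slab_tail.
Proof. exact: measurable_powR1norm. Qed.

Lemma integral_slab_tail_lty : (\int[mu]_x (slab_tail x)%:E < +oo)%E.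
Proof.
pose F (k : nat) : set R := `[- k.+1%:R, k.+1%:R]%classic.
have mF k : measurable (F k) by exact: measurable_itv.
have FT : \bigcup_k F k = setT.
  apply/seteqP; split => // x _; exists (Num.truncn `|x|) => //=.
  by rewrite /F/= in_itv/= -ler_norml ltW// truncnS_gt.
have ndF : nondecreasing_seq F.
  move=> a b ab; apply/subsetPset => x; rewrite /F/= !in_itv/= -!ler_norml.
  by move=> /le_trans; apply; rewrite ler_nat.
have mt : measurable_fun [set: R] (EFin \o slab_tail).
  by apply/measurable_EFinP; exact: measurable_slab_tail.
have := @ge0_nondecreasing_set_cvg_integral _ (measurableTypeR R) R F (EFin \o slab_tail) mu ndF mF.
move=> /(_ (fun i => measurable_funTS mt)) /(_ _) cvgF.
rewrite FT in cvgF; rewrite -(cvg_lim _ (cvgF _))//; last first.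
  by move=> i x _; rewrite lee_fin ltW// slab_tail_gt0.
apply: (@le_lt_trans _ _ (2 * delta^-1)%:E); last exact: ltry.
apply: lime_le.
  apply/cvg_ex; eexists; apply: cvgF.
  by move=> i x _; rewrite lee_fin ltW// slab_tail_gt0.
apply: nearW => k.
have -> : slab_tail = fun x => (1 + `|x|) `^ (- delta - 1).
  by apply/funext => x; rewrite /slab_tail [- 1 - _]addrC.
have dn : - delta != 0 by rewrite oppr_eq0 gt_eqF.
apply: le_trans (le_integral_powR1norm dn _) _; first by rewrite ltr0n.
rewrite lee_fin ler_pM2l// invrN mulrN -mulNr.
rewrite -[leRHS]mul1r ler_pM2r ?invr_gt0//.
Qed.

Lemma integral_slab_tail_gt0 : (0 < \int[mu]_x (slab_tail x)%:E)%E.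
Proof.
apply: (@lt_le_trans _ _ (\int[mu]_(x in `[0%R, 1%R]) (8^-1)%:E)%E).
  rewrite integral_cst//= lebesgue_measure_itv/= lte_fin ltr01 oppr0 adde0.
  by rewrite mule1 lte_fin invr_gt0.
apply: (@le_trans _ _ (\int[mu]_(x in `[0%R, 1%R]) (slab_tail x)%:E)%E).
  apply: ge0_le_integral => //.
  - by apply/measurable_EFinP/measurable_funTS; exact: measurable_slab_tail.
  - move=> x /=; rewrite in_itv/= => /andP[x0 x1]; rewrite lee_fin.
    apply: le_trans (slab_tail_ge x); rewrite lef_pV2 ?posrE ?exprn_gt0 ?gt0_1norm//.
    rewrite (_ : 8 = 2 ^+ 3); last by rewrite -natrX.
    by rewrite lerXn2r// ?nnegrE ?(ltW (gt0_1norm _))// ger0_norm//; lra.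
apply: ge0_subset_integral => //.
- by apply/measurable_EFinP; exact: measurable_slab_tail.
- by move=> x _; rewrite lee_fin ltW// slab_tail_gt0.
Qed.

(** The real-valued integral in [slab_constant] is the [fine] of an extended one and would be 0 if
    that were infinite; hence finiteness matters as much as positivity. *)
Lemma slab_constant_gt0 : 0 < @slab_constant R delta.
Proof.
rewrite invr_gt0 /Rintegral fine_gt0//.
by rewrite integral_slab_tail_gt0 integral_slab_tail_lty.
Qed.

Lemma slab_gt0 x : 0 < slab delta x.
Proof. by rewrite mulr_gt0 ?slab_constant_gt0 ?slab_tail_gt0. Qed.

Lemma measurable_slab : measurable_fun setT (@slab R delta).
Proof. by apply: measurable_funM => //; exact: measurable_slab_tail. Qed.

End slab_bounds.

(** * The marginal density under the slab and the tilted slab *)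

Section marginal_density.
Context (R : realType) (delta : R).
Hypothesis hdelta : 0 < delta < 2.
Local Notation mu := (@lebesgue_measure R).
Local Notation K := (@slab_constant R delta).
Local Notation tail := (slab_tail delta).
Local Notation g := (slab_convolution delta).
Implicit Types x u : R.

Lemma measurable_phi_shift x : measurable_fun setT (fun u => phi (x - u)).
Proof.
have -> : (fun u => phi (x - u)) = normal_pdf x 1.
  by apply/funext => u; rewrite phiE normal_pdf_sym.
exact: measurable_normal_pdf.
Qed.

Let K0 : 0 < K. Proof. exact: slab_constant_gt0. Qed.
Let tail0 x : 0 < tail x. Proof. exact: slab_tail_gt0. Qed.
Let phi0 x : 0 < @phi R x. Proof. exact: phi_gt0. Qed.
Let slab0 x : 0 < slab delta x. Proof. exact: slab_gt0. Qed.

Let mphislab x : measurable_fun setT (fun u => phi (x - u) * slab delta u).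
Proof.
by apply: measurable_funM; [exact: measurable_phi_shift|exact: measurable_slab].
Qed.

(** On the window [[x - 1, x + 1]], of length 2, the noise density is at least [phi 1] and the slab
    at least 1/8 of its value at [x]; [2 / 8 = 1 / 4]. *)
Definition marginal_lower : R := phi 1 / 4.

Lemma marginal_lower_gt0 : 0 < marginal_lower.
Proof. by rewrite /marginal_lower mulr_gt0. Qed.

Lemma integral_phi_slab_le x :
  (\int[mu]_u (phi (x - u) * slab delta u)%:E <= (2 ^+ 13 * (K * tail x))%:E)%E.
Proof.
have h := @le_integral_gaussian R (slab delta) x (K * tail x)
  (measurable_slab _) (fun u => ltW (slab0 u)).
apply: le_trans (h _).
  by under eq_integral do rewrite mulrC phiE normal_pdf_sym.
move=> u; rewrite /slab -mulrA ler_pM2l//.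
apply: le_trans (slab_tail_ratio hdelta x u) _.
rewrite ler_pM2l// distrC ler_weXn2l//.
by rewrite lerDl.
Qed.

Lemma slab_convolutionE x :
  (g x)%:E = (\int[mu]_u (phi (x - u) * slab delta u)%:E)%E.
Proof.
rewrite /slab_convolution /Rintegral fineK// ge0_fin_numE.
  by apply: le_lt_trans (integral_phi_slab_le x) _; rewrite ltry.
by apply: integral_ge0 => u _; rewrite lee_fin mulr_ge0// ltW.
Qed.

Lemma slab_convolution_le x : g x <= 2 ^+ 13 * (K * tail x).
Proof. by rewrite -lee_fin slab_convolutionE integral_phi_slab_le. Qed.

Lemma slab_convolution_ge x : marginal_lower * (K * tail x) <= g x.
Proof.
rewrite -lee_fin slab_convolutionE.
pose c := phi 1 * (K * (tail x / 8)).
have c0 : 0 < c by rewrite !mulr_gt0.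
apply: (@le_trans _ _ (\int[mu]_(u in `[(x - 1)%R, (x + 1)%R]) c%:E)%E).
  rewrite integral_cst//= lebesgue_measure_itv/= lte_fin.
  have -> : x - 1 < x + 1 by lra.
  rewrite -EFinB -EFinM lee_fin /c /marginal_lower.
  by rewrite le_eqVlt; apply/orP; left; apply/eqP; field.
apply: (@le_trans _ _ (\int[mu]_(u in `[(x - 1)%R, (x + 1)%R])
    (phi (x - u) * slab delta u)%:E)%E).
  apply: ge0_le_integral => //.
  - by move=> u _; rewrite lee_fin ltW.
  - by apply/measurable_EFinP/measurable_funTS; exact: mphislab.
  - move=> u /=; rewrite in_itv/= => /andP[u1 u2]; rewrite lee_fin /c.
    have xu : `|x - u| <= 1 by rewrite ler_norml; apply/andP; split; lra.
    rewrite ler_pM//; first exact: ltW.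
    + by rewrite mulr_ge0 ?ltW// mulr_gt0.
    + by apply: le_phi; rewrite normr1.
    + rewrite ler_pM2l// ler_pdivrMr//.
      apply: le_trans (slab_tail_ratio hdelta u x) _.
      rewrite ler_pM2l// (_ : 8 = 2 ^+ 3); last by rewrite -natrX.
      rewrite distrC lerXn2r ?nnegrE// ?addr_ge0//.
      by rewrite -[2]/(1 + 1) lerD2l.
apply: ge0_subset_integral => //.
- by apply/measurable_EFinP; exact: mphislab.
- by move=> u _; rewrite lee_fin mulr_ge0// ltW.
Qed.

Lemma slab_convolution_gt0 x : 0 < g x.
Proof.
apply: lt_le_trans (slab_convolution_ge x).
by rewrite !mulr_gt0 ?marginal_lower_gt0.
Qed.

Local Notation p := (posterior_slab delta).

Lemma posterior_slab_gt0 x u : 0 < p x u.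
Proof. by rewrite divr_gt0 ?mulr_gt0 ?slab_convolution_gt0. Qed.

Lemma measurable_posterior_slab x : measurable_fun setT (p x).
Proof. by apply: measurable_funM => //; exact: mphislab. Qed.

Lemma integral_posterior_slab x : (\int[mu]_u (p x u)%:E = 1)%E.
Proof.
have g0 := slab_convolution_gt0 x.
transitivity (\int[mu]_u ((g x)^-1%:E * (phi (x - u) * slab delta u)%:E))%E.
  by apply: eq_integral => u _; rewrite -EFinM mulrC.
rewrite ge0_integralZl_EFin//.
- by rewrite -slab_convolutionE -EFinM mulVf// gt_eqF.
- by move=> u _; rewrite lee_fin mulr_ge0// ltW.
- by apply/measurable_EFinP; exact: mphislab.
- by rewrite invr_ge0 ltW.
Qed.

(** The tail at [x] cancels between slab and marginal density: up to a cubic factor in the distance,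
    the tilted slab is the noise density centred at [x], uniformly in [x]. *)
Lemma posterior_slab_le x u :
  p x u <= marginal_lower^-1 * ((1 + `|x - u|) ^+ 3 * phi (x - u)).
Proof.
have m0 := marginal_lower_gt0.
have n0 : 0 < (1 + `|x - u|) ^+ 3 by rewrite exprn_gt0// gt0_1norm.
rewrite /posterior_slab ler_pdivrMr ?slab_convolution_gt0// /slab.
apply: (@le_trans _ _ (marginal_lower^-1 * ((1 + `|x - u|) ^+ 3 * phi (x - u)) *
   (marginal_lower * (K * tail x)))); last first.
  rewrite ler_pM2l ?slab_convolution_ge//.
  by apply: mulr_gt0; [rewrite invr_gt0|exact: mulr_gt0].
rewrite [leRHS](_ : _ = phi (x - u) * (K * (tail x * (1 + `|x - u|) ^+ 3))).
  by rewrite !ler_pM2l// slab_tail_ratio.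
by field; rewrite gt_eqF.
Qed.

Lemma posterior_slab_ge x u :
  (2 ^+ 13 * (1 + `|x - u|) ^+ 3)^-1 * phi (x - u) <= p x u.
Proof.
have n0 : 0 < (1 + `|x - u|) ^+ 3 by rewrite exprn_gt0// gt0_1norm.
rewrite /posterior_slab ler_pdivlMr ?slab_convolution_gt0//.
apply: (@le_trans _ _ ((2 ^+ 13 * (1 + `|x - u|) ^+ 3)^-1 * phi (x - u) *
    (2 ^+ 13 * (K * tail x)))).
  by rewrite ler_pM2l ?slab_convolution_le// mulr_gt0 ?invr_gt0 ?mulr_gt0.
rewrite [leLHS](_ : _ = phi (x - u) * (K * (tail x / (1 + `|x - u|) ^+ 3))).
  rewrite !ler_pM2l// ler_pdivrMr// distrC.
  exact: slab_tail_ratio.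
by field; rewrite gt_eqF.
Qed.

(** Cubic growth is what remains of degree 6 once the cubic factor of [posterior_slab_le] is spent.
    This is the concentration of the slab part near [x]. *)
Lemma le_integral_posterior_slab (f : R -> R) x c : measurable_fun setT f ->
  (forall u, 0 <= f u) -> (forall u, f u <= c * (1 + `|x - u|) ^+ 3) ->
  (\int[mu]_u (f u * p x u)%:E <= (2 ^+ 13 * (c / marginal_lower))%:E)%E.
Proof.
move=> mf f0 fc; have m0 := marginal_lower_gt0.
have n0 u : 0 < (1 + `|x - u|) ^+ 3 by rewrite exprn_gt0// gt0_1norm.
pose h u := f u * (marginal_lower^-1 * (1 + `|x - u|) ^+ 3).
have mh : measurable_fun setT h.
  apply: measurable_funM => //; apply: measurable_funM => //.
  apply: measurable_funX; apply: measurable_funD => //.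
  by apply: measurableT_comp => //; exact: measurable_funB.
have h0 u : 0 <= h u by rewrite mulr_ge0// mulr_ge0 ?invr_ge0 ?ltW.
apply: (@le_trans _ _ (\int[mu]_u (h u * normal_pdf x 1 u)%:E)%E).
  apply: ge0_le_integral => //.
  - by move=> u _; rewrite lee_fin mulr_ge0// ltW// posterior_slab_gt0.
  - apply/measurable_EFinP/measurable_funM; first exact: mf.
    exact: measurable_posterior_slab.
  - apply/measurable_EFinP/measurable_funM; first exact: mh.
    exact: measurable_normal_pdf.
  - move=> u _; rewrite lee_fin /h -mulrA ler_wpM2l// normal_pdf_sym -phiE.
    by rewrite -mulrA posterior_slab_le.
apply: le_integral_gaussian => // u.
rewrite /h (_ : 6 = 3 + 3)%N// exprD [`|u - x|]distrC [leRHS]mulrA.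
rewrite [leLHS](_ : _ = f u / marginal_lower * (1 + `|x - u|) ^+ 3); last by ring.
rewrite ler_pM2r// mulrAC ler_pM2r ?invr_gt0//.
Qed.

End marginal_density.

(** * The posterior of one coordinate *)

Section coordinate_posterior.
Context (R : realType) (delta : R).
Hypothesis hdelta : 0 < delta < 2.
Local Notation mu := (@lebesgue_measure R).
Local Notation K := (@slab_constant R delta).
Local Notation tail := (slab_tail delta).
Local Notation g := (slab_convolution delta).
Local Notation a := (posterior_weight delta).
Local Notation p := (posterior_slab delta).
Local Notation med alpha x := (median (coord_posterior delta alpha x)).
Implicit Types alpha x u m b w : R.

Let phi0 x : 0 < @phi R x. Proof. exact: phi_gt0. Qed.
Let g0 x : 0 < g x. Proof. exact: slab_convolution_gt0. Qed.
Let p0 x u : 0 < p x u. Proof. exact: posterior_slab_gt0. Qed.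
Let K0 : 0 < K. Proof. exact: slab_constant_gt0. Qed.
Let tail0 x : 0 < tail x. Proof. exact: slab_tail_gt0. Qed.
Let ml0 : 0 < marginal_lower R. Proof. exact: marginal_lower_gt0. Qed.
Let mp x : measurable_fun setT (p x).
Proof. exact: measurable_posterior_slab. Qed.

Lemma posterior_weight_gt0 alpha x : 0 < alpha < 1 -> 0 < a alpha x.
Proof.
move=> /andP[a0 a1]; rewrite divr_gt0 ?mulr_gt0// addr_gt0// mulr_gt0//.
by rewrite subr_gt0.
Qed.

Lemma onem_posterior_weight alpha x : 0 < alpha < 1 ->
  1 - a alpha x = (1 - alpha) * phi x / ((1 - alpha) * phi x + alpha * g x).
Proof.
move=> /andP[a0 a1]; rewrite /posterior_weight.
have : 0 < (1 - alpha) * phi x + alpha * g x.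
  by rewrite addr_gt0// mulr_gt0// subr_gt0.
by move: ((1 - alpha) * phi x) => y h; field; rewrite gt_eqF.
Qed.

Lemma posterior_weight_lt1 alpha x : 0 < alpha < 1 -> a alpha x < 1.
Proof.
move=> h; rewrite -subr_gt0 onem_posterior_weight//; case/andP: h => a0 a1.
have h : 0 < 1 - alpha by lra.
by rewrite divr_gt0 ?mulr_gt0// addr_gt0// mulr_gt0.
Qed.

(** For [alpha <= 1/2] the denominator is at least [phi x / 2], which doubles the constant of
    [slab_convolution_le]. *)
Lemma posterior_weight_le alpha x : 0 < alpha <= 2^-1 ->
  a alpha x <= 2 ^+ 14 * K * (alpha * tail x / phi x).
Proof.
move=> /andP[a0 a1]; rewrite /posterior_weight.
have h1 := slab_convolution_le hdelta x.
have h2 := phi0 x; have h3 := g0 x.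
rewrite ler_pdivrMr; last by rewrite addr_gt0// mulr_gt0//; lra.
apply: (@le_trans _ _ (2 ^+ 14 * K * (alpha * tail x / phi x) *
  (2^-1 * phi x))); last first.
  rewrite ler_pM2l; first by have := mulr_gt0 a0 h3; nra.
  by apply: mulr_gt0; [rewrite mulr_gt0 ?exprn_gt0|rewrite divr_gt0 ?mulr_gt0].
rewrite [leRHS](_ : _ = alpha * (2 ^+ 13 * (K * tail x))); last first.
  by field; rewrite gt_eqF.
by rewrite ler_pM2l.
Qed.

Lemma posterior_weight_ge alpha x : 0 < alpha < 1 -> alpha * g x <= phi x ->
  marginal_lower R * K / 2 * (alpha * tail x / phi x) <= a alpha x.
Proof.
move=> /andP[a0 a1] agp; rewrite /posterior_weight.
have h1 := slab_convolution_ge hdelta x.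
have h2 := phi0 x; have h3 := g0 x.
rewrite ler_pdivlMr; last by rewrite addr_gt0// mulr_gt0//; lra.
apply: (@le_trans _ _ (marginal_lower R * K / 2 * (alpha * tail x / phi x) *
  (2 * phi x))).
  rewrite ler_pM2l; first by have := mulr_gt0 a0 h2; nra.
  apply: mulr_gt0; last by rewrite divr_gt0 ?mulr_gt0.
  by rewrite divr_gt0 ?mulr_gt0.
rewrite [leLHS](_ : _ = alpha * (marginal_lower R * (K * tail x))); last first.
  by field; rewrite gt_eqF.
by rewrite ler_pM2l.
Qed.

Lemma onem_posterior_weight_le alpha x : 0 < alpha < 1 ->
  1 - a alpha x <= phi x / (alpha * (marginal_lower R * (K * tail x))).
Proof.
move=> h; rewrite onem_posterior_weight//; case/andP: h => a0 a1.
have h1 := slab_convolution_ge hdelta x.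
have h2 := phi0 x; have h3 := g0 x.
have h4 : 0 < alpha * (marginal_lower R * (K * tail x)) by rewrite !mulr_gt0.
have h5 : 0 < (1 - alpha) * phi x by rewrite mulr_gt0//; lra.
apply: ler_pM; [exact: ltW| | |].
- by rewrite invr_ge0 ltW// addr_gt0// mulr_gt0.
- by have := mulr_gt0 a0 h2; nra.
- rewrite lef_pV2 ?posrE//; last by rewrite addr_gt0// mulr_gt0.
  by apply: (@le_trans _ _ (alpha * g x)); [rewrite ler_pM2l|lra].
Qed.

Let w01 alpha x : 0 < alpha < 1 -> 0 <= a alpha x <= 1.
Proof.
by move=> h; rewrite !ltW ?posterior_weight_gt0 ?posterior_weight_lt1.
Qed.

Lemma coord_posterior_probability alpha x : 0 < alpha < 1 ->
  exists P : probability (measurableTypeR R) R,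
    P = coord_posterior delta alpha x :> (set R -> \bar R).
Proof.
move=> h; apply: spike_slab_probability; [exact: w01|exact: mp|..].
- by move=> u; exact: ltW.
- exact: integral_posterior_slab.
Qed.

Lemma median_is_median alpha x : 0 < alpha < 1 ->
  is_median (coord_posterior delta alpha x) (med alpha x).
Proof.
move=> /(@coord_posterior_probability _ x)[P PE].
rewrite /median; apply: (@xgetPex _ 0 [set m | is_median _ m]).
by have [m] := median_exists P; rewrite PE; exists m.
Qed.

Lemma slab_mass_le1 x (A : set R) : measurable A ->
  (\int[mu]_(u in A) (p x u)%:E <= 1)%E.
Proof.
move=> mA; rewrite -(integral_posterior_slab hdelta x).
apply: ge0_subset_integral => //.
- by apply/measurable_EFinP; exact: mp.
- by move=> u _; rewrite lee_fin ltW.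
Qed.

(** Markov's inequality for the distance to [x]. *)
Lemma slab_mass_far b x (A : set R) : measurable A -> 0 < b ->
  (forall u, A u -> b <= `|x - u|) ->
  (\int[mu]_(u in A) (p x u)%:E <= (2 ^+ 13 / (b * marginal_lower R))%:E)%E.
Proof.
move=> mA b0 Ab; rewrite integral_mkcond.
pose f u : R := \1_A u.
apply: (@le_trans _ _ (\int[mu]_u (f u * p x u)%:E)%E).
  rewrite le_eqVlt; apply/orP; left; apply/eqP; apply: eq_integral => u _.
  by rewrite patchE /f indicE; case: ifP => _; rewrite ?mul1r ?mul0r.
apply: le_trans (@le_integral_posterior_slab _ _ hdelta f x b^-1 _ _ _) _.
- by apply: measurable_indic; exact: mA.
- by move=> u; rewrite /f.
- move=> u; have h := ge1_1norm (x - u); rewrite /f indicE.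
  case: (boolP (u \in A)) => /= [/[!inE]/Ab bu|_]; last first.
    by rewrite mulr_ge0 ?invr_ge0 ?(ltW b0)// exprn_ge0// (le_trans _ h).
  rewrite mulrC ler_pdivlMr// mul1r; apply: (@le_trans _ _ (1 + `|x - u|)).
    by rewrite (le_trans bu)// lerDr.
  by rewrite ler_eXnr.
- by rewrite lee_fin [(b * _)^-1]invfM.
Qed.

Lemma coord_posterior_le alpha x (A : set R) b : 0 < alpha < 1 ->
  (\int[mu]_(u in A) (p x u)%:E <= b%:E)%E ->
  (coord_posterior delta alpha x A <= (1 - a alpha x + a alpha x * b)%:E)%E.
Proof.
move=> h Ab; have /andP[w0 w1] := w01 x h.
rewrite /coord_posterior /spike_slab [leRHS]EFinD; apply: leeD.
  rewrite diracE -EFinM lee_fin ler_piMr ?subr_ge0//.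
  by case: (_ \in _).
by rewrite [leRHS]EFinM; apply: lee_wpmul2l.
Qed.

Lemma coord_posterior_le_off0 alpha x (A : set R) b : 0 < alpha < 1 ->
  ~ A 0 -> (\int[mu]_(u in A) (p x u)%:E <= b%:E)%E ->
  (coord_posterior delta alpha x A <= (a alpha x * b)%:E)%E.
Proof.
move=> h A0 Ab; have /andP[w0 w1] := w01 x h.
rewrite /coord_posterior /spike_slab diracE memNset// mule0 add0e.
by rewrite [leRHS]EFinM; apply: lee_wpmul2l.
Qed.

(** A closed half-line that ends at a nonzero median and misses the atom at 0 draws its mass, at
    least 1/2, from the slab alone. *)
Lemma median_gt0_weight alpha x m : 0 < alpha < 1 ->
  is_median (coord_posterior delta alpha x) m -> m != 0 ->
  2^-1 <= a alpha x.
Proof.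
move=> h [mL mR]; rewrite neq_lt -lee_fin => /orP[m0|m0].
  apply: le_trans mL _; rewrite -[leRHS]mule1.
  rewrite -[1%E in leRHS]/(1%R%:E) -EFinM.
  apply: coord_posterior_le_off0 => //; last exact: slab_mass_le1.
  by rewrite /= in_itv/= leNgt m0.
apply: le_trans mR _; rewrite -[leRHS]mule1.
rewrite -[1%E in leRHS]/(1%R%:E) -EFinM.
apply: coord_posterior_le_off0 => //; last exact: slab_mass_le1.
by rewrite /= in_itv/= andbT leNgt m0.
Qed.

(** The distance at which [slab_mass_far] gives 1/4. *)
Definition slab_radius : R := 2 ^+ 15 / marginal_lower R.

Lemma slab_radius_gt0 : 0 < slab_radius.
Proof. by rewrite divr_gt0// exprn_gt0. Qed.

Lemma slab_mass_radius x (A : set R) : measurable A ->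
  (forall u, A u -> slab_radius <= `|x - u|) ->
  (\int[mu]_(u in A) (p x u)%:E <= (4^-1)%:E)%E.
Proof.
move=> mA /(slab_mass_far mA slab_radius_gt0) /le_trans; apply.
rewrite lee_fin /slab_radius le_eqVlt; apply/orP; left; apply/eqP.
by field; rewrite gt_eqF.
Qed.

Lemma median_norm_le alpha x m : 0 < alpha < 1 ->
  is_median (coord_posterior delta alpha x) m -> `|m| <= `|x| + slab_radius.
Proof.
move=> h [mL mR]; rewrite leNgt; apply/negP => xm.
have B0 := slab_radius_gt0.
have a1 := posterior_weight_lt1 x h.
have xr := ler_norm x; have xl := ler_norm (- x); rewrite normrN in xl.
suff : ((2^-1)%:E <= (a alpha x * 4^-1)%:E)%E by rewrite lee_fin; lra.
have [m0|m0] := leP 0 m.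
  rewrite (ger0_norm m0) in xm.
  apply: le_trans mR _; apply: coord_posterior_le_off0 => //.
    by rewrite /= in_itv/= andbT; have := normr_ge0 x; lra.
  apply: slab_mass_radius => // u /=; rewrite in_itv/= andbT => mu_.
  by rewrite distrC (le_trans _ (ler_norm _))//; lra.
rewrite (ltr0_norm m0) in xm.
apply: le_trans mL _; apply: coord_posterior_le_off0 => //.
  by rewrite /= in_itv/=; have := normr_ge0 x; lra.
apply: slab_mass_radius => // u /=; rewrite in_itv/= => um.
by rewrite (le_trans _ (ler_norm _))//; lra.
Qed.

(** A half-line beyond the radius may now contain the atom, but 1/8 from the spike and 1/4 from the
    slab stay below 1/2. *)
Lemma median_dist_le alpha x m : 0 < alpha < 1 ->
  is_median (coord_posterior delta alpha x) m ->
  1 - a alpha x <= 8^-1 -> `|m - x| <= slab_radius.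
Proof.
move=> h [mL mR] a8; rewrite leNgt; apply/negP => xm.
have B0 := slab_radius_gt0.
have a1 := posterior_weight_lt1 x h.
suff : ((2^-1)%:E <= (1 - a alpha x + a alpha x * 4^-1)%:E)%E.
  by rewrite lee_fin; lra.
have [m0|m0] := leP 0 (m - x).
  rewrite (ger0_norm m0) in xm.
  apply: le_trans mR _; apply: coord_posterior_le => //.
  apply: slab_mass_radius => // u /=; rewrite in_itv/= andbT => mu_.
  by rewrite distrC (le_trans _ (ler_norm _))//; lra.
rewrite (ltr0_norm m0) in xm.
apply: le_trans mL _; apply: coord_posterior_le => //.
apply: slab_mass_radius => // u /=; rewrite in_itv/= => um.
by rewrite (le_trans _ (ler_norm _))//; lra.
Qed.

End coordinate_posterior.

(** * Loss and spread of one coordinate *)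

Section coordinate_risk.
Context (R : realType) (delta q : R).
Hypotheses (hdelta : 0 < delta < 2) (hq : 0 < q <= 2).
Local Notation mu := (@lebesgue_measure R).
Local Notation K := (@slab_constant R delta).
Local Notation tail := (slab_tail delta).
Local Notation g := (slab_convolution delta).
Local Notation a := (posterior_weight delta).
Local Notation p := (posterior_slab delta).
Local Notation med alpha x := (median (coord_posterior delta alpha x)).
Local Notation B := (slab_radius R).
Implicit Types alpha tau x y u m b w c e : R.

Let q0 : 0 < q. Proof. by case/andP: hq. Qed.
Let q2 : q <= 2. Proof. by case/andP: hq. Qed.
Let phi0 x : 0 < @phi R x. Proof. exact: phi_gt0. Qed.
Let g0 x : 0 < g x. Proof. exact: slab_convolution_gt0. Qed.
Let p0 x u : 0 < p x u. Proof. exact: posterior_slab_gt0. Qed.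
Let K0 : 0 < K. Proof. exact: slab_constant_gt0. Qed.
Let tail0 x : 0 < tail x. Proof. exact: slab_tail_gt0. Qed.
Let ml0 : 0 < marginal_lower R. Proof. exact: marginal_lower_gt0. Qed.
Let B0 : 0 < B. Proof. exact: slab_radius_gt0. Qed.

Lemma powR_le_sqr y : 1 <= y -> y `^ q <= y ^+ 2.
Proof.
move=> y1; rewrite -powR_mulrn; last by rewrite (le_trans _ y1).
exact: ler_powR.
Qed.

Lemma le_powRq x y : 0 <= x -> x <= y -> x `^ q <= y `^ q.
Proof.
move=> x0 xy; apply: ge0_ler_powR; rewrite ?nnegrE//; first exact: ltW.
exact: le_trans xy.
Qed.

Lemma powRq_scale c y : 1 <= c -> 0 <= y -> (c * y) `^ q <= c ^+ 2 * y `^ q.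
Proof.
move=> c1 y0; have c0 : 0 <= c by apply: le_trans c1.
by rewrite powRM// ler_wpM2r ?powR_ge0// powR_le_sqr.
Qed.

(** The order of the slab weight, capped at 1, times the slab's order of contribution
    [(1 + |x|) ^ q]. It is an explicit measurable majorant both of the loss at a null coordinate and
    of the spread. *)
Definition risk_bound alpha x : R :=
  (1 + `|x|) `^ q * Num.min 1 (alpha * tail x / phi x).

Let ratio_gt0 alpha x : 0 < alpha -> 0 < alpha * tail x / phi x.
Proof. by move=> a0; rewrite divr_gt0 ?mulr_gt0. Qed.

Lemma min1_ratio_gt0 alpha x : 0 < alpha ->
  0 < Num.min 1 (alpha * tail x / phi x).
Proof. by move=> a0; rewrite lt_min ltr01 ratio_gt0. Qed.

Lemma risk_bound_ge0 alpha x : 0 < alpha -> 0 <= risk_bound alpha x.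
Proof. by move=> a0; rewrite mulr_ge0 ?powR_ge0// ltW// min1_ratio_gt0. Qed.

Lemma measurable_phi : measurable_fun setT (@phi R).
Proof. exact: measurable_normal_pdf. Qed.

Lemma measurable_phiV : measurable_fun setT (fun x : R => (phi x)^-1).
Proof.
have -> : (fun x : R => (phi x)^-1) = fun x => phi x `^ (-1).
  by apply/funext => x; rewrite powR_inv1// ltW.
exact: (measurableT_comp (measurable_powR (-1)) measurable_phi).
Qed.

Lemma measurable_risk_bound alpha : measurable_fun setT (risk_bound alpha).
Proof.
apply: measurable_funM; first exact: measurable_powR1norm.
apply: measurable_minr; first exact: measurable_cst.
apply: measurable_funM; last exact: measurable_phiV.
by apply: measurable_funM; [exact: measurable_cst|exact: measurable_slab_tail].
Qed.

Let CW : R := 1 + 2 ^+ 14 * K.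

Let CW1 : 1 <= CW.
Proof. by rewrite /CW lerDl mulr_ge0 ?exprn_ge0// ltW. Qed.

Lemma posterior_weight_min alpha x : 0 < alpha <= 2^-1 ->
  a alpha x <= CW * Num.min 1 (alpha * tail x / phi x).
Proof.
move=> h; have h1 := posterior_weight_le hdelta x h.
case/andP: h => a0 a2.
have h2 : a alpha x < 1 by apply: posterior_weight_lt1 => //; lra.
have r0 := ratio_gt0 x a0; have c0 : 0 <= 2 ^+ 14 * K.
  by rewrite mulr_ge0 ?exprn_ge0// ltW.
rewrite /CW; case: (leP 1 (alpha * tail x / phi x)) => _.
  by rewrite mulr1; lra.
by rewrite mulrDl mul1r (le_trans h1)// lerDr ltW.
Qed.

(** A nonzero median forces the slab weight above 1/2, so the minimum in [risk_bound] is then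
    bounded below; a zero median contributes nothing. *)
Lemma median_pow_le : exists2 C, 0 < C & forall alpha x, 0 < alpha <= 2^-1 ->
  `|med alpha x| `^ q <= C * risk_bound alpha x.
Proof.
have B1 := B0.
have C0 : 0 < (1 + B) ^+ 2 * (2 * CW).
  by rewrite mulr_gt0 ?exprn_gt0//; have := CW1; have := B0; lra.
exists ((1 + B) ^+ 2 * (2 * CW)) => // alpha x h.
have h' := h; case/andP: h' => a0 a2.
have h01 : 0 < alpha < 1 by rewrite a0/=; lra.
have [->|m0] := eqVneq (med alpha x) 0.
  by rewrite normr0 powR0 ?gt_eqF// mulr_ge0 ?(ltW C0)// risk_bound_ge0.
have mm := median_is_median hdelta x h01.
have wa := median_gt0_weight hdelta h01 mm m0.
have mB := median_norm_le hdelta h01 mm.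
have x0 := normr_ge0 x.
apply: (@le_trans _ _ (((1 + B) * (1 + `|x|)) `^ q)).
  by apply: le_powRq => //; have := mulr_ge0 (ltW B0) x0; lra.
apply: (@le_trans _ _ ((1 + B) ^+ 2 * (1 + `|x|) `^ q)).
  by apply: powRq_scale; lra.
rewrite /risk_bound [leRHS](_ : _ = (1 + B) ^+ 2 * (1 + `|x|) `^ q *
  (2 * (CW * Num.min 1 (alpha * tail x / phi x)))); last by ring.
rewrite ler_peMr//; first by rewrite mulr_ge0 ?powR_ge0// exprn_ge0//; lra.
by have := posterior_weight_min x h; lra.
Qed.

Lemma coord_spread_le : exists2 C, 0 < C &
  forall alpha x (P : probability (measurableTypeR R) R),
  0 < alpha <= 2^-1 ->
  P = coord_posterior delta alpha x :> (set R -> \bar R) ->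
  (\int[P]_u (`|u - med alpha x| `^ q)%:E <= (C * risk_bound alpha x)%:E)%E.
Proof.
have B1 := B0.
have [C C0 medC] := median_pow_le.
have C'0 : 0 < 2 ^+ 13 * ((2 + B) ^+ 2 / marginal_lower R) * CW.
  rewrite mulr_gt0//; last by have := CW1; lra.
  by rewrite mulr_gt0 ?exprn_gt0// divr_gt0 ?exprn_gt0//; lra.
exists (C + 2 ^+ 13 * ((2 + B) ^+ 2 / marginal_lower R) * CW).
  exact: addr_gt0.
move=> alpha x P h PE; have mC := medC alpha x h.
have aC := posterior_weight_min x h.
case/andP: h => a0 a2; have h01 : 0 < alpha < 1 by rewrite a0/=; lra.
have w0 := posterior_weight_gt0 hdelta x h01.
have w1 := posterior_weight_lt1 hdelta x h01.
have mB := median_norm_le hdelta h01 (median_is_median hdelta x h01).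
move: mC mB; set m := med alpha x => mC mB.
have mf : measurable_fun setT (fun u : R => `|u - m| `^ q).
  apply: (measurableT_comp (measurable_powR q)) => //.
  by apply: measurableT_comp => //; exact: measurable_funB.
rewrite (ge0_integral_spike_slab _ _ _ PE); first last.
- by move=> u; rewrite lee_fin powR_ge0.
- by apply/measurable_EFinP; exact: mf.
- by move=> u; exact: ltW.
- exact: measurable_posterior_slab.
- by rewrite !ltW.
rewrite mulrDl [leRHS]EFinD; apply: leeD.
  rewrite -EFinM lee_fin sub0r normrN; apply: le_trans mC.
  by rewrite ler_piMl ?powR_ge0//; lra.
have fb u : `|u - m| `^ q <= (2 + B) ^+ 2 * (1 + `|x|) `^ q * (1 + `|x - u|) ^+ 3.
  have x0 := normr_ge0 x; have xu0 := normr_ge0 (x - u).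
  have h1 : `|u - m| <= (2 + B) * ((1 + `|x|) * (1 + `|x - u|)).
    have : `|u - m| <= `|x - u| + (`|x| + `|m|).
      rewrite (_ : u - m = (u - x) + (x - m)); last by ring.
      by rewrite (le_trans (ler_normD _ _))// distrC lerD2l ler_normB.
    have := mulr_ge0 x0 xu0; have := mulr_ge0 (ltW B0) x0.
    have := mulr_ge0 (ltW B0) xu0.
    by have := mulr_ge0 (ltW B0) (mulr_ge0 x0 xu0); nra.
  apply: (le_trans (le_powRq (normr_ge0 _) h1)).
  apply: (le_trans (powRq_scale _ _)); [lra|by rewrite mulr_ge0//; lra|].
  rewrite -mulrA ler_wpM2l ?sqr_ge0// powRM; [|lra..].
  rewrite ler_wpM2l ?powR_ge0//; apply: (le_trans (powR_le_sqr _)); first lra.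
  by rewrite ler_weXn2l//; lra.
have ib : (\int[mu]_u (`|u - m| `^ q * p x u)%:E <=
    (2 ^+ 13 * ((2 + B) ^+ 2 * (1 + `|x|) `^ q / marginal_lower R))%:E)%E.
  by apply: le_integral_posterior_slab; [|exact: mf|
    move=> u; rewrite powR_ge0|exact: fb].
apply: le_trans (lee_wpmul2l _ ib) _; first by rewrite lee_fin ltW.
rewrite -EFinM lee_fin /risk_bound.
rewrite [leLHS](_ : _ = a alpha x * (2 ^+ 13 *
  ((2 + B) ^+ 2 / marginal_lower R) * (1 + `|x|) `^ q)); last by ring.
rewrite [leRHS](_ : _ = (CW * Num.min 1 (alpha * tail x / phi x)) * (2 ^+ 13 *
  ((2 + B) ^+ 2 / marginal_lower R) * (1 + `|x|) `^ q)); last by ring.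
rewrite ler_wpM2r// mulr_ge0 ?powR_ge0// mulr_ge0 ?exprn_ge0//.
by rewrite divr_ge0 ?sqr_ge0// ltW.
Qed.

(** The median vanishes, so the spread is the slab's [q]-th moment about 0. It is bounded below on
    [[x - 1, x]], where [u >= x / 2] costs a factor 4 and the tilted slab is at least
    [phi 1 / 2 ^+ 16]. *)
Lemma coord_spread_ge : exists2 c, 0 < c &
  forall alpha x (P : probability (measurableTypeR R) R),
  0 < alpha < 1 -> 2 <= x -> a alpha x < 2^-1 -> alpha * g x <= phi x ->
  P = coord_posterior delta alpha x :> (set R -> \bar R) ->
  ((c * (x `^ q * (alpha * tail x / phi x)))%:E <=
   \int[P]_u (`|u - med alpha x| `^ q)%:E)%E.
Proof.
pose c1 : R := marginal_lower R * K / 2.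
have c10 : 0 < c1 by rewrite /c1 divr_gt0// mulr_gt0.
exists (c1 * (phi 1 / 2 ^+ 18)).
  by apply: mulr_gt0 => //; apply: divr_gt0; rewrite ?exprn_gt0.
move=> alpha x P h01 x2 wlt agp PE.
have w0 := posterior_weight_gt0 hdelta x h01.
have w1 := posterior_weight_lt1 hdelta x h01.
have wge := posterior_weight_ge hdelta h01 agp.
have -> : med alpha x = 0.
  apply/eqP; apply/negPn/negP => m0.
  have := median_gt0_weight hdelta h01 (median_is_median hdelta x h01) m0.
  by rewrite leNgt wlt.
have mf : measurable_fun setT (fun u : R => `|u - 0| `^ q).
  apply: (measurableT_comp (measurable_powR q)) => //.
  by apply: measurableT_comp => //; exact: measurable_funB.
rewrite (ge0_integral_spike_slab _ _ _ PE); first last.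
- by move=> u; rewrite lee_fin powR_ge0.
- by apply/measurable_EFinP; exact: mf.
- by move=> u; exact: ltW.
- exact: measurable_posterior_slab.
- by rewrite !ltW.
rewrite subrr normr0 powR0 ?gt_eqF// mule0 add0e.
have il : ((phi 1 / 2 ^+ 18 * x `^ q)%:E <=
    \int[mu]_u (`|u - 0| `^ q * p x u)%:E)%E.
  apply: (@le_trans _ _ (\int[mu]_(u in `[(x - 1)%R, x])
      (phi 1 / 2 ^+ 18 * x `^ q)%:E)%E).
    rewrite integral_cst//= lebesgue_measure_itv/= lte_fin.
    have -> : x - 1 < x by lra.
    by rewrite -EFinB -EFinM lee_fin opprB addrCA subrr addr0 mulr1.
  apply: (@le_trans _ _ (\int[mu]_(u in `[(x - 1)%R, x])
      (`|u - 0| `^ q * p x u)%:E)%E).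
    apply: ge0_le_integral => //.
    - by move=> u _; rewrite lee_fin mulr_ge0 ?powR_ge0// divr_ge0 ?(ltW (phi0 1))// exprn_ge0.
    - apply/measurable_EFinP/measurable_funTS; apply: measurable_funM.
        exact: mf.
      exact: measurable_posterior_slab.
    - move=> u /=; rewrite in_itv/= => /andP[u1 u2]; rewrite lee_fin subr0.
      have xu : `|x - u| <= 1 by rewrite ler_norml; apply/andP; split; lra.
      have h1 : x `^ q / 4 <= `|u| `^ q.
        rewrite ler_pdivrMr// mulrC.
        apply: (@le_trans _ _ ((2 * `|u|) `^ q)).
          apply: le_powRq; first lra.
          by have := ler_norm u; lra.
        rewrite (_ : 4 = 2 ^+ 2); last by rewrite -natrX.
        by apply: powRq_scale => //; lra.
      have h2 : phi 1 / 2 ^+ 16 <= p x u.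
        apply: le_trans (posterior_slab_ge hdelta x u).
        rewrite mulrC; apply: ler_pM; [|exact: ltW| |
          by apply: le_phi; rewrite normr1].
          by rewrite invr_ge0 exprn_ge0.
        have n0 := gt0_1norm (x - u).
        rewrite lef_pV2 ?posrE ?mulr_gt0 ?exprn_gt0//.
        rewrite (exprD 2 13 3) ler_pM2l ?exprn_gt0// lerXn2r ?nnegrE ?(ltW n0)//.
        lra.
      rewrite [leLHS](_ : _ = x `^ q / 4 * (phi 1 / 2 ^+ 16)); last first.
        by field.
      apply: ler_pM => //; first by rewrite divr_ge0 ?powR_ge0.
      by rewrite divr_ge0 ?exprn_ge0// ltW.
  apply: ge0_subset_integral => //.
  - apply/measurable_EFinP; apply: measurable_funM; first exact: mf.
    exact: measurable_posterior_slab.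
  - by move=> u _; rewrite lee_fin mulr_ge0 ?powR_ge0// ltW.
apply: le_trans (lee_wpmul2l _ il); last by rewrite lee_fin ltW.
rewrite -EFinM lee_fin [leLHS](_ : _ = c1 * (alpha * tail x / phi x) *
  (phi 1 / 2 ^+ 18 * x `^ q)); last by ring.
by rewrite ler_wpM2r// mulr_ge0 ?powR_ge0// divr_ge0 ?exprn_ge0// ltW.
Qed.

Lemma expRN_sqr_small c e : 0 < c -> 0 < e -> exists2 t0, 1 <= t0 &
  forall tau, t0 <= tau -> expR (- (c * tau ^+ 2)) <= e.
Proof.
move=> c0 e0; exists (1 + (c * e)^-1).
  by rewrite lerDl invr_ge0 ltW// mulr_gt0.
move=> tau t0; have ce : 0 < (c * e)^-1 by rewrite invr_gt0 mulr_gt0.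
rewrite expRN -[leRHS]invrK lef_pV2 ?posrE ?expR_gt0 ?invr_gt0//.
apply: le_trans (expR_ge1Dx _).
have : (c * e)^-1 <= tau ^+ 2 by nra.
rewrite invfM ler_pdivrMl// => ?; lra.
Qed.

(** For [|x| <= tau], [phi x] is at least a multiple of [expR (- tau ^+ 2 / 2)], the square root of
    [alpha], whereas [alpha * g x] is of order at most [alpha]. The factor 4 gained in [key] leaves
    room for [1 - alpha >= 1/2]. *)
Lemma small_posterior_weight : exists2 t0, 1 <= t0 &
  forall tau x, t0 <= tau -> `|x| <= tau ->
  let alpha := expR (- tau ^+ 2) in
  [/\ 0 < alpha <= 2^-1, a alpha x < 2^-1 & alpha * g x <= phi x].
Proof.
pose e : R := normal_peak 1 / (4 * 2 ^+ 13 * K).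
have e0 : 0 < e.
  by rewrite divr_gt0 ?normal_peak1_gt0// mulr_gt0// mulr_gt0 ?exprn_gt0.
have [t1 t11 h1] := @expRN_sqr_small 2^-1 e ltac:(lra) e0.
have [t2 t21 h2] := @expRN_sqr_small 1 2^-1 ltac:(lra) ltac:(lra).
exists (Num.max t1 t2); first by rewrite le_max t11.
move=> tau x; rewrite ge_max => /andP[tt1 tt2] xtau /=.
have a2 := h2 _ tt2; rewrite mul1r in a2.
set alpha := expR (- tau ^+ 2) in a2 *.
have a0 : 0 < alpha by exact: expR_gt0.
have h01 : 0 < alpha < 1 by rewrite a0/=; lra.
have key : 4 * (alpha * g x) <= phi x.
  have phix : normal_peak 1 * expR (- (2^-1 * tau ^+ 2)) <= phi x.
    rewrite /phi normal_pdf1E ler_pM2l ?normal_peak1_gt0// ler_expR subr0.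
    have : x ^+ 2 <= tau ^+ 2; last by lra.
    rewrite -(real_normK (num_real x)); apply: lerXn2r; rewrite ?nnegrE//.
    exact: le_trans xtau.
  have gx : g x <= 2 ^+ 13 * K.
    apply: le_trans (slab_convolution_le hdelta x) _.
    by rewrite mulrA ler_piMr ?slab_tail_le1// mulr_ge0 ?exprn_ge0// ltW.
  apply: le_trans phix.
  have -> : alpha = expR (- (2^-1 * tau ^+ 2)) * expR (- (2^-1 * tau ^+ 2)).
    by rewrite -expRD /alpha; congr expR; field.
  have := h1 _ tt1; move: (expR_gt0 (- (2^-1 * tau ^+ 2))).
  move: (expR _) => E E0 Ee.
  rewrite [leLHS](_ : _ = E * (4 * (E * g x))); last by ring.
  rewrite [leRHS]mulrC ler_pM2l//.
  apply: (@le_trans _ _ (4 * (e * (2 ^+ 13 * K)))).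
    by rewrite ler_pM2l// ler_pM// ?ltW.
  rewrite le_eqVlt; apply/orP; left; apply/eqP; rewrite /e.
  by field; rewrite gt_eqF.
have ag0 : 0 < alpha * g x by rewrite mulr_gt0.
split; [by rewrite a0| |by lra].
rewrite /posterior_weight ltr_pdivrMr; last first.
  by rewrite addr_gt0// mulr_gt0//; lra.
have := ler_wpM2r (ltW (phi0 x)) a2; have := phi0 x; nra.
Qed.

(** Up to [4 * tau] the median is at most of the order of the observation; beyond, the spike is
    negligible and the median is within [slab_radius] of it. The error is thus of order tau however
    large the signal. *)
Lemma median_dist_tau : exists C t0, [/\ 0 < C, 1 <= t0 &
  forall tau x, t0 <= tau ->
  `|med (expR (- tau ^+ 2)) x - x| <= C * tau].
Proof.
have B1 := B0.
(* Beyond [4 * tau] half of the exponent [x ^+ 2 / 2] pays for the inverse tail, and [- x ^+ 2 / 4 +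
   tau ^+ 2 <= - 3 * tau ^+ 2]; [e] brings the spike weight down to 1/8. *)
pose e : R := 8^-1 * (marginal_lower R * K / 2 ^+ 8).
have mlK0 : 0 < marginal_lower R * K by exact: mulr_gt0.
have e0 : 0 < e.
  by apply: mulr_gt0; [rewrite invr_gt0|apply: divr_gt0; rewrite ?exprn_gt0].
have [t1 t11 h1] := @expRN_sqr_small 3 e ltac:(lra) e0.
exists (8 + B), t1; split=> //; first lra.
move=> tau x tt1.
have t1' : 1 <= tau by apply: le_trans tt1.
set alpha := expR (- tau ^+ 2).
have a0 : 0 < alpha by exact: expR_gt0.
have h01 : 0 < alpha < 1.
  rewrite a0/= /alpha expRN invf_lt1 ?expR_gt0//.
  by apply: lt_le_trans (expR_ge1Dx _); nra.
have mm := median_is_median hdelta x h01.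
have [x4|x4] := lerP `|x| (4 * tau).
  have mB := median_norm_le hdelta h01 mm.
  apply: (le_trans (ler_normB _ _)).
  by have := mulr_ge0 (ltW B0) (_ : 0 <= tau - 1); rewrite subr_ge0 => /(_ t1'); nra.
apply: (@le_trans _ _ B); last by have := B0; nra.
apply: (median_dist_le hdelta h01 mm).
apply: (le_trans (onem_posterior_weight_le hdelta x h01)).
have x40 : (4 * tau) ^+ 2 <= x ^+ 2.
  rewrite -(real_normK (num_real x)) lerXn2r ?nnegrE//; last exact: ltW.
  by lra.
have phix : phi x <= expR (- x ^+ 2 / 2).
  rewrite /phi normal_pdf1E subr0 ler_piMl ?expR_ge0//.
  exact: normal_peak1_le1.
have tailx : (tail x)^-1 <= 2 ^+ 8 * expR (2 * x ^+ 2 / 8).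
  apply: (@le_trans _ _ ((1 + `|x|) ^+ 3)).
    rewrite -[leRHS]invrK lef_pV2 ?posrE// ?invr_gt0 ?exprn_gt0 ?gt0_1norm//.
    exact: slab_tail_ge.
  apply: (le_trans (@exp1norm_le _ 3 2 x _)) => //.
  rewrite ler_pM2r ?expR_gt0// (_ : 16 = 2 ^+ 4); last by rewrite -natrX.
  by rewrite -exprM.
have -> : phi x / (alpha * (marginal_lower R * (K * tail x))) =
    phi x * (tail x)^-1 * expR (tau ^+ 2) / (marginal_lower R * K).
  rewrite /alpha expRN; have := expR_gt0 (tau ^+ 2); move: (expR _) => E E0.
  by field; rewrite !gt_eqF.
rewrite ler_pdivrMr ?mulr_gt0//.
apply: (@le_trans _ _ (2 ^+ 8 * e)); last first.
  by rewrite /e le_eqVlt; apply/orP; left; apply/eqP; field.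
apply: (@le_trans _ _ (2 ^+ 8 * expR (- (3 * tau ^+ 2)))); last first.
  by rewrite ler_pM2l//; exact: h1.
apply: (@le_trans _ _ (expR (- x ^+ 2 / 2) * (2 ^+ 8 * expR (2 * x ^+ 2 / 8)) *
   expR (tau ^+ 2))).
  rewrite ler_pM2r ?expR_gt0//; apply: ler_pM => //; first exact: ltW.
  by rewrite invr_ge0 ltW.
rewrite [leLHS](_ : _ = 2 ^+ 8 * (expR (- x ^+ 2 / 2) *
  expR (2 * x ^+ 2 / 8) * expR (tau ^+ 2))); last by ring.
rewrite ler_pM2l ?exprn_gt0// -!expRD ler_expR.
by move: x40; rewrite exprMn; lra.
Qed.

End coordinate_risk.

(** * Moments of the bounds at null coordinates and signals *)

Section risk_moments.
Context (R : realType) (delta q : R).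
Hypotheses (hdelta : 0 < delta < 2) (hq : 0 < q <= 2) (hqd : delta < q).
Local Notation mu := (@lebesgue_measure R).
Local Notation tail := (slab_tail delta).
Local Notation W := (risk_bound delta q).
Implicit Types alpha tau t theta x y c r : R.

Let q0 : 0 < q. Proof. by case/andP: hq. Qed.
Let q2 : q <= 2. Proof. by case/andP: hq. Qed.
Let d0 : 0 < delta. Proof. by case/andP: hdelta. Qed.
Let phi0 x : 0 < @phi R x. Proof. exact: phi_gt0. Qed.
Let tail0 x : 0 < tail x. Proof. exact: slab_tail_gt0. Qed.

Let mn m s : measurable_fun setT (@normal_pdf R m s).
Proof. exact: measurable_normal_pdf. Qed.

(** The exponent [x ^+ 2 / 2] is split: 1/4 for the fourth power, 1/8 to stay integrable, and the
    last 1/8 yields [9 / 8 * tau ^+ 2], which is why the cut is at [3 * tau]. *)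
Lemma gaussian_far_tail tau x : 3 * tau <= `|x| -> 0 <= tau ->
  (1 + `|x|) ^+ 4 * phi x <= 2 ^+ 9 * expR (- tau ^+ 2) * normal_pdf 0 2 x.
Proof.
move=> x3 t0; rewrite /phi normal_pdf1E normal_pdf2E !subr0.
have xt : (3 * tau) ^+ 2 <= x ^+ 2.
  rewrite -(real_normK (num_real x)); apply: lerXn2r; rewrite ?nnegrE//; lra.
have := @exp1norm_le R 4 2 x isT.
have := normal_peak1_gt0 R; move: (normal_peak 1) => k k0 h.
apply: (@le_trans _ _ (16 ^+ 2 * expR (2 * x ^+ 2 / 8) *
    (k * expR (- x ^+ 2 / 2)))).
  by rewrite ler_wpM2r// mulr_ge0 ?expR_ge0// ltW.
rewrite [leLHS](_ : _ = 16 ^+ 2 * k *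
  (expR (2 * x ^+ 2 / 8) * expR (- x ^+ 2 / 2))); last by ring.
rewrite [leRHS](_ : _ = 16 ^+ 2 * k *
  (expR (- tau ^+ 2) * expR (- x ^+ 2 / 8))); last by field.
rewrite ler_wpM2l ?mulr_ge0 ?exprn_ge0 ?(ltW k0)// -!expRD ler_expR.
by move: xt; rewrite exprMn; have := sqr_ge0 tau; lra.
Qed.

(** Up to [3 * tau] the minimum is replaced by the ratio, whose [phi] cancels the density and leaves
    a polynomial integral; beyond, it is replaced by 1 and the Gaussian tail supplies [alpha]. The
    cases [r = q] and [r = 2 * q] give the two moments. *)
Lemma le_integral_min_density r tau alpha : delta < r <= 4 -> 1 <= tau ->
  alpha = expR (- tau ^+ 2) ->
  (\int[mu]_x ((1 + `|x|) `^ r * Num.min 1 (alpha * tail x / phi x) *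
     normal_pdf 0 1 x)%:E <=
   ((2 * 4 `^ (r - delta) / (r - delta) + 2 ^+ 9) *
    (alpha * tau `^ (r - delta)))%:E)%E.
Proof.
move=> /andP[dr r4] t1 aE.
have a0 : 0 < alpha by rewrite aE expR_gt0.
have rd0 : 0 < r - delta by lra.
have t0 : 0 < tau by lra.
pose I : set R := `[- (3 * tau), 3 * tau]%classic.
pose f1 x := (1 + `|x|) `^ (r - delta - 1) * \1_I x.
pose f2 x := 2 ^+ 9 * normal_pdf 0 2 x.
have mI : measurable I by exact: measurable_itv.
have f10 x : 0 <= f1 x by rewrite mulr_ge0 ?powR_ge0.
have f20 x : 0 <= f2 x by rewrite mulr_ge0 ?normal_pdf_ge0 ?exprn_ge0.
have mf1 : measurable_fun setT f1.
  by apply: measurable_funM; [exact: measurable_powR1norm|exact: measurable_indic].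
have mf2 : measurable_fun setT f2.
  by apply: measurable_funM; [exact: measurable_cst|exact: mn].
have mr0 x : 0 <= Num.min 1 (alpha * tail x / phi x).
  by rewrite ltW// min1_ratio_gt0.
have mmin : measurable_fun setT (fun x : R => Num.min 1 (alpha * tail x / phi x)).
  apply: measurable_minr; first exact: measurable_cst.
  apply: measurable_funM; last exact: measurable_phiV.
  by apply: measurable_funM; [exact: measurable_cst|exact: measurable_slab_tail].
apply: (@le_trans _ _ (\int[mu]_x (alpha%:E * ((f1 x)%:E + (f2 x)%:E)))%E).
  apply: ge0_le_integral => //.
  - by move=> x _; rewrite lee_fin !mulr_ge0 ?powR_ge0 ?normal_pdf_ge0.
  - apply/measurable_EFinP; apply: measurable_funM; last exact: mn.
    by apply: measurable_funM; [exact: measurable_powR1norm|exact: mmin].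
  - apply: measurable_funeM; apply: emeasurable_funD; apply/measurable_EFinP.
      exact: mf1.
    exact: mf2.
  move=> x _; rewrite -EFinD -EFinM lee_fin mulrDr.
  have [xI|xI] := lerP `|x| (3 * tau).
    rewrite -[leLHS]addr0; apply: lerD; last by rewrite mulr_ge0 ?f20// ltW.
    rewrite /f1 indicE mem_set; last by rewrite /I/= in_itv/= -ler_norml.
    rewrite mulr1.
    apply: (@le_trans _ _ ((1 + `|x|) `^ r * (alpha * tail x / phi x) * phi x)).
      rewrite ler_wpM2r ?normal_pdf_ge0// ler_wpM2l ?powR_ge0//.
      by rewrite ge_min lexx orbT.
    rewrite -mulrA divfK ?gt_eqF// mulrCA ler_pM2l// /slab_tail.
    rewrite -powRD; last by apply/implyP => _; rewrite gt_eqF// gt0_1norm.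
    by rewrite le_eqVlt; apply/orP; left; apply/eqP; congr powR; ring.
  rewrite -[leLHS]add0r; apply: lerD; first by rewrite mulr_ge0 ?f10// ltW.
  apply: (@le_trans _ _ ((1 + `|x|) ^+ 4 * phi x)).
    rewrite ler_wpM2r ?normal_pdf_ge0//.
    apply: (@le_trans _ _ ((1 + `|x|) `^ r)).
      by rewrite ler_piMr ?powR_ge0// ge_min lexx.
    by rewrite -powR_mulrn ?(ltW (gt0_1norm _))// ler_powR// ge1_1norm.
  apply: le_trans (gaussian_far_tail (ltW xI) (ltW t0)) _.
  by rewrite /f2 -aE mulrA [2 ^+ 9 * _]mulrC.
rewrite ge0_integralZl_EFin ?(ltW a0)//; first last.
- apply: emeasurable_funD; apply/measurable_EFinP; first exact: mf1.
  exact: mf2.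
- by move=> x _; rewrite -EFinD lee_fin addr_ge0.
rewrite ge0_integralD//; first last.
- by apply/measurable_EFinP; exact: mf2.
- by move=> x _; rewrite lee_fin.
- by apply/measurable_EFinP; exact: mf1.
- by move=> x _; rewrite lee_fin.
rewrite [leRHS](_ : _ = (alpha%:E * ((2 * 4 `^ (r - delta) / (r - delta) *
  tau `^ (r - delta))%:E + (2 ^+ 9 * tau `^ (r - delta))%:E))%E); last first.
  by rewrite -EFinD -EFinM; congr EFin; ring.
apply: lee_wpmul2l; first by rewrite lee_fin ltW.
apply: leeD.
  have rdn : r - delta != 0 by rewrite gt_eqF.
  have tt : 0 < 3 * tau by lra.
  have h := le_integral_powR1norm rdn tt; rewrite integral_mkcond in h.
  apply: (@le_trans _ _ (2 * (((1 + 3 * tau) `^ (r - delta) - 1) / (r - delta)))%:E).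
    apply: le_trans h; rewrite le_eqVlt; apply/orP; left; apply/eqP.
    apply: eq_integral => x _; rewrite patchE /f1 indicE.
    by case: ifP => _; rewrite ?mulr1 ?mulr0.
  rewrite lee_fin -!mulrA ler_pM2l// mulrCA [leLHS]mulrC ler_pM2l ?invr_gt0//.
  apply: (@le_trans _ _ ((1 + 3 * tau) `^ (r - delta))); first lra.
  rewrite -powRM ?(ltW t0)//; apply: ge0_ler_powR; rewrite ?nnegrE; lra.
rewrite (_ : (fun x => _) = fun x => ((2 ^+ 9)%:E * (normal_pdf 0 2 x)%:E)%E)//.
rewrite ge0_integralZl_EFin//; first last.
- by apply/measurable_EFinP; exact: mn.
- by move=> x _; rewrite lee_fin normal_pdf_ge0.
rewrite integral_normal_pdf mule1 lee_fin ler_peMr//.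
by rewrite -(powRr0 tau) ler_powR// ltW.
Qed.

Lemma null_moments : exists2 C, 0 < C & forall tau, 1 <= tau ->
  let alpha := expR (- tau ^+ 2) in
  (\int[normal_prob 0%R 1%R]_x (W alpha x)%:E <=
     (C * (alpha * tau `^ (q - delta)))%:E)%E /\
  (\int[normal_prob 0%R 1%R]_x (W alpha x ^+ 2)%:E <=
     (C * (alpha * tau `^ (2 * q - delta)))%:E)%E.
Proof.
pose C r := 2 * 4 `^ (r - delta) / (r - delta) + 2 ^+ 9.
have C0 r : delta < r -> 0 < C r.
  move=> dr; rewrite addr_gt0 ?exprn_gt0//.
  by rewrite divr_gt0 ?mulr_gt0 ?powR_gt0// subr_gt0.
have q2d : delta < 2 * q by have := hqd; have := q0; lra.
exists (C q + C (2 * q)); first by rewrite addr_gt0 ?C0.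
move=> tau t1 alpha.
have a0 : 0 < alpha by exact: expR_gt0.
have W0 x : 0 <= W alpha x by exact: risk_bound_ge0.
have mW : measurable_fun setT (W alpha) by exact: measurable_risk_bound.
rewrite !ge0_integral_normal_prob; first last.
- by move=> x; rewrite lee_fin.
- by apply/measurable_EFinP; exact: mW.
- by move=> x; rewrite lee_fin sqr_ge0.
- by apply/measurable_EFinP; apply: measurable_funX; exact: mW.
have at0 r : 0 <= alpha * tau `^ r by rewrite mulr_ge0 ?powR_ge0// ltW.
split.
  apply: (@le_trans _ _ (C q * (alpha * tau `^ (q - delta)))%:E).
    apply: le_integral_min_density => //.
    by rewrite hqd/=; have := q2; lra.
  by rewrite lee_fin ler_wpM2r// lerDl ltW// C0.
apply: (@le_trans _ _ (C (2 * q) * (alpha * tau `^ (2 * q - delta)))%:E).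
  have hr : delta < 2 * q <= 4 by rewrite q2d/=; have := q2; lra.
  apply: le_trans (le_integral_min_density hr t1 (erefl alpha)).
  have mr0 x : 0 <= Num.min 1 (alpha * tail x / phi x).
    by rewrite ltW// min1_ratio_gt0.
  apply: ge0_le_integral => //.
  - by move=> x _; rewrite -EFinM lee_fin mulr_ge0 ?sqr_ge0 ?normal_pdf_ge0.
  - apply/measurable_EFinP; apply: measurable_funM; last exact: mn.
    by apply: measurable_funX; exact: mW.
  - apply/measurable_EFinP; apply: measurable_funM; last exact: mn.
    apply: measurable_funM; first exact: measurable_powR1norm.
    apply: measurable_minr; first exact: measurable_cst.
    apply: measurable_funM; last exact: measurable_phiV.
    by apply: measurable_funM; [exact: measurable_cst|exact: measurable_slab_tail].
  move=> x _; rewrite -EFinM lee_fin ler_wpM2r ?normal_pdf_ge0//.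
  rewrite /risk_bound exprMn -/alpha.
  have -> : ((1 + `|x|) `^ q) ^+ 2 = (1 + `|x|) `^ (2 * q).
    by rewrite -powR_mulrn ?powR_ge0// -powRrM mulrC.
  rewrite ler_wpM2l ?powR_ge0//; have := mr0 x.
  have : Num.min 1 (alpha * tail x / phi x) <= 1 by rewrite ge_min lexx.
  by move: (Num.min _ _) => y; nra.
by rewrite lee_fin ler_wpM2r// lerDr ltW// C0.
Qed.

(** For [|x| <= t / 2] the ratio is at most [alpha / phi (t / 2)], and the assumed bound on [alpha]
    leaves a polynomial times [expR (- (3 * t ^+ 2 / 8))]. For larger [|x|], [|theta| < |x| / 2], so
    [|x|] is at most twice the noise. *)
Lemma signal_mean C0 : 0 < C0 -> exists2 C, 0 < C & forall alpha t theta,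
  0 < alpha -> 0 < t -> alpha <= C0 * ((1 + t) ^+ 3 * phi t) ->
  `|theta| <= t / 4 ->
  (\int[normal_prob theta 1%R]_x (W alpha x)%:E <= C%:E)%E.
Proof.
move=> C00; exists (2 ^+ 13 * (2 ^+ 12 * C0 + 4)).
  by rewrite mulr_gt0 ?exprn_gt0// addr_gt0// mulr_gt0 ?exprn_gt0.
move=> alpha t theta a0 t0 at_ tht.
have W0 x : 0 <= W alpha x by exact: risk_bound_ge0.
have mW : measurable_fun setT (W alpha) by exact: measurable_risk_bound.
rewrite ge0_integral_normal_prob; first last.
- by move=> x; rewrite lee_fin.
- by apply/measurable_EFinP; exact: mW.
apply: le_integral_gaussian => // x.
have z1 := ge1_1norm (x - theta).
have x1 := ge1_1norm x.
rewrite mulrDl /risk_bound.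
have [xt|xt] := lerP `|x| (t / 2).
  rewrite -[leLHS]addr0; apply: lerD; last by rewrite mulr_ge0// exprn_ge0//; lra.
  apply: (@le_trans _ _ (2 ^+ 12 * C0)); last first.
    by rewrite ler_peMr ?mulr_ge0 ?exprn_ge0 ?exprn_ege1// ltW.
  apply: (@le_trans _ _ ((1 + t) ^+ 2 * (alpha / phi (t / 2)))).
    apply: ler_pM; [exact: powR_ge0|by rewrite ltW// min1_ratio_gt0| |].
      apply: (le_trans (powR_le_sqr hq _)) => //.
      by apply: lerXn2r; rewrite ?nnegrE; lra.
    rewrite ge_min; apply/orP; right.
    apply: ler_pM; [by rewrite mulr_ge0// ltW|by rewrite invr_ge0 ltW| |].
      by rewrite ler_piMr ?slab_tail_le1// ltW.
    rewrite lef_pV2 ?posrE//; apply: le_phi.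
    by rewrite [`|t / 2|]ger0_norm//; lra.
  apply: (@le_trans _ _ (C0 * ((1 + t) ^+ 5 * expR (- (3 * t ^+ 2 / 8))))).
    rewrite mulrA ler_pdivrMr//.
    rewrite [leRHS](_ : _ = (1 + t) ^+ 2 * (C0 * ((1 + t) ^+ 3 *
      (expR (- (3 * t ^+ 2 / 8)) * phi (t / 2))))); last by ring.
    rewrite ler_wpM2l ?sqr_ge0//; apply: (le_trans at_).
    have -> // : phi t = expR (- (3 * t ^+ 2 / 8)) * phi (t / 2).
    rewrite /phi !normal_pdf1E !subr0 mulrCA -expRD.
    by congr (_ * expR _); field.
  rewrite mulrC ler_pM2r// expRN ler_pdivrMr ?expR_gt0//.
  have := @exp1norm_le R 5 3 t isT; rewrite (ger0_norm (ltW t0)).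
  by rewrite (_ : 16 ^+ 3 = 2 ^+ 12)// (_ : 16 = 2 ^+ 4) -?exprM// -natrX.
rewrite -[leLHS]add0r; apply: lerD.
  by rewrite mulr_ge0 ?exprn_ge0 ?mulr_ge0 ?exprn_ge0//; lra.
apply: (@le_trans _ _ ((1 + `|x|) `^ q)).
  by rewrite ler_piMr ?powR_ge0// ge_min lexx.
apply: (le_trans (powR_le_sqr hq x1)).
have tri : `|x| <= `|x - theta| + `|theta|.
  by rewrite -[X in `|X| <= _](subrK theta) ler_normD.
apply: (@le_trans _ _ ((2 * (1 + `|x - theta|)) ^+ 2)).
  by apply: lerXn2r; rewrite ?nnegrE; lra.
rewrite exprMn (_ : 2 ^+ 2 = 4); last by rewrite -natrX.
by rewrite ler_pM2l// ler_weXn2l.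
Qed.

(** Exceeding [t] needs noise of at least [3 * t / 4]. The quadratic rate is enough since it is
    compared with [tau ^ (- q)], where [q <= 2]. *)
Lemma exceedance_mean t theta : 0 < t -> `|theta| <= t / 4 ->
  (\int[normal_prob theta 1%R]_x (\1_[set x | t < `|x|] x)%:E <=
   (2 ^+ 14 / t ^+ 2)%:E)%E.
Proof.
move=> t0 tht; set A := [set x : R | t < `|x|].
have mA : measurable A.
  rewrite -[A]setTI; apply: (@measurable_fun_ltr _ _ _ _ (fun=> t) (@Num.norm _ R)) => //.
have f0 x : 0 <= \1_A x :> R by [].
have mf : measurable_fun setT (\1_A : R -> R) by exact: measurable_indic.
rewrite ge0_integral_normal_prob; first last.
- by move=> x; rewrite lee_fin.
- by apply/measurable_EFinP; exact: mf.
rewrite (_ : 2 ^+ 14 / t ^+ 2 = 2 ^+ 13 * (2 / t ^+ 2)); last first.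
  by field; rewrite gt_eqF.
apply: le_integral_gaussian => // x; rewrite indicE.
have z1 := ge1_1norm (x - theta).
case: (boolP (x \in A)) => /= [/[!inE] xt|_]; last first.
  by rewrite mulr_ge0 ?exprn_ge0 ?divr_ge0 ?sqr_ge0//; lra.
rewrite mulrAC ler_pdivlMr ?exprn_gt0// mul1r.
apply: (@le_trans _ _ (2 * (1 + `|x - theta|) ^+ 2)); last first.
  by rewrite ler_pM2l// ler_weXn2l.
have tri : `|x| <= `|x - theta| + `|theta|.
  by rewrite -[X in `|X| <= _](subrK theta) ler_normD.
by rewrite /A/= in xt; have : 3 * t / 4 <= `|x - theta|; [lra|nra].
Qed.

(** The order of the lower bound [coord_spread_ge] on a window below the threshold, with the powers
    of [x] frozen at tau. The division by [phi x] makes the mean under the null law an exact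
    constant times the window's length. *)
Definition null_spread_lower alpha tau x : R :=
  alpha * tau `^ (q - 1 - delta) / phi x * \1_(`[tau / 2, tau] : set R) x.

Lemma null_spread_lower_ge0 alpha tau x : 0 < alpha ->
  0 <= null_spread_lower alpha tau x.
Proof.
by move=> a0; rewrite !mulr_ge0 ?powR_ge0 ?invr_ge0// ltW.
Qed.

Lemma measurable_null_spread_lower alpha tau :
  measurable_fun setT (null_spread_lower alpha tau).
Proof.
apply: measurable_funM; last by apply: measurable_indic; exact: measurable_itv.
by apply: measurable_funM; [exact: measurable_cst|exact: measurable_phiV].
Qed.

Lemma null_spread_lower_mean alpha tau : 0 < alpha -> 0 < tau ->
  (\int[normal_prob 0%R 1%R]_x (null_spread_lower alpha tau x)%:E =
   (alpha * tau `^ (q - delta) / 2)%:E)%E.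
Proof.
move=> a0 t0; rewrite ge0_integral_normal_prob; first last.
- by move=> x; rewrite lee_fin null_spread_lower_ge0.
- by apply/measurable_EFinP; exact: measurable_null_spread_lower.
transitivity (\int[mu]_(x in `[(tau / 2)%R, tau])
    (alpha * tau `^ (q - 1 - delta))%:E)%E.
  rewrite [RHS]integral_mkcond; apply: eq_integral => x _.
  rewrite patchE /null_spread_lower indicE -EFinM -/(phi x).
  case: ifP => _; rewrite ?mulr1 ?mulr0 ?mul0r//.
  by rewrite divfK// gt_eqF.
rewrite integral_cst//= lebesgue_measure_itv/= lte_fin.
have -> : tau / 2 < tau by lra.
rewrite -EFinB -EFinM; congr EFin.
have -> : tau `^ (q - delta) = tau `^ (q - 1 - delta) * tau.
  rewrite -[X in _ * X]powRr1 ?(ltW t0)// -powRD.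
    by congr powR; ring.
  by apply/implyP => _; rewrite gt_eqF.
by field.
Qed.

(** One of the two factors [1 / phi x] survives the integration; on the window it is at most
    [1 / phi tau], which costs no more than one factor of [alpha]. *)
Lemma null_spread_lower_sqr tau alpha : 1 <= tau ->
  alpha = expR (- tau ^+ 2) ->
  (\int[normal_prob 0%R 1%R]_x (null_spread_lower alpha tau x ^+ 2)%:E <=
   ((normal_peak 1)^-1 * (alpha * tau `^ (2 * q - delta)))%:E)%E.
Proof.
move=> t1 aE; have t0 : 0 < tau by lra.
have a0 : 0 < alpha by rewrite aE expR_gt0.
have k0 := normal_peak1_gt0 R.
pose b := (alpha * tau `^ (q - 1 - delta)) ^+ 2 / phi tau.
have b0 : 0 <= b by rewrite divr_ge0 ?sqr_ge0// ltW.
rewrite ge0_integral_normal_prob; first last.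
- by move=> x; rewrite lee_fin sqr_ge0.
- apply/measurable_EFinP; apply: measurable_funX.
  exact: measurable_null_spread_lower.
apply: (@le_trans _ _ (\int[mu]_(x in `[(tau / 2)%R, tau]) b%:E)%E).
  rewrite [leRHS]integral_mkcond; apply: ge0_le_integral => //.
  - by move=> x _; rewrite -EFinM lee_fin mulr_ge0 ?sqr_ge0 ?normal_pdf_ge0.
  - apply/measurable_EFinP; apply: measurable_funM; last exact: mn.
    apply: measurable_funX; exact: measurable_null_spread_lower.
  - apply/(measurable_restrictT _ _).1 => //.
  move=> x _; rewrite patchE /null_spread_lower indicE -EFinM -/(phi x).
  case: ifPn => [|_]; last by rewrite !mulr0 expr0n/= mul0r.
  rewrite mem_setE in_itv/= => /andP[x1 x2].
  rewrite mulr1 expr_div_n lee_fin /b -mulrA expr2 invfM divfK ?gt_eqF//.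
  rewrite ler_wpM2l ?mulr_ge0 ?powR_ge0 ?(ltW a0)//.
  rewrite lef_pV2 ?posrE//; apply: le_phi.
  by rewrite !ger0_norm//; lra.
rewrite integral_cst//= lebesgue_measure_itv/= lte_fin.
have -> : tau / 2 < tau by lra.
rewrite -EFinB -EFinM lee_fin.
have bE : b <= (normal_peak 1)^-1 * (alpha * (tau `^ (q - 1 - delta)) ^+ 2).
  rewrite /b ler_pdivrMr// exprMn.
  rewrite [leRHS](_ : _ = alpha * (tau `^ (q - 1 - delta)) ^+ 2 *
    ((normal_peak 1)^-1 * phi tau)); last by ring.
  rewrite [leLHS](_ : _ = alpha * (tau `^ (q - 1 - delta)) ^+ 2 * alpha); last by ring.
  rewrite ler_wpM2l//; first by rewrite mulr_ge0 ?sqr_ge0// ltW.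
  rewrite /phi normal_pdf1E mulKf ?gt_eqF// subr0 aE ler_expR.
  by have := sqr_ge0 tau; lra.
apply: (@le_trans _ _ ((normal_peak 1)^-1 *
    (alpha * (tau `^ (q - 1 - delta)) ^+ 2) * tau)).
  by apply: ler_pM => //; lra.
rewrite -!mulrA; apply: ler_wpM2l; first by rewrite invr_ge0 ltW.
apply: ler_wpM2l; first exact: ltW.
rewrite mulrA -expr2 -powR_mulrn ?powR_ge0// -powRrM.
rewrite -[X in _ * X <= _]powRr1 ?(ltW t0)// -powRD; last first.
  by apply/implyP => _; rewrite gt_eqF.
by rewrite ler_powR//; have := d0; lra.
Qed.

End risk_moments.

(** * The threshold *)

Section threshold.
Context (R : realType) (delta : R).
Hypothesis hdelta : 0 < delta < 2.
Local Notation mu := (@lebesgue_measure R).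
Local Notation K := (@slab_constant R delta).
Local Notation tail := (slab_tail delta).
Local Notation g := (slab_convolution delta).
Local Notation a := (posterior_weight delta).
Local Notation p := (posterior_slab delta).
Local Notation med alpha x := (median (coord_posterior delta alpha x)).
Local Notation B := (slab_radius R).
Implicit Types alpha tau t x y u m b w c e : R.

Let phi0 x : 0 < @phi R x. Proof. exact: phi_gt0. Qed.
Let g0 x : 0 < g x. Proof. exact: slab_convolution_gt0. Qed.
Let p0 x u : 0 < p x u. Proof. exact: posterior_slab_gt0. Qed.
Let K0 : 0 < K. Proof. exact: slab_constant_gt0. Qed.
Let tail0 x : 0 < tail x. Proof. exact: slab_tail_gt0. Qed.
Let ml0 : 0 < marginal_lower R. Proof. exact: marginal_lower_gt0. Qed.
Let slab0 x : 0 < slab delta x. Proof. exact: slab_gt0. Qed.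
Let mp x : measurable_fun setT (p x).
Proof. exact: measurable_posterior_slab. Qed.
Let mphislab x : measurable_fun setT (fun u => phi (x - u) * slab delta u).
Proof.
by apply: measurable_funM; [exact: measurable_phi_shift|exact: measurable_slab].
Qed.

Lemma slab_mass_itv_gt0 x m1 m2 : m1 < m2 ->
  (0 < \int[mu]_(u in `]m1, m2[) (p x u)%:E)%E.
Proof.
move=> m12; pose b := `|x| + (`|m1| + `|m2|).
have b0 : 0 <= b by rewrite !addr_ge0.
have n0 y : 0 < 2 ^+ 13 * (1 + `|y|) ^+ 3.
  by rewrite mulr_gt0 ?exprn_gt0// gt0_1norm.
pose e := (2 ^+ 13 * (1 + `|b|) ^+ 3)^-1 * phi b.
have e0 : 0 < e by rewrite mulr_gt0 ?invr_gt0.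
apply: (@lt_le_trans _ _ (\int[mu]_(u in `]m1, m2[) e%:E)%E).
  rewrite integral_cst//= lebesgue_measure_itv/= lte_fin m12 -EFinB -EFinM.
  by rewrite lte_fin mulr_gt0// subr_gt0.
apply: ge0_le_integral => //.
- by move=> u _; rewrite lee_fin ltW.
- by apply/measurable_EFinP/measurable_funTS; exact: mp.
move=> u /=; rewrite in_itv/= => /andP[u1 u2]; rewrite lee_fin.
apply: le_trans (posterior_slab_ge hdelta x u).
have xu : `|x - u| <= `|b|.
  rewrite [`|b|]ger0_norm// /b (le_trans (ler_normB _ _))// lerD2l.
  have := ler_norm (- m1); have := ler_norm m2; rewrite normrN.
  have := normr_ge0 m1; have := normr_ge0 m2.
  by rewrite ler_norml => *; apply/andP; split; lra.
apply: ler_pM; [by rewrite invr_ge0 ltW|exact: ltW| |exact: le_phi].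
rewrite lef_pV2 ?posrE// ler_pM2l ?exprn_gt0//.
by apply: lerXn2r; rewrite ?nnegrE ?(ltW (gt0_1norm _))// lerD2l.
Qed.

(** The half-lines outside two distinct medians would carry the whole mass, but the slab charges the
    interval between them. *)
Lemma median_unique alpha x m1 m2 : 0 < alpha < 1 ->
  is_median (coord_posterior delta alpha x) m1 ->
  is_median (coord_posterior delta alpha x) m2 -> m1 = m2.
Proof.
move=> h; wlog : m1 m2 / m1 < m2.
  by move=> wl mm1 mm2; have [m12|m21|//] := ltgtP m1 m2;
    [exact: wl|apply/esym; exact: wl].
move=> m12 [mL _] [_ mR]; exfalso.
have w0 := posterior_weight_gt0 hdelta x h.
have w1 := posterior_weight_lt1 hdelta x h.
have [P PE] := coord_posterior_probability hdelta x h.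
have Pm : (0 < P `]m1, m2[%classic)%E.
  rewrite PE /coord_posterior /spike_slab.
  apply: (@lt_le_trans _ _ ((a alpha x)%:E *
      \int[mu]_(u in `]m1, m2[) (p x u)%:E)%E).
    by rewrite mule_gt0// slab_mass_itv_gt0.
  rewrite leeDr// mule_ge0// lee_fin; lra.
have : (P (`]-oo, m1] `|` `[m2, +oo[)%classic = 1 - P `]m1, m2[%classic)%E.
  rewrite -probability_setC; last exact: measurable_itv.
  congr (P _); apply/seteqP; split=> u /=; rewrite !in_itv/= andbT.
    move=> -[um /andP[mu1 _]|mu2 /andP[_ um2]].
      by move: um; rewrite leNgt mu1.
    by move: mu2; rewrite leNgt um2.
  move=> /negP; rewrite negb_and -!leNgt => /orP[]; by [left|right].
have dis : `]-oo, m1]%classic `&` `[m2, +oo[%classic = set0.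
  apply/seteqP; split=> // u [] /=; rewrite !in_itv/= andbT => um1 um2.
  by have := le_lt_trans (le_trans um2 um1) m12; rewrite ltxx.
rewrite measureU//; [|exact: measurable_itv..].
rewrite -PE in mL mR => PU.
have : (1 <= 1 - P `]m1, m2[%classic)%E.
  rewrite -PU (_ : 1%E = (2^-1)%:E + (2^-1)%:E)%E; last first.
    by rewrite -EFinD; congr EFin; lra.
  exact: leeD.
move: Pm; have : P `]m1, m2[%classic \is a fin_num.
  by apply: fin_num_measure; exact: measurable_itv.
move: (P _) => [r| |]//= _; rewrite lte_fin -EFinB lee_fin; lra.
Qed.

Let upper x : R := \int[mu]_(u in `[0, +oo[) (phi (x - u) * slab delta u).

Let upperE x : (upper x)%:E =
  (\int[mu]_(u in `[0%R, +oo[) (phi (x - u) * slab delta u)%:E)%E.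
Proof.
rewrite /upper /Rintegral fineK// ge0_fin_numE; last first.
  by apply: integral_ge0 => u _; rewrite lee_fin mulr_ge0// ltW.
apply: le_lt_trans (ltry (g x)); rewrite slab_convolutionE//.
apply: ge0_subset_integral => //.
- by apply/measurable_EFinP; exact: mphislab.
- by move=> u _; rewrite lee_fin mulr_ge0// ltW.
Qed.

Let upper_ge0 x : 0 <= upper x.
Proof.
by rewrite -lee_fin upperE; apply: integral_ge0 => u _; rewrite lee_fin mulr_ge0// ltW.
Qed.

Let slabN u : slab delta (- u) = slab delta u.
Proof. by rewrite /slab normrN. Qed.

Let phiN u : @phi R (- u) = phi u.
Proof. by rewrite /phi !normal_pdf1E !subr0 sqrrN. Qed.

Let lowerE x : (upper (- x))%:E =
  (\int[mu]_(u in `]-oo, 0%R]) (phi (x - u) * slab delta u)%:E)%E.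
Proof.
rewrite upperE.
rewrite (@ge0_integration_by_substitution0 _
  (fun u => (phi (- x - u) * slab delta u)%:E)); first last.
- by move=> u; rewrite lee_fin mulr_ge0// ltW.
- by apply/measurable_EFinP; exact: mphislab.
by apply: eq_integral => u _; rewrite slabN -opprD phiN.
Qed.

Let marginal_split x : g x = upper x + upper (- x).
Proof.
apply: EFin_inj; apply: (etrans (slab_convolutionE hdelta x)).
apply: etrans (esym (congr2 adde (upperE x) (lowerE x))); rewrite [RHS]addeC.
have -> : [set: R] = `]-oo, 0%R[ `|` `[0%R, +oo[.
  by rewrite -setCitvr setUC setUv.
rewrite ge0_integral_setU//=; first last.
- by rewrite -setCitvr /disj_set setICl.
- by move=> u _; rewrite lee_fin mulr_ge0// ltW.
- by apply/measurable_EFinP/measurable_funTS; exact: mphislab.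
congr (_ + _)%E; apply: integral_itv_bndo_bndc.
by apply/measurable_EFinP/measurable_funTS; exact: mphislab.
Qed.

Let post_int x (A : set R) (v : R) : measurable A ->
  v%:E = (\int[mu]_(u in A) (phi (x - u) * slab delta u)%:E)%E ->
  (\int[mu]_(u in A) (p x u)%:E)%E = (v / g x)%:E.
Proof.
move=> mA vE.
transitivity (\int[mu]_(u in A) ((g x)^-1%:E * (phi (x - u) * slab delta u)%:E))%E.
  by apply: eq_integral => u _; rewrite -EFinM mulrC.
rewrite ge0_integralZl_EFin//.
- by rewrite -vE -EFinM mulrC.
- by move=> u _; rewrite lee_fin mulr_ge0// ltW.
- by apply/measurable_EFinP/measurable_funTS; exact: mphislab.
- by rewrite invr_ge0 ltW.
Qed.

(* Dividing by the density of the observation under the spike turns the slab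
   part into the Laplace transform of [expR (- u ^+ 2 / 2)] times the slab. *)
Let rat x : R := upper x / phi x.

(** A half-line with the atom has mass at least 1/2 when the slab part outside exceeds the one
    inside by no more than the spike: [alpha * v' <= (1 - alpha) * phi x + alpha * v]. *)
Let half_line x (A : set R) (v v' : R) alpha : 0 < alpha < 1 -> measurable A ->
  A 0 -> g x = v + v' ->
  v%:E = (\int[mu]_(u in A) (phi (x - u) * slab delta u)%:E)%E ->
  ((2^-1)%:E <= coord_posterior delta alpha x A)%E <->
  v' / phi x - v / phi x <= (1 - alpha) / alpha.
Proof.
move=> h mA A0 gE vE.
rewrite /coord_posterior /spike_slab (post_int mA vE) diracE mem_set// mule1.
rewrite -EFinM -EFinD lee_fin onem_posterior_weight// /posterior_weight.
case/andP: h => a0 a1.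
have den0 : 0 < (1 - alpha) * phi x + alpha * g x.
  by rewrite addr_gt0// mulr_gt0//; lra.
have -> : alpha * g x / ((1 - alpha) * phi x + alpha * g x) * (v / g x) =
    alpha * v / ((1 - alpha) * phi x + alpha * g x).
  have gx0 := g0 x; move: den0; move: ((1 - alpha) * phi x) => y den0.
  by field; rewrite !gt_eqF.
rewrite -mulrDl ler_pdivlMr// -mulrBl ler_pdivrMr// mulrAC ler_pdivlMr//.
rewrite gE; split => hh; nra.
Qed.

Let zero_medianP alpha x : 0 < alpha < 1 ->
  is_median (coord_posterior delta alpha x) 0 <->
  rat x - rat (- x) <= (1 - alpha) / alpha /\
  rat (- x) - rat x <= (1 - alpha) / alpha.
Proof.
move=> h; rewrite /rat phiN.
have HL := @half_line x `]-oo, 0]%classic (upper (- x)) (upper x) alpha h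
  (measurable_itv _) _ _ (lowerE x).
have HU := @half_line x `[0, +oo[%classic (upper x) (upper (- x)) alpha h
  (measurable_itv _) _ (marginal_split x) (upperE x).
rewrite /is_median HL; last 2 first.
- by rewrite /= in_itv/=.
- by rewrite marginal_split; exact: addrC.
by rewrite HU//= in_itv/= lexx.
Qed.

Let kernel x u : R := expR (x * u - u ^+ 2 / 2) * slab delta u.

Let mkernel x : measurable_fun setT (kernel x).
Proof.
apply: measurable_funM; last exact: measurable_slab.
apply: (measurableT_comp (@measurable_expR R)).
apply: measurable_funB.
  by apply: measurable_funM; [exact: measurable_cst|exact: measurable_id].
by apply: measurable_funM; [apply: measurable_funX; exact: measurable_id|exact: measurable_cst].
Qed.

Let kernel_ge0 x u : 0 <= kernel x u.
Proof. by rewrite mulr_ge0 ?expR_ge0// ltW. Qed.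

Let ratE x : (rat x)%:E = (\int[mu]_(u in `[0%R, +oo[) (kernel x u)%:E)%E.
Proof.
rewrite /rat mulrC EFinM upperE -ge0_integralZl_EFin//; first last.
- by rewrite invr_ge0 ltW.
- by apply/measurable_EFinP/measurable_funTS; exact: mphislab.
- by move=> u _; rewrite lee_fin mulr_ge0// ltW.
apply: eq_integral => u _; rewrite -EFinM mulrA /kernel; congr (_ * _)%:E.
rewrite /phi !normal_pdf1E !subr0 mulrC -mulf_div divff ?gt_eqF ?normal_peak1_gt0//.
by rewrite mul1r -expRN -expRD; congr expR; field.
Qed.

Let rat_mono x y : x <= y -> rat x <= rat y.
Proof.
move=> xy; rewrite -lee_fin !ratE; apply: ge0_le_integral => //.
- by move=> u _; rewrite lee_fin.
- by apply/measurable_EFinP/measurable_funTS; exact: mkernel.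
- by apply/measurable_EFinP/measurable_funTS; exact: mkernel.
move=> u /=; rewrite in_itv/= andbT => u0; rewrite lee_fin ler_pM2r//.
by rewrite ler_expR lerD2r ler_wpM2r.
Qed.

Let rat_ge0 x : 0 <= rat x.
Proof. by rewrite divr_ge0 ?upper_ge0// ltW. Qed.

(** Local continuity without differentiating under the integral: [1 - expR (- (y - x) * u) <= (y -
    x) * expR u], and the factor [expR u] shifts the kernel from [y] to [y + 1]. *)
Let rat_lipschitz x y : x <= y -> rat y - rat x <= (y - x) * rat (y + 1).
Proof.
move=> xy; rewrite lerBlDl -lee_fin EFinD [((y - x) * _)%:E]EFinM !ratE.
rewrite -ge0_integralZl_EFin//; first last.
- by rewrite subr_ge0.
- by apply/measurable_EFinP/measurable_funTS; exact: mkernel.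
- by move=> u _; rewrite lee_fin.
rewrite -ge0_integralD//; first last.
- apply: measurable_funeM; apply/measurable_EFinP/measurable_funTS.
  exact: mkernel.
- by move=> u _; rewrite -EFinM lee_fin mulr_ge0// subr_ge0.
- by apply/measurable_EFinP/measurable_funTS; exact: mkernel.
- by move=> u _; rewrite lee_fin.
apply: ge0_le_integral => //.
- by move=> u _; rewrite lee_fin.
- by apply/measurable_EFinP/measurable_funTS; exact: mkernel.
- apply: emeasurable_funD.
    by apply/measurable_EFinP/measurable_funTS; exact: mkernel.
  apply: measurable_funeM; apply/measurable_EFinP/measurable_funTS.
  exact: mkernel.
move=> u /=; rewrite in_itv/= andbT => u0; rewrite -EFinM -EFinD lee_fin /kernel.
rewrite [(y - x) * (_ * _)]mulrA -mulrDl ler_pM2r//.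
have -> : x * u - u ^+ 2 / 2 = - ((y - x) * u) + (y * u - u ^+ 2 / 2) by ring.
have -> : (y + 1) * u - u ^+ 2 / 2 = u + (y * u - u ^+ 2 / 2) by ring.
move: (y * u - u ^+ 2 / 2) => v.
rewrite !expRD mulrA -mulrDl -[leLHS]mul1r ler_pM2r ?expR_gt0//.
have := expR_ge1Dx u; have := expR_ge1Dx (- ((y - x) * u)).
move: (expR _) (expR _) => e1 e2 h1 h2.
have : (y - x) * u <= (y - x) * e1 by rewrite ler_wpM2l ?subr_ge0//; lra.
lra.
Qed.

Let rat_unbounded c : exists2 x, 0 <= x & c < rat x.
Proof.
(* On [[1, 2]] the exponent is at least [x - 2] and the slab at least its value at 2. *)
pose e := expR (- 2) * slab delta 2.
have e0 : 0 < e by rewrite mulr_gt0 ?expR_gt0.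
have key x : 0 <= x -> expR x * e <= rat x.
  move=> x0; rewrite -lee_fin ratE.
  apply: (@le_trans _ _ (\int[mu]_(u in `[1%R, 2%R]) (expR x * e)%:E)%E).
    rewrite integral_cst//= lebesgue_measure_itv/= lte_fin ltr1n.
    by rewrite -EFinB -EFinM lee_fin (_ : 2 - 1 = 1) ?mulr1//; ring.
  apply: (@le_trans _ _ (\int[mu]_(u in `[1%R, 2%R]) (kernel x u)%:E)%E).
    apply: ge0_le_integral => //.
    - by move=> u _; rewrite lee_fin mulr_ge0 ?expR_ge0// ltW.
    - by apply/measurable_EFinP/measurable_funTS; exact: mkernel.
    move=> u /=; rewrite in_itv/= => /andP[u1 u2]; rewrite lee_fin /e /kernel.
    rewrite mulrA -expRD; apply: ler_pM; [exact: expR_ge0|exact: ltW| |].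
      rewrite ler_expR; have : x <= x * u by rewrite ler_peMr.
      by nra.
    rewrite ler_pM2l//; apply: (le_slab_tail hdelta).
    by rewrite !ger0_norm//; lra.
  apply: ge0_subset_integral => //.
  - by apply/measurable_EFinP/measurable_funTS; exact: mkernel.
  - by move=> u _; rewrite lee_fin.
  - by move=> u /=; rewrite !in_itv/= andbT => /andP[u1 _]; lra.
exists (`|c| / e); first by rewrite divr_ge0// ltW.
apply: lt_le_trans (key _ _); last by rewrite divr_ge0// ltW.
have := expR_ge1Dx (`|c| / e).
rewrite -(ler_pM2r e0) mulrDl mul1r divfK ?gt_eqF//.
by have := ler_norm c; lra.
Qed.

(** The median vanishes when [D x] and [D (- x)] are both at most [c]. As [D] is odd, nondecreasing,
    unbounded and continuous, with [D 0 = 0 < c], its sublevel set is a closed half-line with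
    positive endpoint. *)
Lemma is_threshold_exists alpha : 0 < alpha < 1 ->
  exists t, is_threshold delta alpha t.
Proof.
move=> h; pose c := (1 - alpha) / alpha.
have c0 : 0 < c by case/andP: h => a0 a1; rewrite divr_gt0// subr_gt0.
pose D x := rat x - rat (- x).
have Dmono x y : x <= y -> D x <= D y.
  by move=> xy; apply: lerB; apply: rat_mono => //; rewrite lerN2.
pose S := [set x | D x <= c].
have [X X0 XD] : exists2 x, 0 <= x & c < D x.
  have [x x0 xc] := rat_unbounded (c + rat 0); exists x => //.
  have : rat (- x) <= rat 0 by apply: rat_mono; rewrite oppr_le0.
  by rewrite /D; lra.
have ubS : has_ubound S.
  exists X => x xS; rewrite leNgt; apply/negP => /ltW /Dmono XDx.
  by have := le_lt_trans (le_trans XDx xS) XD; rewrite ltxx.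
(* [rat_lipschitz] on both sides of 0 gives [D x <= x * r3] for [0 < x <= 1], so a small positive
   point lies in [S]. *)
pose r3 := rat 2 + rat 1.
have r30 : 0 <= r3 by rewrite addr_ge0.
pose x0 := Num.min 1 (c / (r3 + 1)).
have x00 : 0 < x0 by rewrite lt_min ltr01 divr_gt0//; lra.
have x01 : x0 <= 1 by rewrite ge_min lexx.
have Sx0 : S x0.
  have h1 : rat x0 - rat 0 <= x0 * rat 2.
    apply: (le_trans (rat_lipschitz (ltW x00))); rewrite subr0.
    by apply: ler_wpM2l; [exact: ltW|apply: rat_mono; lra].
  have h2 : rat 0 - rat (- x0) <= x0 * rat 1.
    have hx : - x0 <= 0 by lra.
    apply: (le_trans (rat_lipschitz hx)).
    by rewrite sub0r opprK add0r.
  have h3 : x0 * (r3 + 1) <= c.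
    rewrite -ler_pdivlMr; last by lra.
    by rewrite ge_min lexx orbT.
  by rewrite /S/= /D; move: h3; rewrite /r3; lra.
have supS : has_sup S by split; [exists x0|].
pose t := sup S.
have t0 : 0 < t by apply: (lt_le_trans x00); exact: ub_le_sup.
have Dt : D t <= c.
  pose C := rat (t + 1) + rat (- t + 2).
  have C0 : 0 <= C by rewrite addr_ge0.
  rewrite leNgt; apply/negP => ct.
  (* A point of [S] within [e] of [t] would have [D] above [c]; [e <= 1] keeps [- s + 1] below
     [- t + 2], where the Lipschitz factor was fixed. *)
  pose e := Num.min 1 ((D t - c) / (C + 1)).
  have e0 : 0 < e by rewrite lt_min ltr01 divr_gt0 ?subr_gt0//; lra.
  have e1 : e <= 1 by rewrite ge_min lexx.
  have [s Ss ts] := sup_adherent e0 supS.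
  have st : s <= t by exact: ub_le_sup.
  have h1 := rat_lipschitz st.
  have h2 : rat (- s) - rat (- t) <= (t - s) * rat (- t + 2).
    have hx : - t <= - s by rewrite lerN2.
    apply: (le_trans (rat_lipschitz hx)).
    rewrite (_ : - s - - t = t - s); last by ring.
    apply: ler_wpM2l; first by rewrite subr_ge0.
    by apply: rat_mono; rewrite -/t in ts; lra.
  have h3 : e * (C + 1) <= D t - c.
    rewrite -ler_pdivlMr; last by lra.
    by rewrite ge_min lexx orbT.
  have h4 : (t - s) * (C + 1) < e * (C + 1).
    by rewrite ltr_pM2r; [rewrite -/t in ts; lra|lra].
  have h5 : 0 <= t - s by rewrite subr_ge0.
  have Ds : D s <= c by [].
  by move: h3 h4 Ds; rewrite /D /C; lra.
have DP x : D x <= c <-> x <= t.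
  split=> [xS|/Dmono/le_trans]; last exact.
  exact: ub_le_sup.
exists t; split=> // x.
have zP : med alpha x = 0 <-> is_median (coord_posterior delta alpha x) 0.
  have mm := median_is_median hdelta x h.
  by split=> [<-//|m0]; exact: median_unique mm m0.
rewrite zP zero_medianP// ler_norml.
have -> : rat (- x) - rat x = D (- x) by rewrite /D opprK.
by rewrite -/(D x) -/c !DP; split=> [[? ?]|/andP[? ?]]; [apply/andP|]; split; lra.
Qed.

Lemma threshold_is_threshold alpha : 0 < alpha < 1 ->
  is_threshold delta alpha (threshold delta alpha).
Proof.
move=> h; rewrite /threshold.
exact: (@xgetPex _ 0 [set t | is_threshold delta alpha t]
  (is_threshold_exists h)).
Qed.

(** At the observation tau the slab weight is below 1/2, so the median there is 0. *)
Lemma threshold_ge : exists2 t0, 1 <= t0 & forall tau, t0 <= tau ->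
  tau <= threshold delta (expR (- tau ^+ 2)).
Proof.
have [t0 t01 H] := small_posterior_weight hdelta.
exists t0 => // tau tt; have tau0 : 0 <= tau by lra.
have tau1 : `|tau| <= tau by rewrite ger0_norm.
have [a01 wlt _] := H _ _ tt tau1.
have h : 0 < expR (- tau ^+ 2) < 1 by case/andP: a01 => -> ?/=; lra.
have [t0' tP] := threshold_is_threshold h.
rewrite -[leLHS]ger0_norm//; apply/tP/eqP/negPn/negP => m0.
have := median_gt0_weight hdelta h (median_is_median hdelta tau h) m0.
by rewrite leNgt wlt.
Qed.

(** At [x = t] the median is still 0 while the negative half-line holds at most 1/4 of the slab, so
    the spike keeps weight at least 1/3: [alpha * tail t] is at most of order [phi t]. *)
Lemma threshold_weight : exists2 C, 0 < C & forall alpha, 0 < alpha < 1 ->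
  let t := threshold delta alpha in
  B <= t -> alpha <= C * ((1 + t) ^+ 3 * phi t).
Proof.
have mlK0 : 0 < marginal_lower R * K by exact: mulr_gt0.
exists (3 / (marginal_lower R * K)); first exact: divr_gt0.
move=> alpha h; have [t0 tP] := threshold_is_threshold h.
move: t0 tP; set t := threshold delta alpha => t0 tP /= Bt.
have m0 : med alpha t = 0 by apply/tP; rewrite ger0_norm// ltW.
have [mL _] := median_is_median hdelta t h.
rewrite m0 in mL.
have : ((2^-1)%:E <= (1 - a alpha t + a alpha t * 4^-1)%:E)%E.
  apply: (le_trans mL); apply: coord_posterior_le => //.
  apply: slab_mass_radius => // u /=; rewrite in_itv/= => u0.
  by rewrite (le_trans _ (ler_norm _))//; lra.
rewrite lee_fin => wt.
have w1 : 3^-1 <= 1 - a alpha t by lra.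
have := le_trans w1 (onem_posterior_weight_le hdelta t h).
case/andP: h => a0 a1.
have q0 : 0 < alpha * (marginal_lower R * (K * tail t)) by rewrite !mulr_gt0.
rewrite ler_pdivlMr// ler_pdivrMl// => h1.
have tt : tail t * (1 + t) ^+ 3 >= 1.
  have := slab_tail_ge hdelta t; rewrite (ger0_norm (ltW t0)).
  by rewrite -ler_pdivrMr ?mul1r// exprn_gt0//; lra.
have n0 : 0 < (1 + t) ^+ 3 by rewrite exprn_gt0//; lra.
rewrite [leRHS](_ : _ = (1 + t) ^+ 3 * (3 * phi t) / (marginal_lower R * K));
  last by ring.
rewrite ler_pdivlMr//.
apply: (@le_trans _ _ ((1 + t) ^+ 3 *
    (alpha * (marginal_lower R * (K * tail t))))); last by rewrite ler_pM2l.
rewrite [leRHS](_ : _ = alpha * (marginal_lower R * K) *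
  (tail t * (1 + t) ^+ 3)); last by ring.
by rewrite ler_peMr// ltW// mulr_gt0.
Qed.

End threshold.

(** * Coverage in finite samples *)

Section finite_sample.
Context (R : realType) (delta q : R).
Hypotheses (hdelta : 0 < delta < 2) (hq : 0 < q <= 2) (hqd : delta < q).
Local Notation W := (risk_bound delta q).
Local Notation med alpha x := (median (coord_posterior delta alpha x)).
Implicit Types alpha tau t x y b c M : R.

Let d0 : 0 < delta. Proof. by case/andP: hdelta. Qed.

(** For a fixed observation the medians are constants, so the loss is a coordinate sum under the
    product of the posteriors [Q i]. *)
Lemma posterior_spreadE alpha n (X : n.-tuple R) : 0 < alpha < 1 ->
  exists2 Q : 'I_n -> probability (measurableTypeR R) R,
    (forall i, Q i = coord_posterior delta alpha (tnth X i) :> (set R -> \bar R)) &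
    posterior_spread delta alpha q X =
    (\sum_(i < n) \int[Q i]_u (`|u - med alpha (tnth X i)| `^ q)%:E)%E.
Proof.
move=> h.
have /choice[Q QE] : forall i : 'I_n,
    exists P : probability (measurableTypeR R) R,
    P = coord_posterior delta alpha (tnth X i) :> (set R -> \bar R).
  by move=> i; exact: coord_posterior_probability.
exists Q => //.
have [P PE] := product_measure_probability Q.
have postE : posterior delta alpha X = P.
  rewrite PE /posterior; congr product_measure.
  by apply/funext => i; rewrite QE.
rewrite /posterior_spread postE.
pose f (i : 'I_n) (u : measurableTypeR R) : R := `|u - med alpha (tnth X i)| `^ q.
rewrite -(integral_coordinate_sum PE (f := f)).
- apply: eq_integral => theta _; congr EFin; apply: eq_bigr => i _.
  by rewrite /f tnth_mktuple.
- move=> i; apply: (measurableT_comp (measurable_powR q)) => //.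
  by apply: measurableT_comp => //; exact: measurable_funB.
- by move=> i u; exact: powR_ge0.
Qed.

Lemma law_probability n (theta : n.-tuple R) :
  exists2 P : probability (n.-tuple (measurableTypeR R)) R,
    P = product_measure (fun i => normal_prob (tnth theta i) 1 : set (measurableTypeR R) -> \bar R)
      :> (set _ -> \bar R) &
    law theta = P.
Proof.
have [P PE] := product_measure_probability
  (fun i : 'I_n => normal_prob (tnth theta i) 1 : probability (measurableTypeR R) R).
by exists P.
Qed.

Lemma law_monotone n (theta : n.-tuple R) (A C : set (n.-tuple R)) :
  A `<=` C -> (law theta A <= law theta C)%E.
Proof.
exact: (@product_measure_monotone _ (measurableTypeR R) R n
  (fun i => normal_prob (tnth theta i) 1 : probability _ R) A C).
Qed.

Lemma fine_integral_le d (T : measurableType d) (P : probability T R)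
    (f : T -> R) b : (forall z, 0 <= f z) -> (\int[P]_z (f z)%:E <= b%:E)%E ->
  exists2 m, (\int[P]_z (f z)%:E = m%:E)%E & 0 <= m <= b.
Proof.
move=> f0 fb.
have i0 : (0 <= \int[P]_z (f z)%:E)%E.
  by apply: integral_ge0 => x _; rewrite lee_fin.
exists (fine (\int[P]_z (f z)%:E)%E).
  by rewrite fineK// ge0_fin_numE// (le_lt_trans fb)// ltry.
by move: i0 fb; case: (\int[P]_z _)%E => [r| |]//=; rewrite !lee_fin => -> ->.
Qed.

Lemma probability_setC3_ge d (T : measurableType d) (P : probability T R)
    (A1 A2 A3 : set T) b1 b2 b3 :
  measurable A1 -> measurable A2 -> measurable A3 ->
  (P A1 <= b1%:E)%E -> (P A2 <= b2%:E)%E -> (P A3 <= b3%:E)%E ->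
  ((1 - (b1 + b2 + b3))%:E <= P (~` (A1 `|` A2 `|` A3)))%E.
Proof.
move=> m1 m2 m3 P1 P2 P3.
have m12 : measurable (A1 `|` A2) by exact: measurableU.
have m123 : measurable (A1 `|` A2 `|` A3) by exact: measurableU.
rewrite probability_setC// EFinB; apply: leeB => //.
have U12 : (P (A1 `|` A2) <= P A1 + P A2)%E by exact: measureU2.
have U123 : (P (A1 `|` A2 `|` A3) <= P (A1 `|` A2) + P A3)%E.
  exact: measureU2.
apply: (le_trans U123); rewrite EFinD; apply: leeD => //.
by apply: (le_trans U12); rewrite EFinD; exact: leeD.
Qed.

Lemma sum_if_const n (p : pred 'I_n) c :
  \sum_(i < n) (if p i then c else 0) = #|p|%:R * c.
Proof. by rewrite -big_mkcond/= sumr_const mulr_natl. Qed.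

(** The left side equals [C * tau ^ delta / (n * alpha)], which the rate condition turns into a
    multiple of [1 / s]. *)
Lemma variance_ratio (n s : nat) tau alpha K C : 0 < alpha -> 0 < tau ->
  (0 < n)%N -> (0 < s)%N -> 0 <= C ->
  s%:R * tau `^ delta <= K * (n%:R * alpha) ->
  n%:R * (C * (alpha * tau `^ (2 * q - delta))) /
    (n%:R * (alpha * tau `^ (q - delta))) ^+ 2 <= C * K / s%:R.
Proof.
move=> a0 t0 n0 s0 C0 sK.
have n0' : 0 < n%:R :> R by rewrite ltr0n.
have s0' : 0 < s%:R :> R by rewrite ltr0n.
have -> : tau `^ (2 * q - delta) = (tau `^ (q - delta)) ^+ 2 * tau `^ delta.
  rewrite -powR_mulrn ?powR_ge0// -powRrM -powRD.
    by congr powR; ring.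
  by apply/implyP => _; rewrite gt_eqF.
have p0 : 0 < tau `^ (q - delta) by rewrite powR_gt0.
move: (tau `^ (q - delta)) p0 => p p0.
rewrite [leLHS](_ : _ = C * (tau `^ delta / (n%:R * alpha))); last first.
  by field; rewrite !gt_eqF.
rewrite -mulrA ler_wpM2l// ler_pdivrMr ?mulr_gt0//.
by rewrite mulrAC ler_pdivlMr// mulrC.
Qed.

Lemma lower_spread_rate tau x : 1 <= tau -> tau / 2 <= x <= tau ->
  tau `^ (q - 1 - delta) / 2 ^+ 5 <= x `^ q * slab_tail delta x.
Proof.
move=> t1 /andP[x1 x2]; have t0 : 0 < tau by lra.
have p0 r : 0 <= tau `^ r by exact: powR_ge0.
have xq : tau `^ q / 4 <= x `^ q.
  rewrite ler_pdivrMr// mulrC; apply: (@le_trans _ _ ((2 * x) `^ q)).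
    by apply: (le_powRq hq); lra.
  rewrite (_ : 4 = 2 ^+ 2); last by rewrite -natrX.
  by apply: (powRq_scale hq) => //; lra.
have tx : tau `^ (- 1 - delta) / 2 ^+ 3 <= slab_tail delta x.
  apply: (@le_trans _ _ (slab_tail delta tau)); last first.
    by apply: (le_slab_tail hdelta); rewrite !ger0_norm//; lra.
  apply: (@le_trans _ _ ((2 * tau) `^ (- 1 - delta))).
    rewrite powRM ?(ltW t0)// mulrC ler_wpM2r// -powR_mulrn// -powRN.
    by rewrite ler_powR ?ler1n//; case/andP: hdelta; lra.
  rewrite /slab_tail (ger0_norm (ltW t0)) -opprD !powRN.
  rewrite lef_pV2 ?posrE ?powR_gt0//; try lra.
  by apply: ge0_ler_powR; rewrite ?nnegrE; have := d0; lra.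
rewrite [leLHS](_ : _ = tau `^ q / 4 * (tau `^ (- 1 - delta) / 2 ^+ 3)).
  by apply: ler_pM => //; rewrite divr_ge0.
rewrite (_ : q - 1 - delta = q + (- 1 - delta)); last by ring.
rewrite powRD; last by apply/implyP => _; rewrite gt_eqF.
by field.
Qed.

Lemma signal_loss_le alpha tau theta x C : 1 <= tau -> 0 < C ->
  `|med alpha x - x| <= C * tau ->
  `|theta - med alpha x| `^ q <=
    (C + 1) ^+ 2 * (tau `^ q * (1 + `|x - theta|) ^+ 2).
Proof.
move=> t1 C0 mx; have z0 := normr_ge0 (x - theta).
have h1 : `|theta - med alpha x| <= (C + 1) * (tau * (1 + `|x - theta|)).
  have : `|theta - med alpha x| <= `|x - theta| + `|med alpha x - x|.
    rewrite (_ : theta - med alpha x = - ((x - theta) + (med alpha x - x))).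
      by rewrite normrN ler_normD.
    by ring.
  have := mulr_ge0 (ltW C0) (_ : 0 <= tau * `|x - theta|).
  have t0 : 0 <= tau by lra.
  have := mulr_ge0 t0 z0 => tz0 /(_ tz0); nra.
apply: (le_trans (le_powRq hq (normr_ge0 _) h1)).
apply: (le_trans (powRq_scale hq _ _)); [lra|by rewrite mulr_ge0//; lra|].
rewrite ler_wpM2l ?sqr_ge0// powRM; [|lra..].
by rewrite ler_wpM2l ?powR_ge0// (powR_le_sqr hq)//; lra.
Qed.

Lemma deviation_le y m b c : `|y - m| < c -> m <= b -> y <= b + c.
Proof. by move=> /ltr_normlW; lra. Qed.

Lemma deviation_ge y m b c : `|y - m| < c -> b <= m -> b - c <= y.
Proof. by rewrite distrC => /ltr_normlW; lra. Qed.

Lemma upper_half tau x : 4 <= tau -> tau / 2 <= x <= tau ->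
  `|x| <= tau /\ 2 <= x.
Proof. by move=> ? /andP[? ?]; rewrite ger0_norm; [split|]; lra. Qed.

(** Three sums are kept near their means: the majorant of the loss over nulls, the minorant of the
    spread over nulls, and the squared noise over signals. The quantifiers put [t0] before [K], so
    that the bound on [alpha] will not depend on the constant in the rate. *)
Lemma coverage_ge : exists2 t0, 1 <= t0 & forall K, 0 < K ->
  exists M C, 0 < M /\ forall tau (n s : nat) (theta : n.-tuple R),
    t0 <= tau -> (0 < s)%N -> (2 * s <= n)%N ->
    s%:R * tau `^ delta <= K * (n%:R * expR (- tau ^+ 2)) ->
    l0_ball n s theta ->
    ((1 - C / s%:R)%:E <= coverage delta (expR (- tau ^+ 2)) q M theta)%E.
Proof.
have [Cm Cm0 medW] := median_pow_le hdelta hq.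
have [cl cl0 spread_ge] := coord_spread_ge hdelta hq.
have [t1 t11 small] := small_posterior_weight hdelta.
have [Cd [t2 [Cd0 t21 dist]]] := median_dist_tau hdelta.
have [Cn Cn0 null] := null_moments hq hqd.
(* With [4 <= tau] the window [[tau / 2, tau]] lies above 2, as [coord_spread_ge] requires. *)
exists (Num.max 4 (Num.max t1 t2)); first by rewrite le_max ler1n.
move=> K K0.
have k0 := normal_peak1_gt0 R.
(* The loss in units of [L]: each sum is bounded by its mean plus one unit, and [K] converts the
   signal part through [Lq]. *)
pose D := Cm * (Cn + 1) + (Cd + 1) ^+ 2 * (2 ^+ 13 + 1) * K.
have D0 : 0 < D.
  apply: addr_gt0; first by rewrite mulr_gt0// addr_gt0.
  by rewrite !mulr_gt0 ?exprn_gt0 ?addr_gt0 ?exprn_gt0.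
(* A factor [2 ^+ 5] comes from [lower_spread_rate] and 8 from the bound [L / 8] of [Sh]. *)
pose cl' := cl / 2 ^+ 8.
have cl'0 : 0 < cl' by rewrite divr_gt0 ?exprn_gt0.
exists (D / cl'), (Cn * K + 64 * ((normal_peak 1)^-1 * K) + 2 ^+ 13).
split; first exact: divr_gt0.
move=> tau n s theta; rewrite !ge_max => /andP[t4 /andP[tt1 tt2]] s0 sn sK th.
set alpha := expR (- tau ^+ 2) in sK *.
have tau1 : 1 <= tau by lra.
have tau0 : 0 < tau by lra.
have a0 : 0 < alpha by exact: expR_gt0.
have [a02 _ _] : [/\ 0 < alpha <= 2^-1, posterior_weight delta alpha 0 < 2^-1
    & alpha * slab_convolution delta 0 <= phi 0].
  by apply: small => //; rewrite normr0 ltW.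
have h01 : 0 < alpha < 1 by rewrite a0/=; lra.
have n0 : (0 < n)%N by apply: leq_trans sn; rewrite muln_gt0.
have n0' : 0 < n%:R :> R by rewrite ltr0n.
have s0' : 0 < s%:R :> R by rewrite ltr0n.
pose A := alpha * tau `^ (q - delta).
have A0 : 0 < A by rewrite mulr_gt0 ?powR_gt0.
pose V := alpha * tau `^ (2 * q - delta).
have V0 : 0 < V by rewrite mulr_gt0 ?powR_gt0.
pose L := n%:R * A.
have L0 : 0 < L by exact: mulr_gt0.
have [EW EW2] := null tau tau1; rewrite -/alpha in EW EW2.
have W0 x : 0 <= W alpha x by exact: risk_bound_ge0.
have [eW EWE /andP[mW0 mWle]] := @fine_integral_le _ (measurableTypeR R)
  (normal_prob 0 1 : probability _ R) _ _ W0 EW.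
pose h := null_spread_lower delta q alpha tau.
have h0 x : 0 <= h x by exact: null_spread_lower_ge0.
have Eh : (\int[normal_prob 0%R 1%R]_x (h x)%:E = (A / 2)%:E)%E.
  by rewrite null_spread_lower_mean.
have Eh2 : (\int[normal_prob 0%R 1%R]_x (h x ^+ 2)%:E <=
    ((normal_peak 1)^-1 * V)%:E)%E.
  exact: null_spread_lower_sqr.
pose z (c x : R) : R := (1 + `|x - c|) ^+ 2.
have z0 c x : 0 <= z c x by exact: sqr_ge0.
have mz c : measurable_fun setT (z c).
  apply: measurable_funX; apply: measurable_funD => //.
  by apply: measurableT_comp => //; exact: measurable_funB.
have gint c (f : R -> R) : measurable_fun setT f -> (forall x, 0 <= f x) ->
    (forall x, f x <= (1 + `|x - c|) ^+ 6) ->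
    (\int[normal_prob c 1%R]_x (f x)%:E <= (2 ^+ 13)%:E)%E.
  move=> mf f0 fc; rewrite ge0_integral_normal_prob; first last.
  - by move=> x; rewrite lee_fin.
  - by apply/measurable_EFinP; exact: mf.
  rewrite -[X in (_ <= X%:E)%E]mulr1; apply: le_integral_gaussian => // x.
  by rewrite mul1r.
have Ez c : (\int[normal_prob c 1%R]_x (z c x)%:E <= (2 ^+ 13)%:E)%E.
  by apply: gint => // x; rewrite ler_weXn2l// lerDl.
have Ez2 c : (\int[normal_prob c 1%R]_x (z c x ^+ 2)%:E <= (2 ^+ 13)%:E)%E.
  apply: gint => [|x|x].
  - by apply: measurable_funX; exact: mz.
  - exact: sqr_ge0.
  - by rewrite /z -exprM ler_weXn2l// lerDl.
pose nul := [pred i | tnth theta i == 0].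
pose sig := [pred i | tnth theta i != 0].
have sigs : (#|sig| <= s)%N by exact: th.
have nulsig : (#|nul| + #|sig| = n)%N.
  have := cardC nul; rewrite card_ord => cE; apply: etrans cE.
  by congr addn; apply: eq_card.
have nE : n%:R = #|nul|%:R + #|sig|%:R :> R by rewrite -natrD nulsig.
have sigs' : #|sig|%:R <= s%:R :> R by rewrite ler_nat.
have sn' : 2 * s%:R <= n%:R :> R by rewrite -natrM ler_nat.
have sig0 : 0 <= #|sig|%:R :> R by [].
have nuln : n%:R / 2 <= #|nul|%:R :> R by lra.
have nulle : #|nul|%:R <= n%:R :> R by rewrite nE lerDl.
have [P PE lawE] := law_probability theta.
have mz' i : exists2 m, (\int[normal_prob (tnth theta i) 1%R]_x
    (z (tnth theta i) x)%:E = m%:E)%E & 0 <= m <= 2 ^+ 13.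
  exact: (@fine_integral_le _ (measurableTypeR R)
    (normal_prob (tnth theta i) 1 : probability _ R) _ _ (z0 _) (Ez _)).
have [mZ mZE mZb] : exists2 mZ : 'I_n -> R, (forall i,
    (\int[normal_prob (tnth theta i) 1%R]_x (z (tnth theta i) x)%:E = (mZ i)%:E)%E)
    & forall i, 0 <= mZ i <= 2 ^+ 13.
  have /choice[mZ H] : forall i, exists m, (\int[normal_prob (tnth theta i) 1%R]_x
      (z (tnth theta i) x)%:E = m%:E)%E /\ 0 <= m <= 2 ^+ 13.
    by move=> i; have [m ? ?] := mz' i; exists m.
  by exists mZ => i; have [] := H i.
pose fW i x := if nul i then W alpha x else 0.
pose fh i x := if nul i then h x else 0.
pose fz i x := if sig i then z (tnth theta i) x else 0.
pose muW i := if nul i then eW else 0.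
pose muh i := if nul i then A / 2 else 0.
pose muz i := if sig i then mZ i else 0.
have mfW i : measurable_fun setT (fW i).
  rewrite /fW; case: (nul i); first exact: measurable_risk_bound.
  exact: measurable_cst.
have mfh i : measurable_fun setT (fh i).
  rewrite /fh; case: (nul i); last exact: measurable_cst.
  exact: measurable_null_spread_lower.
have mfz i : measurable_fun setT (fz i).
  by rewrite /fz; case: (sig i); [exact: mz|exact: measurable_cst].
have fW0 i x : 0 <= fW i x by rewrite /fW; case: ifP.
have fh0 i x : 0 <= fh i x by rewrite /fh; case: ifP.
have fz0 i x : 0 <= fz i x by rewrite /fz; case: ifP.
have nulE i : nul i -> tnth theta i = 0 by move=> /eqP.
have EfW i : (\int[normal_prob (tnth theta i) 1%R]_x (fW i x)%:E = (muW i)%:E)%E.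
  rewrite /fW /muW; case: ifP => [/nulE ->//|_]; exact: integral0.
have EfW2 i : (\int[normal_prob (tnth theta i) 1%R]_x (fW i x ^+ 2)%:E <=
    (if nul i then Cn * V else 0)%:E)%E.
  rewrite /fW; case: ifP => [/nulE ->//|_].
  by rewrite expr0n/= integral0.
have Efh i : (\int[normal_prob (tnth theta i) 1%R]_x (fh i x)%:E = (muh i)%:E)%E.
  rewrite /fh /muh; case: ifP => [/nulE ->//|_]; exact: integral0.
have Efh2 i : (\int[normal_prob (tnth theta i) 1%R]_x (fh i x ^+ 2)%:E <=
    (if nul i then (normal_peak 1)^-1 * V else 0)%:E)%E.
  rewrite /fh; case: ifP => [/nulE ->//|_].
  by rewrite expr0n/= integral0.
have Efz i : (\int[normal_prob (tnth theta i) 1%R]_x (fz i x)%:E = (muz i)%:E)%E.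
  rewrite /fz /muz; case: ifP => [_|_]; first exact: mZE.
  exact: integral0.
have Efz2 i : (\int[normal_prob (tnth theta i) 1%R]_x (fz i x ^+ 2)%:E <=
    (if sig i then 2 ^+ 13 else 0)%:E)%E.
  rewrite /fz; case: ifP => _; first exact: Ez2.
  by rewrite expr0n/= integral0.
have L80 : 0 < L / 8 by rewrite divr_gt0.
have Wdev := chebyshev_coordinate_sum PE mfW fW0 L0 EfW EfW2.
have hdev := chebyshev_coordinate_sum PE mfh fh0 L80 Efh Efh2.
have zdev := chebyshev_coordinate_sum PE mfz fz0 s0' Efz Efz2.
have mWdev := measurable_deviation mfW (\sum_i muW i) L.
have mhdev := measurable_deviation mfh (\sum_i muh i) (L / 8).
have mzdev := measurable_deviation mfz (\sum_i muz i) s%:R.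
have vr C (C0 : 0 <= C) := variance_ratio a0 tau0 n0 s0 C0 sK.
apply: (@le_trans _ _ (1 - (Cn * K / s%:R +
   64 * ((normal_peak 1)^-1 * K) / s%:R + 2 ^+ 13 / s%:R))%:E).
  by rewrite -!mulrDl lexx.
have good := @probability_setC3_ge _ _ P _ _ _ (Cn * K / s%:R)
  (64 * ((normal_peak 1)^-1 * K) / s%:R) (2 ^+ 13 / s%:R) mWdev mhdev mzdev.
apply: le_trans (good _ _ _) _.
- apply: le_trans Wdev _; rewrite lee_fin sum_if_const.
  apply: le_trans (vr _ (ltW Cn0)); rewrite ler_pM2r ?invr_gt0 ?exprn_gt0//.
  by apply: ler_wpM2r => //; apply/ltW/mulr_gt0.
- apply: le_trans hdev _; rewrite lee_fin sum_if_const.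
  have k0' : 0 <= (normal_peak 1)^-1 :> R by rewrite invr_ge0 ltW.
  have key y : y / (L / 8) ^+ 2 = 64 * (y / L ^+ 2).
    by field; rewrite gt_eqF.
  rewrite [leRHS](_ : _ = 64 * ((normal_peak 1)^-1 * K / s%:R)); last by ring.
  rewrite key ler_pM2l//; apply: le_trans (vr _ k0').
  rewrite ler_pM2r ?invr_gt0 ?exprn_gt0//; apply: ler_wpM2r => //.
  by apply: mulr_ge0 => //; exact: ltW.
- apply: le_trans zdev _; rewrite lee_fin sum_if_const.
  rewrite ler_pdivrMr ?exprn_gt0//.
  rewrite [leRHS](_ : _ = s%:R * 2 ^+ 13); last by field; rewrite gt_eqF.
  by rewrite ler_pM2r ?exprn_gt0.
(* From here on the argument is deterministic, at an observation outside the three deviation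
   events. *)
rewrite -lawE; apply: law_monotone => X /=.
move=> /not_orP[/not_orP[/negP XW /negP Xh] /negP Xz].
rewrite -ltNge in XW; rewrite -ltNge in Xh; rewrite -ltNge in Xz.
have [Q QE spreadE] := posterior_spreadE X h01.
rewrite /credible_set/= spreadE.
(* The rate condition in the form in which the null coordinates pay for the loss at the signals. *)
have Lq : s%:R * tau `^ q <= K * L.
  rewrite (_ : q = delta + (q - delta)); last by ring.
  rewrite powRD; last by apply/implyP => _; rewrite gt_eqF.
  rewrite mulrA /L /A [leRHS](_ : _ = K * (n%:R * alpha) * tau `^ (q - delta)).
    by rewrite ler_wpM2r ?powR_ge0.
  by ring.
have SW : \sum_i fW i (tnth X i) <= (Cn + 1) * L.
  have muWle : \sum_i muW i <= Cn * L.
    rewrite sum_if_const (_ : Cn * L = n%:R * (Cn * A)); last by rewrite /L; ring.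
    by apply: ler_pM.
  by rewrite mulrDl mul1r; exact: deviation_le muWle.
have Sz : \sum_i fz i (tnth X i) <= (2 ^+ 13 + 1) * s%:R.
  have muzle : \sum_i muz i <= 2 ^+ 13 * s%:R.
    apply: (@le_trans _ _ (\sum_i if sig i then 2 ^+ 13 else 0)).
      by apply: ler_sum => i _; rewrite /muz; case: ifP => // _; case/andP: (mZb i).
    by rewrite sum_if_const mulrC ler_pM2l// exprn_gt0.
  by rewrite mulrDl mul1r; exact: deviation_le muzle.
have Sh : L / 8 <= \sum_i fh i (tnth X i).
  have muhge : L / 4 <= \sum_i muh i.
    rewrite sum_if_const (_ : L / 4 = n%:R / 2 * (A / 2)); last by rewrite /L; field.
    by rewrite ler_pM2r// divr_gt0.
  by rewrite (_ : L / 8 = L / 4 - L / 8); [exact: deviation_ge muhge|field].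
have distD : dist_q q theta (posterior_median delta alpha X) <= D * L.
  apply: (@le_trans _ _ (Cm * \sum_i fW i (tnth X i) +
      (Cd + 1) ^+ 2 * tau `^ q * \sum_i fz i (tnth X i))).
    rewrite /dist_q !mulr_sumr -big_split/=; apply: ler_sum => i _.
    rewrite tnth_mktuple /fW /fz /nul /sig/=.
    have [->|thi] := eqVneq (tnth theta i) 0.
      by rewrite sub0r normrN mulr0 addr0; exact: medW.
    rewrite mulr0 add0r -mulrA; apply: signal_loss_le => //.
    exact: dist.
  rewrite /D mulrDl; apply: lerD; first by rewrite -mulrA ler_pM2l.
  rewrite -mulrA -[leRHS]mulrA -[leRHS]mulrA ler_pM2l ?exprn_gt0 ?addr_gt0//.
  apply: (@le_trans _ _ (tau `^ q * ((2 ^+ 13 + 1) * s%:R))).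
    by rewrite ler_wpM2l ?powR_ge0.
  rewrite mulrCA mulrC [tau `^ q * _]mulrC [leRHS]mulrC.
  by rewrite ler_pM2r// addr_gt0 ?exprn_gt0.
have spreadL : ((cl' * L)%:E <= \sum_(i < n) \int[Q i]_u
    (`|u - med alpha (tnth X i)| `^ q)%:E)%E.
  apply: (@le_trans _ _ (cl / 2 ^+ 5 * \sum_i fh i (tnth X i))%:E).
    rewrite lee_fin (_ : cl' * L = cl / 2 ^+ 5 * (L / 8)); last first.
      by rewrite /cl'; field.
    by rewrite ler_pM2l// divr_gt0 ?exprn_gt0.
  rewrite mulr_sumr -sumEFin; apply: lee_sum => i _.
  have int0 : (0 <= \int[Q i]_u (`|u - med alpha (tnth X i)| `^ q)%:E)%E.
    by apply: integral_ge0 => u _; rewrite lee_fin powR_ge0.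
  rewrite /fh; case: ifP => _; last by rewrite mulr0.
  rewrite /h /null_spread_lower indicE mem_setE in_itv/=.
  case: (boolP (_ <= _ <= _)) => xb; last by rewrite !mulr0.
  have [xabs x2] := upper_half t4 xb; rewrite mulr1.
  have [_ wlt agp] := small _ _ tt1 xabs.
  apply: le_trans (spread_ge _ _ _ h01 x2 wlt agp (QE i)).
  rewrite lee_fin -mulrA ler_pM2l//.
  have phx := phi_gt0 (tnth X i).
  have := lower_spread_rate tau1 xb; move: (tnth X i) phx => y phx ly.
  rewrite [leRHS](_ : _ = alpha / phi y * (y `^ q * slab_tail delta y)); last by ring.
  rewrite [leLHS](_ : _ = alpha / phi y * (tau `^ (q - 1 - delta) / 2 ^+ 5)).
    by rewrite ler_pM2l// divr_gt0.
  by field; rewrite gt_eqF.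
apply: (@le_trans _ _ (D * L)%:E); first by rewrite lee_fin.
apply: (@le_trans _ _ ((D / cl')%:E * (cl' * L)%:E)%E).
  have e y w v : w != 0 -> y / w * (w * v) = y * v by move=> ?; field.
  by rewrite -EFinM lee_fin e ?gt_eqF// lexx.
by apply: lee_wpmul2l => //; rewrite lee_fin divr_ge0// ltW.
Qed.

End finite_sample.

(** * Upper bound on the coverage of intermediate signals *)

Section finite_sample_failure.
Context (R : realType) (delta q : R).
Hypotheses (hdelta : 0 < delta < 2) (hq : 0 < q <= 2) (hqd : delta < q).
Local Notation W := (risk_bound delta q).
Local Notation med alpha x := (median (coord_posterior delta alpha x)).
Implicit Types alpha tau t x y b c M : R.

(** Counting: the [s] coordinates in the band are nonzero since the threshold is positive, and the
    ball allows no further ones. *)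
Lemma intermediate_signalsP alpha (n s : nat) (theta : n.-tuple R) :
  0 < threshold delta alpha -> intermediate_signals delta alpha n s theta ->
  #|[pred i | tnth theta i != 0]| = s /\
  forall i, tnth theta i != 0 ->
    threshold delta alpha / 8 <= `|tnth theta i| <= threshold delta alpha / 4.
Proof.
set t := threshold delta alpha => t0 [/= th0 ths].
have sub : {subset [pred i | t / 8 <= `|tnth theta i| <= t / 4] <=
    [pred i | tnth theta i != 0]}.
  move=> i; rewrite !inE => /andP[ti _]; rewrite -normr_gt0.
  by apply: lt_le_trans ti; rewrite divr_gt0.
have cE : #|[pred i | tnth theta i != 0]| = s.
  have := subset_leq_card (introT fintype.subsetP sub); rewrite ths => sle.
  by apply/eqP; rewrite eqn_leq th0.
split=> // i thi.
have /subset_cardP cardP : #|[pred i | t / 8 <= `|tnth theta i| <= t / 4]| =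
  #|[pred i | tnth theta i != 0]| by rewrite cE.
have /cardP/(_ i) : [pred i | t / 8 <= `|tnth theta i| <= t / 4] \subset
  [pred i | tnth theta i != 0] by exact/fintype.subsetP.
by rewrite !inE thi.
Qed.

(** Coverage bounds the loss by [M] times the spread. Adding [T8] for each signal observed beyond
    the threshold makes the loss side at least [s * T8] at every observation, so one Markov
    inequality handles spread and exceedances together. *)
Lemma coverage_le : exists2 t0, 1 <= t0 & forall M, 0 < M ->
  exists2 C, 0 < C & forall tau (n s : nat) (theta : n.-tuple R),
    t0 <= tau -> (0 < s)%N ->
    intermediate_signals delta (expR (- tau ^+ 2)) n s theta ->
    (coverage delta (expR (- tau ^+ 2)) q M theta <=
     (C * (n%:R * expR (- tau ^+ 2) / (s%:R * tau `^ delta) + (tau `^ q)^-1))%:E)%E.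
Proof.
have [Cs Cs0 spread_le] := coord_spread_le hdelta hq.
have [t1 t11 small] := small_posterior_weight hdelta.
have [t2 t21 tge] := threshold_ge hdelta.
have [Cn Cn0 null] := null_moments hq hqd.
have [Ct Ct0 tw] := threshold_weight hdelta.
have [Cg Cg0 sigm] := signal_mean hdelta hq Ct0.
(* Since the threshold is at least tau, this makes [threshold_weight] applicable. *)
exists (Num.max (slab_radius R) (Num.max t1 t2)).
  by rewrite !le_max t11 orbT.
move=> M M0; pose MC := M * Cs.
have MC0 : 0 < MC by exact: mulr_gt0.
exists (64 * (MC * Cn) + 64 * (MC * Cg) + 2 ^+ 14).
  by rewrite !addr_gt0 ?exprn_gt0 ?mulr_gt0.
move=> tau n s theta; rewrite !ge_max => /andP[tB /andP[tt1 tt2]] s0 th.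
set alpha := expR (- tau ^+ 2) in th *.
have tau1 : 1 <= tau by lra.
have tau0 : 0 < tau by lra.
have a0 : 0 < alpha by exact: expR_gt0.
have [a02 _ _] : [/\ 0 < alpha <= 2^-1, posterior_weight delta alpha 0 < 2^-1
    & alpha * slab_convolution delta 0 <= phi 0].
  by apply: small => //; rewrite normr0 ltW.
have h01 : 0 < alpha < 1 by rewrite a0/=; lra.
have s0' : 0 < s%:R :> R by rewrite ltr0n.
have taut := tge _ tt2; have := tw _ h01; rewrite /= -/alpha in taut *.
have [tpos tP] := threshold_is_threshold hdelta h01.
have [sigE sigb] := intermediate_signalsP tpos th.
move: tpos tP taut sigb; set t := threshold delta alpha => t0 tP taut sigb at_.
have {}at_ : alpha <= Ct * ((1 + t) ^+ 3 * phi t) by apply: at_; lra.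
pose A := alpha * tau `^ (q - delta).
have A0 : 0 < A by rewrite mulr_gt0 ?powR_gt0.
have [EW _] := null tau tau1; rewrite -/alpha in EW.
have W0 x : 0 <= W alpha x by exact: risk_bound_ge0.
pose T8 := (t / 8) `^ q.
have T80 : 0 < T8 by rewrite powR_gt0 ?divr_gt0.
pose sig := [pred i | tnth theta i != 0].
pose ex x : R := \1_[set y : R | t < `|y|] x.
pose f i x := MC * W alpha x + (if sig i then T8 * ex x else 0).
have mex : measurable_fun setT ex.
  apply: measurable_indic; rewrite -[X in measurable X]setTI.
  exact: (@measurable_fun_ltr _ _ _ _ (fun=> t) (@Num.norm _ R)).
have ex0 x : 0 <= ex x by [].
have mW := measurable_risk_bound delta q alpha.
have mf2 i : measurable_fun setT (fun x => if sig i then T8 * ex x else 0).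
  case: (sig i); last exact: measurable_cst.
  by apply: measurable_funM => //; exact: measurable_cst.
have mf1 : measurable_fun setT (fun x => MC * W alpha x).
  by apply: measurable_funM; [exact: measurable_cst|exact: mW].
have mf i : measurable_fun setT (f i).
  by apply: measurable_funD; [exact: mf1|exact: mf2].
have MW0 x : 0 <= MC * W alpha x by rewrite mulr_ge0// ltW.
have f20 i x : 0 <= (if sig i then T8 * ex x else 0).
  by case: ifP => // _; rewrite mulr_ge0// ltW.
have f0 i x : 0 <= f i x by rewrite addr_ge0.
have [P PE lawE] := law_probability theta.
pose bn := MC * (Cn * A).
pose bs := MC * Cg + T8 * (2 ^+ 14 / t ^+ 2).
have bn0 : 0 <= bn by apply/ltW/mulr_gt0 => //; exact: mulr_gt0.
have bs0 : 0 <= bs.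
  apply/ltW/addr_gt0; first exact: mulr_gt0.
  by apply: mulr_gt0 => //; rewrite divr_gt0 ?exprn_gt0.
have Ef i : (\int[normal_prob (tnth theta i) 1%R]_x (f i x)%:E <=
    (bn + if sig i then bs else 0)%:E)%E.
  rewrite [leLHS](_ : _ = (MC%:E * \int[normal_prob (tnth theta i) 1%R]_x
     (W alpha x)%:E + \int[normal_prob (tnth theta i) 1%R]_x
     (if sig i then T8 * ex x else 0)%:E)%E); last first.
    rewrite -ge0_integralZl_EFin//; first last.
    - exact: ltW.
    - by apply/measurable_EFinP; exact: mW.
    - by move=> x _; rewrite lee_fin.
    rewrite -ge0_integralD//.
    - by move=> x _; rewrite -EFinM lee_fin.
    - by apply: measurable_funeM; apply/measurable_EFinP; exact: mW.
    - by move=> x _; rewrite lee_fin.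
    - by apply/measurable_EFinP; exact: mf2.
  have MCe : (0 <= MC%:E)%E by rewrite lee_fin ltW.
  case: ifP => /= si.
    have /andP[_ thi] := sigb _ si.
    have E1 := sigm alpha t (tnth theta i) a0 t0 at_ thi.
    have E2 := exceedance_mean t0 thi.
    apply: (@le_trans _ _ (bs%:E)); last by rewrite lee_fin; lra.
    rewrite /bs EFinD; apply: leeD.
      by rewrite [leRHS]EFinM; exact: lee_wpmul2l.
    rewrite (_ : (fun x => _) = fun x => (T8%:E * (ex x)%:E)%E)//.
    rewrite ge0_integralZl_EFin//; first last.
    - exact: ltW.
    - by apply/measurable_EFinP; exact: mex.
    - by move=> x _; rewrite lee_fin.
    by rewrite [leRHS]EFinM; apply: lee_wpmul2l; [rewrite lee_fin ltW|exact: E2].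
  rewrite integral0 adde0 addr0; move/negbFE/eqP: si => ->.
  by rewrite /bn [leRHS]EFinM; exact: lee_wpmul2l.
have c0 : 0 < s%:R * T8 by exact: mulr_gt0.
have := @markov_coordinate_sum _ (measurableTypeR R) R n _ P PE f mf f0
  (n%:R * bn + s%:R * bs) (s%:R * T8) c0.
have -> : (\sum_(i < n) \int[normal_prob (tnth theta i) 1%R]_x (f i x)%:E <=
    (n%:R * bn + s%:R * bs)%:E)%E.
  apply: (@le_trans _ _ (\sum_(i < n) (bn + if sig i then bs else 0)%:E)%E).
    exact: lee_sum.
  rewrite sumEFin lee_fin big_split/= sumr_const card_ord.
  by rewrite sum_if_const sigE -[bn *+ n]mulr_natl.
move=> /(_ isT) mk.
rewrite /coverage; apply: (@le_trans _ _
  (law theta [set x | s%:R * T8 <= \sum_(i < n) f i (tnth x i)])).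
  apply: law_monotone => X /=; rewrite /credible_set/=.
  have [Q QE ->] := posterior_spreadE q hdelta X h01 => cred.
  have spr : (\sum_(i < n) \int[Q i]_u (`|u - med alpha (tnth X i)| `^ q)%:E <=
      (Cs * \sum_i W alpha (tnth X i))%:E)%E.
    rewrite mulr_sumr -sumEFin; apply: lee_sum => i _.
    by apply: spread_le => //; exact: QE.
  have {}cred : dist_q q theta (posterior_median delta alpha X) <=
      MC * \sum_i W alpha (tnth X i).
    rewrite -lee_fin; apply: (le_trans cred).
    rewrite /MC -mulrA [leRHS]EFinM; apply: lee_wpmul2l => //.
    by rewrite lee_fin ltW.
  rewrite big_split/= -mulr_sumr.
  apply: le_trans (lerD cred (lexx _)).
  rewrite /dist_q -big_split/= -sigE -(sum_if_const sig T8).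
  apply: ler_sum => i _; rewrite tnth_mktuple.
  have p0 y : 0 <= `|y| `^ q by exact: powR_ge0.
  rewrite -[tnth theta i != 0]/(sig i); case: ifP => si; last by rewrite addr0.
  (* Beyond the threshold the indicator supplies [T8]; otherwise the median is 0 and the loss is the
     signal itself, at least [t / 8]. *)
  rewrite /ex indicE; case: (boolP (_ \in _)) => [_|/=].
    by rewrite mulr1 lerDr.
  rewrite notin_setE/= => /negP; rewrite -leNgt => /tP ->.
  rewrite mulr0 addr0 subr0.
  by apply: (le_powRq hq); [rewrite divr_ge0// ltW|case/andP: (sigb _ si)].
rewrite lawE; apply: (le_trans mk); rewrite lee_fin.
have T8ge : tau `^ q / 64 <= T8.
  rewrite ler_pdivrMr// mulrC (_ : 64 = 8 ^+ 2); last by rewrite -natrX.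
  apply: (@le_trans _ _ ((8 * (t / 8)) `^ q)).
    by apply: (le_powRq hq); [exact: ltW|rewrite mulrC divfK].
  by apply: (powRq_scale hq); [rewrite ler1n|rewrite divr_ge0// ltW].
have tq0 : 0 < tau `^ q by rewrite powR_gt0.
have T8V : T8^-1 <= 64 * (tau `^ q)^-1.
  rewrite -[64]invrK -invfM lef_pV2 ?posrE// ?mulr_gt0 ?invr_gt0//.
  by rewrite mulrC.
have t2q : (t ^+ 2)^-1 <= (tau `^ q)^-1.
  rewrite lef_pV2 ?posrE ?exprn_gt0//; apply: (@le_trans _ _ (tau ^+ 2)).
    exact: powR_le_sqr.
  by apply: lerXn2r; rewrite ?nnegrE// ltW.
have AE : A = alpha * tau `^ q / tau `^ delta.
  rewrite /A -mulrA -powRN -powRD//; apply/implyP => _; rewrite gt_eqF//.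
have td0 : 0 < tau `^ delta by rewrite powR_gt0.
pose r := n%:R * alpha / (s%:R * tau `^ delta).
have r0 : 0 <= r by rewrite divr_ge0 ?mulr_ge0// ltW.
have v0 : 0 <= (tau `^ q)^-1 by rewrite invr_ge0 ltW.
apply: (@le_trans _ _ (64 * (MC * Cn) * r + (64 * (MC * Cg) + 2 ^+ 14) *
    (tau `^ q)^-1)); last first.
  have c1 : 0 <= 64 * (MC * Cn) by rewrite !mulr_ge0// ltW.
  have c2 : 0 <= 64 * (MC * Cg) + 2 ^+ 14.
    by rewrite addr_ge0 ?exprn_ge0// !mulr_ge0// ltW.
  rewrite -[in leRHS]addrA [leRHS]mulrDl; apply: lerD; first by rewrite ler_wpM2l// lerDl.
  by rewrite ler_wpM2l// lerDr.
rewrite [leLHS]mulrDl; apply: lerD.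
  rewrite [leLHS](_ : _ = T8^-1 * (n%:R * bn / s%:R)); last first.
    by field; rewrite !gt_eqF.
  apply: (@le_trans _ _ (64 * (tau `^ q)^-1 * (n%:R * bn / s%:R))).
    by apply: ler_wpM2r => //; apply: divr_ge0 => //; exact: mulr_ge0.
  rewrite /bn AE /r le_eqVlt; apply/orP; left; apply/eqP.
  by field; rewrite !gt_eqF.
rewrite [leLHS](_ : _ = bs * T8^-1); last by field; rewrite !gt_eqF.
rewrite /bs [leLHS]mulrDl [leRHS]mulrDl; apply: lerD.
  rewrite [leRHS](_ : _ = MC * Cg * (64 * (tau `^ q)^-1)); last by ring.
  by rewrite ler_wpM2l// ltW// mulr_gt0.
rewrite [leLHS](_ : _ = 2 ^+ 14 * (t ^+ 2)^-1); last first.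
  by field; rewrite !gt_eqF.
by rewrite ler_wpM2l// exprn_ge0.
Qed.

End finite_sample_failure.

(** * Asymptotics *)

Section asymptotics.
Context (R : realType) (delta q : R).
Hypotheses (hdelta : 0 < delta < 2) (hq : 0 < q <= 2) (hqd : delta < q).
Implicit Types (alpha tau c C : R) (n s : nat).

Let d0 : 0 < delta. Proof. by case/andP: hdelta. Qed.
Let d2 : delta < 2. Proof. by case/andP: hdelta. Qed.

Lemma gaussian_scale alpha c : 0 <= c -> 0 < alpha <= expR (- c ^+ 2) ->
  exists2 tau, c <= tau & alpha = expR (- tau ^+ 2).
Proof.
move=> c0 /andP[a0 ac]; have cl : c ^+ 2 <= - ln alpha.
  by rewrite lerNr -[leRHS]expRK ler_ln ?posrE ?expR_gt0.
exists (Num.sqrt (- ln alpha)).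
  by rewrite -[leLHS]ger0_norm// -sqrtr_sqr ler_wsqrtr.
rewrite sqr_sqrtr ?opprK ?lnK// ?posrE//.
by apply: le_trans cl; exact: sqr_ge0.
Qed.

Lemma powR_half tau : 0 <= tau -> (tau ^+ 2) `^ (delta / 2) = tau `^ delta.
Proof.
by move=> t0; rewrite -powR_mulrn// -powRrM; congr powR; field.
Qed.

(** As the logarithm is at least 1, the rate gives [s / n <= C * alpha]; taking logarithms,
    [tau ^+ 2] is at most [1 + |ln C|] times [ln (n / s)]. *)
Lemma rate_upper s n C tau : (0 < s)%N -> (0 < n)%N -> 0 < C -> 0 <= tau ->
  1 <= ln (n%:R / s%:R : R) ->
  s%:R * ln (n%:R / s%:R) `^ (delta / 2) / n%:R <= C * expR (- tau ^+ 2) ->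
  s%:R * tau `^ delta <=
    (1 + `|ln C|) `^ (delta / 2) * C * (n%:R * expR (- tau ^+ 2)).
Proof.
move=> s0 n0 C0 t0; set L := ln _ => L1 rC.
have s0' : 0 < s%:R :> R by rewrite ltr0n.
have n0' : 0 < n%:R :> R by rewrite ltr0n.
have dd : 0 <= delta / 2 by rewrite divr_ge0// ltW.
have Lp1 : 1 <= L `^ (delta / 2).
  apply: (@le_trans _ _ (1 `^ (delta / 2))); first by rewrite powR1.
  apply: ge0_ler_powR => //; rewrite ?nnegrE//.
  exact: le_trans L1.
have tL : tau ^+ 2 <= (1 + `|ln C|) * L.
  have h : s%:R / n%:R <= C * expR (- tau ^+ 2).
    by apply: le_trans rC; rewrite ler_pM2r ?invr_gt0// ler_peMr// ltW.
  have : ln (s%:R / n%:R) <= ln (C * expR (- tau ^+ 2)).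
    by rewrite ler_ln ?posrE ?divr_gt0 ?mulr_gt0 ?expR_gt0.
  rewrite lnM ?posrE ?expR_gt0// expRK.
  have -> : ln (s%:R / n%:R) = - L by rewrite /L -[n%:R / _]invf_div lnV ?opprK// posrE divr_gt0.
  have := ler_norm (ln C); have := normr_ge0 (ln C).
  by move: (`|ln C|) => c c0 Cc; nra.
apply: (@le_trans _ _ (s%:R * ((1 + `|ln C|) `^ (delta / 2) * L `^ (delta / 2)))).
  rewrite ler_pM2l// -powR_half// -powRM; [|by rewrite addr_ge0|lra].
  by apply: ge0_ler_powR => //; rewrite ?nnegrE ?sqr_ge0// (le_trans _ tL)// sqr_ge0.
rewrite mulrCA -mulrA ler_wpM2l ?powR_ge0//.
by rewrite [leRHS]mulrCA [leRHS]mulrC -ler_pdivrMr.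
Qed.

Lemma ln_le_half c : 0 < c -> ln c <= c / 2.
Proof.
move=> c0; rewrite -[leRHS]expRK ler_ln ?posrE ?expR_gt0//.
have := expR_ge1Dx (c / 4).
have -> : expR (c / 2) = expR (c / 4) ^+ 2.
  by rewrite expr2 -expRD; congr expR; field.
move: (expR _) => e ce; have := sqr_ge0 (c / 4 - 1); nra.
Qed.

(** Since [c <= 1] and [delta / 2 < 1], [alpha <= L * s / n]; logarithms and [ln L <= L / 2] give
    the first claim. It bounds the power of [L] by [2 * tau ^ delta], whence the second. *)
Lemma rate_lower s n c tau : (0 < s)%N -> (0 < n)%N -> 0 < c <= 1 -> 0 <= tau ->
  1 <= ln (n%:R / s%:R : R) ->
  expR (- tau ^+ 2) <= c * (s%:R * ln (n%:R / s%:R) `^ (delta / 2) / n%:R) ->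
  ln (n%:R / s%:R) / 2 <= tau ^+ 2 /\
  n%:R * expR (- tau ^+ 2) / (s%:R * tau `^ delta) <= 2 * c.
Proof.
move=> s0 n0 /andP[c0 c1] t0; set L := ln _ => L1 rC.
have s0' : 0 < s%:R :> R by rewrite ltr0n.
have n0' : 0 < n%:R :> R by rewrite ltr0n.
have dd : 0 <= delta / 2 by rewrite divr_ge0// ltW.
have L0 : 0 < L by lra.
have tL : L / 2 <= tau ^+ 2.
  have LL : L `^ (delta / 2) <= L.
    by rewrite -[leRHS]powRr1 ?(ltW L0)// ler_powR//; have := d2; lra.
  have h : expR (- tau ^+ 2) <= L * (s%:R / n%:R).
    apply: (le_trans rC).
    rewrite [leLHS](_ : _ = (c * L `^ (delta / 2)) * (s%:R / n%:R)); last by ring.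
    rewrite ler_pM2r ?divr_gt0//; apply: (le_trans _ LL).
    by rewrite ler_piMl ?powR_ge0.
  have : ln (expR (- tau ^+ 2)) <= ln (L * (s%:R / n%:R)).
    by rewrite ler_ln ?posrE ?expR_gt0 ?mulr_gt0 ?invr_gt0.
  rewrite expRK lnM ?posrE ?divr_gt0//.
  have -> : ln (s%:R / n%:R) = - L by rewrite /L -[n%:R / _]invf_div lnV ?opprK// posrE divr_gt0.
  by have := ln_le_half L0; lra.
split=> //.
have t1 : 0 < tau by rewrite lt0r t0 andbT; apply/eqP => tE; move: tL; rewrite tE expr0n/=; lra.
have td0 : 0 < tau `^ delta by rewrite powR_gt0.
rewrite ler_pdivrMr ?mulr_gt0//.
apply: (@le_trans _ _ (c * s%:R * L `^ (delta / 2))).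
  move: rC; rewrite !mulrA ler_pdivlMr// [_ * n%:R]mulrC.
  by apply: le_trans.
rewrite [leRHS](_ : _ = c * s%:R * (2 * tau `^ delta)); last by ring.
rewrite ler_pM2l ?mulr_gt0// -(powR_half t0).
apply: (@le_trans _ _ ((2 * tau ^+ 2) `^ (delta / 2))).
  by apply: ge0_ler_powR => //; rewrite ?nnegrE; lra.
rewrite powRM ?sqr_ge0// ler_wpM2r ?powR_ge0//.
by rewrite -[leRHS]powRr1// ler_powR ?ler1n//; have := d2; lra.
Qed.

Lemma near_log_ratio (s : nat -> nat) (A : R) : s @ \oo --> \oo ->
  (fun n => (s n)%:R : R) =o_\oo (fun n => n%:R : R) ->
  \forall n \near \oo,
    [/\ (0 < s n)%N, (2 * s n <= n)%N & A <= ln (n%:R / (s n)%:R : R)].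
Proof.
move=> soo so.
have key (c : R) : 0 < c -> \forall n \near \oo, (s n)%:R <= c * n%:R :> R.
  move=> c0; have := (eqoP _ _ _).1 so c c0.
  by apply: filterS => n; rewrite !ger0_norm.
near=> n.
have s0 : (0 < s n)%N by near: n; move/cvgnyPge : soo; exact.
have s0' : 0 < (s n)%:R :> R by rewrite ltr0n.
have h1 : (s n)%:R <= 2^-1 * n%:R :> R by near: n; apply: key.
have h2 : (s n)%:R <= expR (- A) * n%:R :> R.
  by near: n; apply: key; exact: expR_gt0.
have n0 : 0 < n%:R :> R by lra.
split=> //; first by rewrite -(ler_nat R) natrM; lra.
rewrite -[leLHS]expRK ler_ln ?posrE ?expR_gt0 ?divr_gt0//.
by rewrite ler_pdivlMr// mulrC -ler_pdivlMr ?expR_gt0// -expRN mulrC.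
Unshelve. all: by end_near. Qed.

Lemma coverage_ge0 alpha M n (theta : n.-tuple R) :
  (0 <= coverage delta alpha q M theta)%E.
Proof.
have [P _ lawE] := law_probability theta.
apply: (@le_trans _ _ (law theta set0)); first by rewrite lawE measure0.
exact: law_monotone.
Qed.

Lemma coverage_le1 alpha M n (theta : n.-tuple R) :
  (coverage delta alpha q M theta <= 1)%E.
Proof.
have [P _ lawE] := law_probability theta.
apply: (@le_trans _ _ (law theta setT)); first exact: law_monotone.
by rewrite lawE probability_setT.
Qed.

(** An infimum over an empty set would be [+oo]. *)
Lemma zero_l0_ball n s : l0_ball n s [tuple of nseq n (0 : R)].
Proof.
rewrite /l0_ball/= eq_card0// => i; rewrite !inE.
by rewrite (tnth_nth 0) nth_nseq ltn_ord eqxx.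
Qed.

Lemma card_ord_ltn n s : (s <= n)%N -> #|[pred i : 'I_n | (i < s)%N]| = s.
Proof.
move=> sn; have inj : injective (widen_ord sn).
  by move=> i j /(congr1 val) ij; exact: val_inj.
rewrite -[RHS](card_ord s) -(card_codom inj); apply: eq_card => i; rewrite !inE; apply/idP/codomP => [iS|[j ->]]; last exact: (valP j).
by exists (Ordinal iS); apply: val_inj.
Qed.

(** A supremum over an empty set would be [-oo], so the limit 0 requires a member. *)
Lemma intermediate_signals_nonempty alpha n s :
  0 < threshold delta alpha -> (s <= n)%N ->
  exists theta, intermediate_signals delta alpha n s theta.
Proof.
set t := threshold delta alpha => t0 sn.
pose theta := [tuple (if (i < s)%N then t / 8 else 0) | i < n].
have th i : tnth theta i = if (i < s)%N then t / 8 else 0 by rewrite tnth_mktuple.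
have t8 : 0 < t / 8 by rewrite divr_gt0.
have card P : P =1 [pred i : 'I_n | (i < s)%N] -> #|P| = s.
  by move=> PE; rewrite (eq_card PE) card_ord_ltn.
exists theta; split => /=.
  rewrite /l0_ball/= card// => i; rewrite /= th.
  by case: ifP => _; [rewrite (gt_eqF t8)|rewrite eqxx].
apply: card => i; rewrite /= th.
case: ifP => _; last by rewrite normr0 leNgt t8.
by rewrite ger0_norm ?(ltW t8)// lexx/= ler_pM2l// lef_pV2 ?posrE// ler_nat.
Qed.

Lemma coverage_tendsto1 : exists2 alpha1 : R, 0 < alpha1 &
  forall (s : nat -> nat) (alpha : nat -> R),
  s @ \oo --> \oo ->
  (fun n => (s n)%:R : R) =o_\oo (fun n => n%:R : R) ->
  (forall n, 0 < alpha n < 1) ->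
  (exists2 C : R, 0 < C & \forall n \near \oo, rate delta s n <= C * alpha n) ->
  (\forall n \near \oo, alpha n <= alpha1) ->
  exists2 M : R, 0 < M &
    ereal_inf [set coverage delta (alpha n) q M theta0 |
               theta0 in l0_ball n (s n)] @[n --> \oo] --> 1%E.
Proof.
have [t0 t01 cov] := coverage_ge hdelta hq hqd.
(* [alpha <= alpha1] then means [t0 <= tau]. *)
exists (expR (- t0 ^+ 2)); first exact: expR_gt0.
move=> s alpha soo so a01 [C C0 rC] a1.
pose K := (1 + `|ln C|) `^ (delta / 2) * C.
have K0 : 0 < K by rewrite mulr_gt0// powR_gt0// ltr_pwDl.
have [M [D [M0 covM]]] := cov K K0.
exists M => //.
have lower : \forall n \near \oo, ((1 - D / (s n)%:R)%:E <=
    ereal_inf [set coverage delta (alpha n) q M theta0 |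
               theta0 in l0_ball n (s n)] <= 1)%E.
  near=> n.
  have [s0 sn L1] : [/\ (0 < s n)%N, (2 * s n <= n)%N &
      1 <= ln (n%:R / (s n)%:R : R)] by near: n; exact: near_log_ratio.
  have n0 : (0 < n)%N by apply: leq_trans sn; rewrite muln_gt0.
  have rCn : rate delta s n <= C * alpha n by near: n.
  have a1n : alpha n <= expR (- t0 ^+ 2) by near: n.
  have /andP[an0 _] := a01 n.
  have t00 : 0 <= t0 by lra.
  have ab : 0 < alpha n <= expR (- t0 ^+ 2) by rewrite an0.
  have [tau tt aE] := gaussian_scale t00 ab.
  have tau0 : 0 <= tau by lra.
  rewrite aE in rCn *; apply/andP; split.
    apply: le_ereal_inf_tmp => _ [theta th <-].
    apply: covM => //; exact: rate_upper.
  apply: ge_ereal_inf; exists (coverage delta (expR (- tau ^+ 2)) q M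
    [tuple of nseq n (0 : R)]); last exact: coverage_le1.
  by exists [tuple of nseq n (0 : R)] => //; exact: zero_l0_ball.
apply: (squeeze_cvge lower); last exact: cvg_cst.
have inv0 : (s n)%:R^-1 @[n --> \oo] --> (0 : R).
  apply/cvgr0Pnorm_le => e e0; near=> n.
  have se : ((Num.truncn e^-1).+1 <= s n)%N by near: n; move/cvgnyPge : soo; exact.
  have se' : e^-1 <= (s n)%:R.
    by apply: (le_trans (ltW (truncnS_gt _))); rewrite ler_nat.
  have s0 : 0 < (s n)%:R :> R by apply: lt_le_trans se'; rewrite invr_gt0.
  by rewrite ger0_norm ?invr_ge0 ?(ltW s0)// -[leRHS]invrK lef_pV2 ?posrE ?invr_gt0.
rewrite -[X in _ --> X%:E]subr0 -[X in 1 - X](mulr0 D).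
apply: cvg_EFin; first exact: nearW.
by apply: cvgB; [exact: cvg_cst|apply: cvgMr].
Unshelve. all: by end_near. Qed.

Lemma coverage_tendsto0 (s : nat -> nat) (alpha : nat -> R) :
  s @ \oo --> \oo ->
  (fun n => (s n)%:R : R) =o_\oo (fun n => n%:R : R) ->
  (forall n, 0 < alpha n < 1) ->
  alpha =o_\oo rate delta s ->
  forall M : R, 0 < M ->
    ereal_sup [set coverage delta (alpha n) q M theta0 |
               theta0 in intermediate_signals delta (alpha n) n (s n)]
      @[n --> \oo] --> 0%E.
Proof.
have [t0 t01 cov] := coverage_le hdelta hq hqd.
have q0 : 0 < q by case/andP: hq.
move=> soo so a01 ao M M0; have [C C0 covM] := cov M M0.
pose g (e : R) : R := C * (2 * e + e).
have small (e : R) : 0 < e <= 1 -> \forall n \near \oo,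
    (0 <= ereal_sup [set coverage delta (alpha n) q M theta0 |
      theta0 in intermediate_signals delta (alpha n) n (s n)] <= (g e)%:E)%E.
  move=> /andP[e0 e1].
  (* Since [tau ^+ 2] will be at least half the logarithm, this forces [t0 <= tau] and
     [tau ^ q >= 1 / e]. *)
  pose A : R := Num.max (2 * t0 ^+ 2) (2 * (e^-1 `^ q^-1) ^+ 2).
  near=> n.
  have [s0 sn L1] : [/\ (0 < s n)%N, (2 * s n <= n)%N &
      Num.max 1 A <= ln (n%:R / (s n)%:R : R)] by near: n; exact: near_log_ratio.
  have n0 : (0 < n)%N by apply: leq_trans sn; rewrite muln_gt0.
  have arate : `|alpha n| <= e * `|rate delta s n|.
    by near: n; exact: ((eqoP _ _ _).1 ao e e0).
  have /andP[an0 an1] := a01 n.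
  have rate0 : 0 <= rate delta s n by rewrite divr_ge0// mulr_ge0// powR_ge0.
  rewrite (gtr0_norm an0) (ger0_norm rate0) in arate.
  move: L1; rewrite !ge_max => /andP[L1 /andP[L2 L3]].
  (* At first only [alpha < 1], that is [0 <= tau], is available; [rate_lower] then makes tau
     large. *)
  have a1 : 0 < alpha n <= expR (- 0 ^+ 2) by rewrite an0/= expr0n/= oppr0 expR0 ltW.
  have [tau tau0 aE] := gaussian_scale (lexx 0) a1.
  rewrite aE in arate an0 an1 *.
  have e01 : 0 < e <= 1 by rewrite e0.
  have [tL rL] := rate_lower s0 n0 e01 tau0 L1 arate.
  have tt : t0 <= tau.
    by rewrite -(@ler_pXn2r _ 2)// ?nnegrE//; lra.
  have te : e^-1 `^ q^-1 <= tau.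
    by rewrite -(@ler_pXn2r _ 2)// ?nnegrE ?powR_ge0//; lra.
  have tqe : (tau `^ q)^-1 <= e.
    rewrite -[leRHS]invrK lef_pV2 ?posrE ?invr_gt0 ?powR_gt0//; last by lra.
    apply: (@le_trans _ _ ((e^-1 `^ q^-1) `^ q)).
      by rewrite -powRrM mulVf ?gt_eqF// powRr1 ?invr_ge0 ?(ltW e0).
    by apply: (le_powRq hq) => //; exact: powR_ge0.
  apply/andP; split; last first.
    apply: ge_ereal_sup => _ [theta th <-]; apply: (le_trans (covM _ _ _ _ tt s0 th)).
    by rewrite lee_fin /g ler_pM2l// lerD.
  have h01 : 0 < expR (- tau ^+ 2) < 1 by rewrite an0.
  have [tpos _] := threshold_is_threshold hdelta h01.
  have sn' : (s n <= n)%N by apply: leq_trans sn; rewrite leq_pmull.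
  have [theta th] := intermediate_signals_nonempty tpos sn'.
  apply: le_ereal_sup_tmp; exists (coverage delta (expR (- tau ^+ 2)) q M theta).
    by exists theta.
  exact: coverage_ge0.
apply/fine_cvgP; split.
  have := small 1 _; rewrite ltr01 lexx => /(_ isT).
  apply: filterS => n /andP[h1 h2].
  by rewrite ge0_fin_numE// (le_lt_trans h2)// ltry.
apply/cvgr0Pnorm_le => e e0.
pose e' := Num.min 1 (e / (3 * C)).
have e'0 : 0 < e' by rewrite lt_min ltr01 divr_gt0// mulr_gt0.
have e'1 : 0 < e' <= 1 by rewrite e'0 ge_min lexx.
apply: filterS (small e' e'1) => n /= /andP[].
move: (ereal_sup _) => [r| |]//=; rewrite !lee_fin => r0 re.
rewrite ger0_norm//; apply: (le_trans re); rewrite /g.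
have : e' <= e / (3 * C) by rewrite ge_min lexx orbT.
rewrite ler_pdivlMr ?mulr_gt0//; lra.
Unshelve. all: by end_near. Qed.

End asymptotics.

Theorem proposition1 (R : realType) (delta q : R)
    (hdelta : 0 < delta < 2) (hq : 0 < q <= 2) (hqdelta : delta < q) :
  exists2 alpha1 : R, 0 < alpha1 &
  forall (s : nat -> nat) (kappa1 : R) (alpha : nat -> R),
    s @ \oo --> \oo ->
    (fun n => (s n)%:R : R) =o_\oo (fun n => n%:R : R) ->
    0 < kappa1 ->
    (\forall n \near \oo, kappa1 * ln n%:R ^+ 2 <= (s n)%:R) ->
    (forall n, 0 < alpha n < 1) ->
  ((exists2 C : R, 0 < C &
      \forall n \near \oo, rate delta s n <= C * alpha n) ->
   (\forall n \near \oo, alpha n <= alpha1) ->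
   exists2 M : R, 0 < M &
     ereal_inf [set coverage delta (alpha n) q M theta0 |
                theta0 in l0_ball n (s n)] @[n --> \oo] --> 1%E)
  /\
  (alpha =o_\oo rate delta s ->
   forall M : R, 0 < M ->
     ereal_sup [set coverage delta (alpha n) q M theta0 |
                theta0 in intermediate_signals delta (alpha n) n (s n)]
       @[n --> \oo] --> 0%E).
Proof.
have [alpha1 alpha10 covers] := coverage_tendsto1 hdelta hq hqdelta.
exists alpha1 => // s kappa1 alpha soo so _ _ alpha01; split.
  exact: covers.
exact: coverage_tendsto0.
Qed.
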